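(* Let $\Omega\subset\mathbb{R}^2$ be an open and bounded domain with Lipschitz boundary, $\emptyset\neq\mathcal{D}\subset\Omega$ a finite ordered set with $\ell=\#\mathcal{D}$, $\nu>0$, $\eta>0$, $\mathbf{y}_\Omega\in\mathbf{L}^2(\Omega)$, $\alpha\in(0,2)$, and $\mathbf{a}_t<\mathbf{b}_t$ in $\mathbb{R}^2$ for $t\in\mathcal{D}$. Let $(\bar{\mathbf{y}},\bar{\mathcal{U}})$ be a local solution of problem (P) of the context such that $\bar{\mathbf{y}}$ is regular, let $\mathcal{O}(\bar{\mathcal{U}})$ be the neighborhood of $\bar{\mathcal{U}}$ described in the context, let $\mathcal{U}\in\mathcal{O}(\bar{\mathcal{U}})$, and let $\mathbf{y}_{\mathcal{U}}$ be the velocity component of $Q(\mathcal{U})$. If $(\mathbf{z},r)\in\mathbf{H}_0^1(\rho^{-1},\Omega)\times L^2(\rho^{-1},\Omega)/\mathbb{R}$ solves the adjoint problem $$\int_\Omega\left(\nu\nabla\mathbf{z}:\nabla\mathbf{w}-(\mathbf{y}_{\mathcal{U}}\cdot\nabla)\mathbf{z}\cdot\mathbf{w}+(\nabla\mathbf{y}_{\mathcal{U}})^{\intercal}\mathbf{z}\cdot\mathbf{w}-r\,\mathrm{div}\,\mathbf{w}\right)=\int_\Omega(\mathbf{y}_{\mathcal{U}}-\mathbf{y}_\Omega)\cdot\mathbf{w},\qquad\int_\Omega s\,\mathrm{div}\,\mathbf{z}=0$$ for all $(\mathbf{w},s)\in\mathbf{H}_0^1(\rho,\Omega)\times L^2(\rho,\Omega)/\mathbb{R}$,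 then $\mathbf{z}\in\mathbf{W}^{1,q}(\Omega)$ for some $q>2$. Consequently, $\mathbf{z}\in\mathbf{C}(\bar\Omega)$.
   Context: Controls: $\mathcal{U}=(\mathbf{u}_1,\dots,\mathbf{u}_\ell)\in[\mathbb{R}^2]^\ell$, components indexed by $t\in\mathcal{D}$; $\mathbb{U}_{ad}=\{\mathcal{V}\in[\mathbb{R}^2]^\ell:\mathbf{a}_t\le\mathbf{v}_t\le\mathbf{b}_t\ \forall t\in\mathcal{D}\}$ (componentwise). Cost: $J(\mathbf{y},\mathcal{U})=\frac12\|\mathbf{y}-\mathbf{y}_\Omega\|_{\mathbf{L}^2(\Omega)}^2+\frac{\eta}{2}\sum_{t\in\mathcal{D}}|\mathbf{u}_t|^2$. Weight: let $d_{\mathcal{D}}=\mathrm{dist}(\mathcal{D},\partial\Omega)$ if $\ell=1$ and $d_{\mathcal{D}}=\min\{\mathrm{dist}(\mathcal{D},\partial\Omega),\min\{|t-t'|:t,t'\in\mathcal{D},t\ne t'\}\}$ otherwise. If $\ell=1$, $\mathcal{D}=\{t\}$, then $\rho(x)=|x-t|^\alpha$; otherwise $\rho(x)=|x-t|^\alpha$ if there is $t\in\mathcal{D}$ with $|x-t|<d_{\mathcal{D}}/2$, and $\rho(x)=1$ if $|x-t|\ge d_{\mathcal{D}}/2$ for all $t\in\mathcal{D}$. Spaces: for a weight $\omega$, $\|f\|_{L^2(\omega,\Omega)}^2=\int_\Omega|f|^2\omega$; $H^1(\omega,\Omega)$ consists of $f\in L^2(\omega,\Omega)$ with weak gradient in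 $L^2(\omega,\Omega)$, with norm $(\|f\|^2_{L^2(\omega,\Omega)}+\|\nabla f\|^2_{L^2(\omega,\Omega)})^{1/2}$; $H_0^1(\omega,\Omega)$ is the closure of $C_0^\infty(\Omega)$ in it. Bold letters denote $\mathbb{R}^2$-valued versions; $/\mathbb{R}$ is the quotient by constants. $\mathbf{V}(\rho,\Omega)=\{\mathbf{v}\in\mathbf{H}_0^1(\rho,\Omega):\mathrm{div}\,\mathbf{v}=0\}$. Convention: $(\nabla\mathbf{y})_{ij}=\partial_jy_i$. State equation: a weak solution associated to $\mathcal{U}$ is a pair $(\mathbf{y},p)\in\mathbf{H}_0^1(\rho,\Omega)\times L^2(\rho,\Omega)/\mathbb{R}$ with $\int_{\Omega}(\nu\nabla\mathbf{y}:\nabla\mathbf{v}-\mathbf{y}\otimes\mathbf{y}:\nabla\mathbf{v}-p\,\mathrm{div}\,\mathbf{v})=\sum_{t\in\mathcal{D}}\langle\mathbf{u}_t\delta_t,\mathbf{v}\rangle$ and $\int_\Omega q\,\mathrm{div}\,\mathbf{y}=0$ for all $(\mathbf{v},q)\in\mathbf{H}_0^1(\rho^{-1},\Omega)\times L^2(\rho^{-1},\Omega)/\mathbb{R}$. Here $\langle\mathbf{u}_t\delta_t,\mathbf{v}\rangle=\mathbf{u}_t\cdot\mathbf{v}(t)$ for smooth $\mathbf{v}$, extended by continuity to an element of $\mathbf{H}_0^1(\rho^{-1},\Omega)'$. The velocity of such a solution is known to belong to $\mathbf{W}_0^{1,p}(\Omega)$ for $p\in(4/3-\epsilon,2)$,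 with $\epsilon=\epsilon(\Omega)>0$. Regular: the velocity $\mathbf{\Phi}$ of a weak solution associated to a control in $\mathbb{U}_{ad}$ is regular if for every $\mathbf{g}\in\mathbf{H}^{-1}(\Omega)$ the problem of finding $(\boldsymbol\theta,\xi)\in\mathbf{H}_0^1(\Omega)\times L^2(\Omega)/\mathbb{R}$ with $\int_\Omega[(\nu\nabla\boldsymbol\theta-\mathbf{\Phi}\otimes\boldsymbol\theta-\boldsymbol\theta\otimes\mathbf{\Phi}):\nabla\mathbf{w}-\xi\,\mathrm{div}\,\mathbf{w}]=\langle\mathbf{g},\mathbf{w}\rangle$, $\int_\Omega s\,\mathrm{div}\,\boldsymbol\theta=0$ for all $(\mathbf{w},s)\in\mathbf{H}_0^1(\Omega)\times L^2(\Omega)/\mathbb{R}$ is well-posed (unique solution depending continuously on $\mathbf{g}$). Problem (P): minimize $J(\mathbf{y},\mathcal{U})$ over $(\mathbf{y},\mathcal{U})\in\mathbf{H}_0^1(\rho,\Omega)\times\mathbb{U}_{ad}$ such that $\mathbf{y}$ is the velocity of a weak solution of the state equation associated to $\mathcal{U}$ (feasible pairs). A feasible pair $(\bar{\mathbf{y}},\bar{\mathcal{U}})$ is a local solution if there are neighborhoods $\mathcal{A}\subset\mathbf{H}_0^1(\rho,\Omega)$ of $\bar{\mathbf{y}}$ and $\mathcal{B}\subset[\mathbb{R}^2]^\ell\cap\mathbb{U}_{ad}$ of $\bar{\mathcal{U}}$ (relative to $\mathbb{U}_{ad}$) with $J(\bar{\mathbf{y}},\bar{\mathcal{U}})\le J(\mathbf{y},\mathcal{U})$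 for all feasible $(\mathbf{y},\mathcal{U})\in\mathcal{A}\times\mathcal{B}$. Local solution map: when $\bar{\mathbf{y}}$ is regular, with associated pressure $\bar p$, there are open neighborhoods $\mathcal{O}(\bar{\mathcal{U}})\subset[\mathbb{R}^2]^\ell$, $\mathcal{O}(\bar{\mathbf{y}})\subset\mathbf{V}(\rho,\Omega)$, $\mathcal{O}(\bar p)\subset L^2(\rho,\Omega)/\mathbb{R}$ of $\bar{\mathcal{U}},\bar{\mathbf{y}},\bar p$ and a $C^2$ map $Q:\mathcal{O}(\bar{\mathcal{U}})\to\mathcal{O}(\bar{\mathbf{y}})\times\mathcal{O}(\bar p)$ with $Q(\bar{\mathcal{U}})=(\bar{\mathbf{y}},\bar p)$ such that for each $\mathcal{U}\in\mathcal{O}(\bar{\mathcal{U}})$, $Q(\mathcal{U})=(\mathbf{y}_{\mathcal{U}},p_{\mathcal{U}})$ is the unique weak solution associated to $\mathcal{U}$ in $\mathcal{O}(\bar{\mathbf{y}})\times\mathcal{O}(\bar p)$. *)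

(* Defs.v *)
From HB Require Import structures.
From mathcomp Require Import all_boot all_order all_algebra.
From mathcomp Require Import all_classical all_reals all_analysis.
Import Order.TTheory GRing.Theory Num.Theory.
Import numFieldNormedType.Exports.

Set Implicit Arguments.
Unset Strict Implicit.
Unset Printing Implicit Defensive.

Local Open Scope classical_set_scope.
Local Open Scope ring_scope.

(* Elements of Lebesgue and Sobolev spaces are represented by functions, not by
   almost-everywhere classes, and elements of a quotient by the constants by
   any representative.  The norms below are therefore seminorms on the
   functions, uniqueness is uniqueness of the classes, and vector fields are
   row-vector valued. *)

Section Plane.
Context {R : realType}.

Definition plane : Type := (R * R)%type.
Definition vfield : Type := plane -> 'rV[R]_2.

Definition leb2 : {measure set (measurableTypeR R * measurableTypeR R) -> \bar R} :=
  (@lebesgue_measure R \x @lebesgue_measure R)%E.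

(* The library norm on R * R is the max norm. *)
Definition edist (x y : plane) : R :=
  Num.sqrt ((x.1 - y.1) ^+ 2 + (x.2 - y.2) ^+ 2).

Definition dir (j : 'I_2) : plane := if j == ord0 then (1, 0) else (0, 1).

Definition vcomp (v : vfield) (i : 'I_2) : plane -> R := fun x => v x ord0 i.

Definition dot (u v : 'rV[R]_2) : R := \sum_i u ord0 i * v ord0 i.
Definition tensor (u v : 'rV[R]_2) : 'M[R]_2 := u^T *m v.
Definition frob (A B : 'M[R]_2) : R := \sum_i \sum_j A i j * B i j.

Definition bdry (Omega : set plane) : set plane := closure Omega `\` interior Omega.

(* Near each boundary point, in suitably rotated coordinates (a, b) centred at
   that point, Omega is the part of a rectangle strictly above the graph of a
   Lipschitz function. *)
Definition lipschitz_boundary (Omega : set plane) : Prop :=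
  forall x, bdry Omega x ->
  exists (c s r h : R) (gamma : R -> R),
    [/\ c ^+ 2 + s ^+ 2 = 1, 0 < r, 0 < h, lipschitz gamma &
        forall a b, `|a| < r -> `|b| < h ->
          Omega (x.1 + a * c - b * s, x.2 + a * s + b * c) <-> gamma a < b].

Definition lipschitz_domain (Omega : set plane) : Prop :=
  [/\ open Omega, connected Omega, bounded_set Omega & lipschitz_boundary Omega].

Fixpoint Ck (k : nat) (f : plane -> R) : Prop :=
  continuous f /\
  if k is k'.+1 then
    forall j, (forall x, derivable f x (dir j)) /\ Ck k' (fun x => 'D_(dir j) f x)
  else True.

(* C_0^oo(Omega) *)
Definition test_fun (Omega : set plane) (phi : plane -> R) : Prop :=
  (forall k, Ck k phi) /\
  exists K, [/\ compact K, K `<=` Omega & forall x, ~ K x -> phi x = 0].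

Definition test_field (Omega : set plane) (phi : vfield) : Prop :=
  forall i, test_fun Omega (vcomp phi i).

End Plane.
Arguments plane : clear implicits.
Arguments vfield : clear implicits.
Arguments leb2 : clear implicits.

Section Sobolev.
Context {R : realType}.
Variable Omega : set (plane R).

Definition intO (f : plane R -> R) : R := \int[leb2 R]_(x in Omega) f x.

Definition measO (f : plane R -> R) : Prop :=
  measurable_fun (Omega : set (measurableTypeR R * measurableTypeR R)) f.

Definition aeO (A : Type) (f g : plane R -> A) : Prop :=
  {ae leb2 R, forall x, Omega x -> f x = g x}.

Definition loc_integrable (f : plane R -> R) : Prop :=
  measO f /\
  forall K : set (plane R), compact K -> K `<=` Omega ->
    (leb2 R).-integrable K (EFin \o f).

Definition is_wpartial (j : 'I_2) (f g : plane R -> R) : Prop :=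
  [/\ loc_integrable f, loc_integrable g &
      forall phi, test_fun Omega phi ->
        intO (fun x => f x * 'D_(dir j) phi x) = - intO (fun x => g x * phi x)].

(* Some weak partial derivative, if there is one; any two agree a.e. *)
Definition wpartial (j : 'I_2) (f : plane R -> R) : plane R -> R :=
  xget (fun=> 0) [set g | is_wpartial j f g].

Definition wgrad (v : vfield R) (x : plane R) : 'M[R]_2 :=
  \matrix_(i, j) wpartial j (vcomp v i) x.
Definition wdiv (v : vfield R) (x : plane R) : R := \tr (wgrad v x).

Definition L2w (omega : plane R -> R) (f : plane R -> R) : Prop :=
  measO f /\ (\int[leb2 R]_(x in Omega) (`|f x| ^+ 2 * omega x)%:E < +oo)%E.

Definition Lq (q : R) (f : plane R -> R) : Prop :=
  measO f /\ (\int[leb2 R]_(x in Omega) (`|f x| `^ q)%:E < +oo)%E.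

Definition sobolev1 (X : set (plane R -> R)) (f : plane R -> R) : Prop :=
  X f /\ forall j, exists g, is_wpartial j f g /\ X g.

Definition L2v (omega : plane R -> R) (v : vfield R) : Prop :=
  forall i, L2w omega (vcomp v i).
Definition H1v (omega : plane R -> R) (v : vfield R) : Prop :=
  forall i, sobolev1 (L2w omega) (vcomp v i).
Definition W1qv (q : R) (v : vfield R) : Prop :=
  forall i, sobolev1 (Lq q) (vcomp v i).

(* Meaningful on the corresponding space only: the real-valued integral of a
   non-integrable function is a default value. *)
Definition L2norm (omega : plane R -> R) (f : plane R -> R) : R :=
  Num.sqrt (intO (fun x => `|f x| ^+ 2 * omega x)).
Definition L2vnorm (omega : plane R -> R) (v : vfield R) : R :=
  Num.sqrt (intO (fun x => dot (v x) (v x) * omega x)).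
Definition H1vnorm (omega : plane R -> R) (v : vfield R) : R :=
  Num.sqrt (L2vnorm omega v ^+ 2
            + intO (fun x => frob (wgrad v x) (wgrad v x) * omega x)).

(* Norm of L^2(omega, Omega) / R *)
Definition L2qnorm (omega : plane R -> R) (p : plane R -> R) : R :=
  inf [set L2norm omega (fun x => p x - c) | c in [set: R]].

Definition H01v (omega : plane R -> R) (v : vfield R) : Prop :=
  H1v omega v /\
  forall eps, 0 < eps ->
    exists2 phi, test_field Omega phi & H1vnorm omega (v - phi) < eps.

Definition divfree (omega : plane R -> R) (v : vfield R) : Prop :=
  H01v omega v /\ aeO (wdiv v) (fun=> 0).

Definition same_pair (y : vfield R) (p : plane R -> R)
    (y' : vfield R) (p' : plane R -> R) : Prop :=
  aeO y y' /\ exists c, aeO p (fun x => p' x + c).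

(* <u delta_t, v>: the limit of u . phi(t) as phi -> v in H^1(omega, Omega),
   phi in C_0^oo(Omega). *)
Definition dirac_pairing (omega : plane R -> R) (t : plane R) (u : 'rV[R]_2)
    (v : vfield R) : R :=
  xget 0 [set c : R | forall eps, 0 < eps -> exists2 del, 0 < del &
    forall phi, test_field Omega phi -> H1vnorm omega (v - phi) < del ->
      `|dot u (phi t) - c| < eps].

(* Continuous linear forms on H_0^1(Omega), no weight *)
Definition Hm1 (g : vfield R -> R) : Prop :=
  (forall (c : R) v w, H01v (fun=> 1) v -> H01v (fun=> 1) w ->
     g (c *: v + w) = c * g v + g w) /\
  exists M : R, forall w, H01v (fun=> 1) w -> `|g w| <= M * H1vnorm (fun=> 1) w.

Definition continuous_on_closure (z : vfield R) : Prop :=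
  exists Z : plane R -> 'rV[R]_2,
    {within closure Omega, continuous Z} /\ aeO z Z.

End Sobolev.

(* S is the set of representatives of a normed space and N its norm; the norm
   only determines elements up to N (x - y) = 0. *)
Section SeminormedSpaces.
Context {R : realType}.
Variables (X : lmodType R) (S : set X) (N : X -> R).

Definition nbhd_in (x : X) (A : set X) : Prop :=
  A `<=` S /\ exists2 eps, 0 < eps & forall x', S x' -> N (x' - x) < eps -> A x'.

Definition open_in (A : set X) : Prop :=
  A `<=` S /\ forall x, A x -> nbhd_in x A.

(* F1 and F2 are the first and second Frechet derivatives of F on the open set
   O; they are bounded because the source is finite dimensional. *)
Definition C2_map (m n : nat) (O : set 'M[R]_(m, n)) (F : 'M[R]_(m, n) -> X) : Prop :=
  exists (F1 : 'M[R]_(m, n) -> 'M[R]_(m, n) -> X)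
         (F2 : 'M[R]_(m, n) -> 'M[R]_(m, n) -> 'M[R]_(m, n) -> X),
  forall u, O u ->
  [/\ [/\ S (F u), forall h, S (F1 u h) & forall h k, S (F2 u h k)],
      [/\ linear (F1 u), forall h, linear (F2 u h) & forall k, linear ((F2 u)^~ k)],
      forall eps, 0 < eps -> exists2 del, 0 < del &
        forall h, `|h| < del -> O (u + h) ->
          N (F (u + h) - F u - F1 u h) <= eps * `|h|,
      forall eps, 0 < eps -> exists2 del, 0 < del &
        forall h k, `|h| < del -> O (u + h) ->
          N (F1 (u + h) k - F1 u k - F2 u h k) <= eps * `|h| * `|k| &
      forall eps, 0 < eps -> exists2 del, 0 < del &
        forall h k k', `|h| < del -> O (u + h) ->
          N (F2 (u + h) k k' - F2 u k k') <= eps * `|k| * `|k'|].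

End SeminormedSpaces.

Section ControlProblem.
Context {R : realType}.
Variables (Omega : set (plane R)) (l : nat) (D : 'I_l -> plane R).

Definition dist_bdry : R :=
  inf [set d | exists t x, bdry Omega x /\ d = edist (D t) x].
Definition min_dist : R :=
  inf [set d | exists t t', t != t' /\ d = edist (D t) (D t')].
Definition dD : R := if l == 1%N then dist_bdry else Num.min dist_bdry min_dist.

(* For l > 1 at most one t satisfies |x - t| < dD / 2. *)
Definition rho (alpha : R) (x : plane R) : R :=
  if [pick t | (l == 1%N) || (edist x (D t) < dD / 2)] is Some t
  then edist x (D t) `^ alpha else 1.

Definition irho (alpha : R) (x : plane R) : R := (rho alpha x)^-1.

(* Row t of a control is the vector u_t. *)
Definition admissible (a b : 'M[R]_(l, 2)) : set 'M[R]_(l, 2) :=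
  [set U | forall t i, a t i <= U t i <= b t i].

Definition cost (eta : R) (yO : vfield R) (y : vfield R) (U : 'M[R]_(l, 2)) : R :=
  2^-1 * L2vnorm Omega (fun=> 1) (y - yO) ^+ 2
  + eta / 2 * \sum_t dot (row t U) (row t U).

Variables (nu alpha : R).

Definition weak_solution (U : 'M[R]_(l, 2)) (y : vfield R) (p : plane R -> R) : Prop :=
  [/\ H01v Omega (rho alpha) y, L2w Omega (rho alpha) p,
      forall v, H01v Omega (irho alpha) v ->
        intO Omega (fun x => nu * frob (wgrad Omega y x) (wgrad Omega v x)
                             - frob (tensor (y x) (y x)) (wgrad Omega v x)
                             - p x * wdiv Omega v x)
        = \sum_t dirac_pairing Omega (irho alpha) (D t) (row t U) v &
      forall q, L2w Omega (irho alpha) q ->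
        intO Omega (fun x => q x * wdiv Omega y x) = 0].

Definition linearized_solution (Phi : vfield R) (g : vfield R -> R)
    (theta : vfield R) (xi : plane R -> R) : Prop :=
  [/\ H01v Omega (fun=> 1) theta, L2w Omega (fun=> 1) xi,
      forall w, H01v Omega (fun=> 1) w ->
        intO Omega (fun x =>
          frob (nu *: wgrad Omega theta x - tensor (Phi x) (theta x)
                - tensor (theta x) (Phi x)) (wgrad Omega w x)
          - xi x * wdiv Omega w x) = g w &
      forall s, L2w Omega (fun=> 1) s ->
        intO Omega (fun x => s x * wdiv Omega theta x) = 0].

(* Continuous dependence: `|g w - g' w| <= del * |w| for all w says that g and
   g' are at distance at most del in H^{-1}(Omega). *)
Definition regular (Phi : vfield R) : Prop :=
  [/\ forall g, Hm1 Omega g -> exists theta xi, linearized_solution Phi g theta xi,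
      forall g theta xi theta' xi', Hm1 Omega g ->
        linearized_solution Phi g theta xi ->
        linearized_solution Phi g theta' xi' ->
        same_pair Omega theta xi theta' xi' &
      forall g theta xi, Hm1 Omega g -> linearized_solution Phi g theta xi ->
        forall eps, 0 < eps -> exists2 del, 0 < del &
        forall g' theta' xi', Hm1 Omega g' ->
          linearized_solution Phi g' theta' xi' ->
          (forall w, H01v Omega (fun=> 1) w ->
             `|g w - g' w| <= del * H1vnorm Omega (fun=> 1) w) ->
          H1vnorm Omega (fun=> 1) (theta - theta')
          + L2qnorm Omega (fun=> 1) (xi - xi') < eps].

Definition feasible (a b : 'M[R]_(l, 2)) (y : vfield R) (U : 'M[R]_(l, 2)) : Prop :=
  admissible a b U /\ exists p, weak_solution U y p.

Definition local_solution (eta : R) (yO : vfield R) (a b : 'M[R]_(l, 2))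
    (ybar : vfield R) (Ubar : 'M[R]_(l, 2)) : Prop :=
  feasible a b ybar Ubar /\
  exists A B,
    [/\ nbhd_in (H01v Omega (rho alpha)) (H1vnorm Omega (rho alpha)) ybar A,
        within (admissible a b) (nbhs Ubar) B &
        forall y U, A y -> B U -> feasible a b y U ->
          cost eta yO ybar Ubar <= cost eta yO y U].

Definition state_space : set (vfield R * (plane R -> R)) :=
  [set yp | divfree Omega (rho alpha) yp.1 /\ L2w Omega (rho alpha) yp.2].
Definition state_norm (yp : vfield R * (plane R -> R)) : R :=
  H1vnorm Omega (rho alpha) yp.1 + L2qnorm Omega (rho alpha) yp.2.

Definition local_solution_map (Ubar : 'M[R]_(l, 2)) (ybar : vfield R)
    (pbar : plane R -> R) (OU : set 'M[R]_(l, 2)) (Oy : set (vfield R))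
    (Op : set (plane R -> R))
    (Q : 'M[R]_(l, 2) -> vfield R * (plane R -> R)) : Prop :=
  [/\ [/\ open OU, OU Ubar,
          open_in (divfree Omega (rho alpha)) (H1vnorm Omega (rho alpha)) Oy /\ Oy ybar &
          open_in (L2w Omega (rho alpha)) (L2qnorm Omega (rho alpha)) Op /\ Op pbar],
      C2_map state_space state_norm OU Q,
      same_pair Omega (Q Ubar).1 (Q Ubar).2 ybar pbar &
      forall U, OU U ->
        [/\ Oy (Q U).1, Op (Q U).2, weak_solution U (Q U).1 (Q U).2 &
            forall y p, Oy y -> Op p -> weak_solution U y p ->
              same_pair Omega y p (Q U).1 (Q U).2]].

(* With row vectors, (y . nabla) z is y *m (wgrad z)^T and (nabla y)^T z is
   z *m wgrad y. *)
Definition adjoint_solution (yO y z : vfield R) (r : plane R -> R) : Prop :=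
  [/\ H01v Omega (irho alpha) z, L2w Omega (irho alpha) r,
      forall w, H01v Omega (rho alpha) w ->
        intO Omega (fun x => nu * frob (wgrad Omega z x) (wgrad Omega w x)
                             - dot (y x *m (wgrad Omega z x)^T) (w x)
                             + dot (z x *m wgrad Omega y x) (w x)
                             - r x * wdiv Omega w x)
        = intO Omega (fun x => dot (y x - yO x) (w x)) &
      forall s, L2w Omega (rho alpha) s ->
        intO Omega (fun x => s x * wdiv Omega z x) = 0].

End ControlProblem.

(* Main.v *)
Require Import Defs.
From HB Require Import structures.
From mathcomp Require Import all_boot all_order all_algebra.
From mathcomp Require Import all_classical all_reals all_analysis.
From mathcomp Require Import measurable_realfun ring lra.
Import Order.TTheory GRing.Theory Num.Theory.
Import numFieldNormedType.Exports.
Set Implicit Arguments.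
Unset Strict Implicit.
Unset Printing Implicit Defensive.
Local Open Scope classical_set_scope.
Local Open Scope ring_scope.

(* Savaré's translation method shows that the gradient of z is slightly better than square
   integrable.  Let phi be a test field close to z and chi a cutoff around a point of the
   closure of Omega.  For h in a cone pointing out of Omega, chi (phi(. + h) - phi) vanishes
   outside Omega, and inserting it in the adjoint equation controls the integral of
   chi grad phi . (grad phi(. + h) - grad phi).  Since |b - a|^2 = |b|^2 - |a|^2 - 2 a . (b - a)
   and the integral of chi (|grad phi(. + h)|^2 - |grad phi|^2) is O(|h|), the integral of
   chi |grad z(. + h) - grad z|^2 is O(|h|^(1/N)) for some N; here the convective terms are
   controlled because z lies in every L^p, y in some L^p with p > 2, and grad y in L^2(rho).
   Averaging over the directions h of the cone bounds the integral of chi |grad z|^2 over the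
   superlevel sets of |grad z|, which gives grad z in L^q for some q > 2.  The averages of z
   over squares of side 2^-n then converge uniformly to a continuous representative. *)

(** * Lebesgue measure on the plane *)

(** Two obstacles shape the proof. Omega is only Lipschitz, so a translate of a test field may leave
    it; increments are available only in a cone of directions, and this is enough because such a
    cone contains a square of directions over which to average. Moreover y is neither bounded nor in
    H^1, its gradient being square integrable only against a weight that vanishes on D. What pays
    for y is the increment of the test field: it is O(r) in L^2 and bounded in every L^p, hence each
    power of it is small by interpolation. An integer m with alpha (m+1)/(m-1) < 2 fixes the
    exponents: y is in L^(2(m+1)/m) and the inverse weight in L^((m+1)/m). The worst convective term
    then forces r = th^N with N = 4(m+1), and the gain is q - 2 = 1/(2N). Every estimate is a bound
    on the integral of a nonnegative function. Hölder's inequality is replaced throughout by Young's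
    with a parameter, chosen as a power of the scale. Test fields carry the estimates because their
    truncated increments are again test fields; their distance to z is tied to r. *)

Section PlaneMeasure.
Context {R : realType}.

Definition mplane : measurableType _ := (measurableTypeR R * measurableTypeR R)%type.

(** The sigma-algebra is that of the product, so an open set enters it as the countable union of the
    open rational rectangles that it contains. *)
Lemma open_measurable_plane (A : set (plane R)) : open A -> measurable (A : set mplane).
Proof.
move=> oA.
pose rect (q : rat * rat * (rat * rat)) : set (plane R) :=
  `]ratr q.1.1 : R, ratr q.1.2[ `*` `]ratr q.2.1, ratr q.2.2[.
pose F (q : rat * rat * (rat * rat)) : set (plane R) :=
  if `[< rect q `<=` A >] then rect q else set0.
have -> : A = \bigcup_q F q.
  apply/seteqP; split=> [x Ax|x [q _]]; last first.
    by rewrite /F; case: asboolP => // sA /sA.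
  have /nbhs_ballP[e /= e0 eA] := open_nbhs_nbhs (conj oA Ax).
  have h1 : x.1 - e < x.1 by rewrite ltrBlDr ltrDl.
  have h2 : x.1 < x.1 + e by rewrite ltrDl.
  have h3 : x.2 - e < x.2 by rewrite ltrBlDr ltrDl.
  have h4 : x.2 < x.2 + e by rewrite ltrDl.
  have [a /[!in_itv]/= /andP[a1 a2]] := rat_in_itvoo h1.
  have [b /[!in_itv]/= /andP[b1 b2]] := rat_in_itvoo h2.
  have [c /[!in_itv]/= /andP[c1 c2]] := rat_in_itvoo h3.
  have [d /[!in_itv]/= /andP[d1 d2]] := rat_in_itvoo h4.
  exists ((a, b), (c, d)) => //; rewrite /F; case: asboolP => [_|].
    by split; rewrite /= in_itv/= ?a2 ?b1 ?c2 ?d1.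
  case=> y [/=]; rewrite !in_itv/= => /andP[ya yb] /andP[yc yd].
  by apply: eA; split; rewrite /ball/= ltr_norml; apply/andP; split; lra.
apply: countable_bigcupT_measurable => [|q]; first exact: countableP.
rewrite /F; case: asboolP => // _; apply: measurableX; exact: measurable_itv.
Qed.

Lemma closed_measurable_plane (A : set (plane R)) : closed A -> measurable (A : set mplane).
Proof.
move=> cA; rewrite -(setCK A); apply: measurableC.
by apply: open_measurable_plane; exact: closed_openC.
Qed.

Lemma continuous_measurable_plane (f : plane R -> R) :
  continuous f -> measurable_fun (setT : set mplane) (f : mplane -> R).
Proof.
move=> cf; apply: (measurability _ (RGenOpens.measurableE R)).
move=> _ [_ [a [b ->] <-]].
rewrite setTI; apply: open_measurable_plane.
by move/continuousP : cf; apply; exact: interval_open.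
Qed.

Local Notation mu := (@lebesgue_measure R).

Lemma measurable_addr1 (c : R) :
  measurable_fun setT (fun x : measurableTypeR R => (x + c : measurableTypeR R)).
Proof.
apply: (@continuous_measurable_fun R (fun x => x + c)) => x.
exact: cvgD (@cvg_id _ _) (cvg_cst _).
Qed.

(** Uniqueness of Lebesgue measure: both sides are measures in A that agree on half-open intervals.
    In the plane, uniqueness of the product measure plays the same part. *)
Lemma lebesgue_measure_shift (c : R) (A : set (measurableTypeR R)) : measurable A ->
  mu ((fun x => x + c) @^-1` A) = mu A.
Proof.
move=> mA.
pose m' : {measure set (measurableTypeR R) -> \bar R} :=
  pushforward mu (fun x : measurableTypeR R => (x + c : measurableTypeR R)).
apply/esym; apply: (@lebesgue_measure_unique R (m' (measurable_addr1 c))) => //= _ [[a b]] _ <-.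
rewrite /pushforward.
rewrite (_ : _ @^-1` _ = `]a - c, b - c]%classic); last first.
  by apply/seteqP; split => x /=; rewrite !in_itv/= ltrBlDr lerBrDr.
by rewrite !lebesgue_measure_itv/= !lte_fin ltrD2r -!EFinB opprB addrA subrK.
Qed.

Lemma measurable_shift (h : plane R) :
  measurable_fun (setT : set mplane) (fun x : mplane => (x.1 + h.1, x.2 + h.2) : mplane).
Proof.
apply: measurable_fun_pair.
  by apply: (measurableT_comp (measurable_addr1 h.1)); exact: measurable_fst.
by apply: (measurableT_comp (measurable_addr1 h.2)); exact: measurable_snd.
Qed.

Lemma leb2_shift (h : plane R) (A : set mplane) : measurable A ->
  leb2 R ((fun x : mplane => (x.1 + h.1, x.2 + h.2) : mplane) @^-1` A) = leb2 R A.
Proof.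
move=> mA.
pose m' : {measure set mplane -> \bar R} :=
  pushforward (leb2 R) (fun x : mplane => (x.1 + h.1, x.2 + h.2) : mplane).
apply/esym; apply: (@product_measure_unique _ _ _ _ _ mu mu (m' (measurable_shift h))) => // B C mB mC.
rewrite /m' /= /pushforward.
rewrite (_ : _ @^-1` _ = ((fun x => x + h.1) @^-1` B) `*` ((fun x => x + h.2) @^-1` C))//.
rewrite product_measure1E.
- by congr (_ * _)%E; exact: lebesgue_measure_shift.
- by rewrite -[X in measurable X]setTI; exact: measurable_addr1.
- by rewrite -[X in measurable X]setTI; exact: measurable_addr1.
Qed.

Definition pint (f : plane R -> R) : \bar R := (\int[leb2 R]_x (f x)%:E)%E.

Definition pmeas (f : plane R -> R) : Prop :=
  measurable_fun (setT : set mplane) (f : mplane -> R).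

Lemma pmeas_shift (h : plane R) f : pmeas f -> pmeas (fun x => f (x + h)).
Proof.
move=> mf; apply: (measurableT_comp mf (measurable_shift h)).
Qed.

Lemma pint_shift (h : plane R) f : pmeas f -> (forall x, 0 <= f x) ->
  pint (fun x => f (x + h)) = pint f.
Proof.
move=> mf f0; rewrite /pint.
have := @ge0_integral_pushforward _ _ _ _ _ _ (measurable_shift h) (leb2 R) setT (EFin \o f)
  measurableT.
rewrite preimage_setT => <-.
- apply: eq_measure_integral; first exact: measurable_shift.
  by move=> m A mA _; exact: (leb2_shift h mA).
- exact/measurable_EFinP.
- by move=> x _; rewrite lee_fin.
Qed.

Lemma pint_ge0 f : (forall x, 0 <= f x) -> (0 <= pint f)%E.
Proof. by move=> f0; apply: integral_ge0 => x _; rewrite lee_fin. Qed.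

Lemma pint_tonelli12 f : pmeas f -> (forall x, 0 <= f x) ->
  pint f = (\int[mu]_x \int[mu]_y (f (x, y))%:E)%E.
Proof.
move=> mf f0; apply: (@fubini_tonelli1 _ _ _ _ _ mu mu (EFin \o f)).
  exact/measurable_EFinP.
by move=> x; rewrite lee_fin.
Qed.

Lemma pint_tonelli21 f : pmeas f -> (forall x, 0 <= f x) ->
  pint f = (\int[mu]_y \int[mu]_x (f (x, y))%:E)%E.
Proof.
move=> mf f0; apply: (@fubini_tonelli2 _ _ _ _ _ mu mu (EFin \o f)).
  exact/measurable_EFinP.
by move=> x; rewrite lee_fin.
Qed.

(** Measurability, sign and bound are kept together, so that domination, sums, multiples and
    translates are one-step rules with explicit constants and no norm has to be formed. *)
Definition intle (f : plane R -> R) (C : R) : Prop :=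
  [/\ pmeas f, forall x, 0 <= f x & (pint f <= C%:E)%E].

Lemma intle_mono f g C : pmeas f -> (forall x, 0 <= f x <= g x) ->
  intle g C -> intle f C.
Proof.
move=> mf fg [mg g0 gC]; split => // [x|]; first by have /andP[] := fg x.
apply: le_trans gC; apply: ge0_le_integral => //.
- by move=> x _; rewrite lee_fin; have /andP[] := fg x.
- exact/measurable_EFinP.
- exact/measurable_EFinP.
- by move=> x _; rewrite lee_fin; have /andP[] := fg x.
Qed.

Lemma intle_weak f C C' : C <= C' -> intle f C -> intle f C'.
Proof. by move=> CC [mf f0 fC]; split => //; rewrite (le_trans fC)// lee_fin. Qed.

Lemma intleD f g C C' : intle f C -> intle g C' ->
  intle (fun x => f x + g x) (C + C').
Proof.
move=> [mf f0 fC] [mg g0 gC]; split.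
- exact: measurable_funD.
- by move=> x; rewrite addr_ge0.
- rewrite /pint (_ : (\int[_]_x _)%E = (pint f + pint g)%E).
    by rewrite EFinD; exact: leeD.
  rewrite /pint -ge0_integralD//.
  + by move=> x _; rewrite lee_fin.
  + exact/measurable_EFinP.
  + by move=> x _; rewrite lee_fin.
  + exact/measurable_EFinP.
Qed.

Lemma intleZ k f C : 0 <= k -> intle f C -> intle (fun x => k * f x) (k * C).
Proof.
move=> k0 [mf f0 fC]; split.
- exact: measurable_funM.
- by move=> x; rewrite mulr_ge0.
- rewrite /pint (_ : (\int[_]_x _)%E = (k%:E * pint f)%E).
    by rewrite EFinM; apply: lee_wpmul2l.
  rewrite /pint -ge0_integralZl//.
  + exact/measurable_EFinP.
  + by move=> x _; rewrite lee_fin.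
Qed.

Lemma intle_shift h f C : intle f C -> intle (fun x => f (x + h)) C.
Proof.
move=> [mf f0 fC]; split => //; first exact: pmeas_shift.
by rewrite pint_shift.
Qed.

Lemma intle_ge0 f C : intle f C -> 0 <= C.
Proof.
by move=> [mf f0]; rewrite -lee_fin; apply: le_trans; exact: pint_ge0.
Qed.

Lemma intle_exists f : pmeas f -> (forall x, 0 <= f x) -> (pint f < +oo)%E ->
  exists C, intle f C.
Proof.
move=> mf f0 ff; exists (fine (pint f)); split => //.
by rewrite fineK// ge0_fin_numE//; exact: pint_ge0.
Qed.

Lemma intle_lty f C : intle f C -> (pint f < +oo)%E.
Proof. by move=> [_ _ /le_lt_trans]; apply; rewrite ltry. Qed.

Lemma intle_sum (J : Type) (s : seq J) (f : J -> plane R -> R) (C : J -> R) :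
  (forall j, intle (f j) (C j)) ->
  intle (fun x => \sum_(j <- s) f j x) (\sum_(j <- s) C j).
Proof.
move=> fC; elim: s => [|a s IH].
  rewrite big_nil (_ : (fun _ => _) = cst 0); last by apply/funext => x; rewrite big_nil.
  split=> //; first exact: measurable_cst.
  by rewrite /pint integral0.
rewrite big_cons (_ : (fun _ => _) = fun x => f a x + \sum_(j <- s) f j x).
  exact: intleD.
by apply/funext => x; rewrite big_cons.
Qed.

Lemma intle0 : intle (fun=> 0) 0.
Proof.
split => //; first exact: measurable_cst.
by rewrite /pint integral0_eq.
Qed.

Lemma intle_integrable f g C : pmeas f -> (forall x, `|f x| <= g x) -> intle g C ->
  (leb2 R).-integrable setT (EFin \o f) /\ `|\int[leb2 R]_x f x| <= C.
Proof.
move=> mf fg gC.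
have h : intle (fun x => `|f x|) C.
  apply: intle_mono gC; last by move=> x; rewrite normr_ge0 fg.
  exact: measurableT_comp.
have i : (leb2 R).-integrable setT (EFin \o f).
  apply/integrableP; split; first exact/measurable_EFinP.
  exact: intle_lty h.
split => //; apply: (le_trans (le_normr_Rintegral _ i)) => //.
rewrite -lee_fin /Rintegral fineK; first by case: h.
rewrite ge0_fin_numE; first exact: intle_lty h.
by apply: integral_ge0 => x _; rewrite lee_fin.
Qed.

Lemma integrable_intle f : (leb2 R).-integrable setT (EFin \o f) ->
  pmeas f /\ exists C, intle (fun x => `|f x|) C.
Proof.
move=> /integrableP[/measurable_EFinP mf h]; split => //.
by apply: intle_exists => //; exact: measurableT_comp.
Qed.

End PlaneMeasure.

Section SigmaFinite.
Context {R : realType}.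
Local Notation mu := (@lebesgue_measure R).
Lemma sigma_finite_leb2 : sigma_finite setT (leb2 R).
Proof.
exists (fun n => (`]- n%:R, n%:R[ : set R) `*` (`]- n%:R, n%:R[ : set R)).
  apply/esym/seteqP; split => // -[x y] _.
  pose n := (Num.bound (`|x| + `|y|)).
  have h : `|x| + `|y| < n%:R by apply: archi_boundP; rewrite addr_ge0.
  have h1 := normr_ge0 x; have h2 := normr_ge0 y.
  by exists n => //; split; rewrite /= in_itv/= -ltr_norml; lra.
move=> n; split; first by apply: measurableX; exact: measurable_itv.
pose A : set (measurableTypeR R) := [set` `]- n%:R, n%:R[ ].
have mA : measurable A by exact: measurable_itv.
rewrite (_ : leb2 R _ = mu A * mu A)%E; last exact: (product_measure1E _ _ mA mA).
have : (mu A < +oo)%E by rewrite /A lebesgue_measure_itv/=; case: ifP; rewrite -?EFinB ltry.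
by move=> h; rewrite lte_mul_pinfty// ge0_fin_numE.
Qed.
End SigmaFinite.

(* An alias of [leb2] that carries the sigma-finite structure required by Fubini. *)
Definition sleb2 (R : realType) : set (@mplane R) -> \bar R := leb2 R.
HB.instance Definition _ (R : realType) := Measure.copy (@sleb2 R) (leb2 R).
HB.instance Definition _ (R : realType) := Measure_isSigmaFinite.Build _ _ _ (@sleb2 R) sigma_finite_leb2.

(** * Smooth functions and their translates *)

Section Smooth.
Context {R : realType}.
Implicit Types (f g : plane R -> R).

Lemma CkS k f : Ck k.+1 f -> Ck k f.
Proof.
elim: k f => [|k IH] f; first by case.
case=> cf df; split => // j; have [h1 h2] := df j; split => //.
exact: IH.
Qed.

Definition smooth f := forall k, Ck k f.

Lemma smooth_continuous f : smooth f -> continuous f.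
Proof. by move=> /(_ 0%N)[]. Qed.

Lemma smooth_derivable f j x : smooth f -> derivable f x (dir j).
Proof. by move=> /(_ 1%N)[_ /(_ j)[]]. Qed.

Lemma smooth_D f j : smooth f -> smooth ('D_(dir j) f).
Proof. by move=> sf k; have [_ /(_ j)[]] := sf k.+1. Qed.

Lemma Ck_cst k (c : R) : Ck k (fun=> c).
Proof.
elim: k c => [|k IH] c; first by split => // x; exact: cvg_cst.
split => [x|j]; first exact: cvg_cst.
split=> [x|]; first exact: derivable_cst.
rewrite (_ : 'D_ _ _ = fun=> 0)//.
by apply/funext => x; exact: derive_cst.
Qed.

Lemma CkD k f g : Ck k f -> Ck k g -> Ck k (fun x => f x + g x).
Proof.
elim: k f g => [|k IH] f g; first by move=> [cf _] [cg _]; split => // x; apply: cvgD; [exact: cf|exact: cg].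
move=> [cf df] [cg dg]; split => [x|j]; first by apply: cvgD; [exact: cf|exact: cg].
have [df1 df2] := df j; have [dg1 dg2] := dg j.
split=> [x|]; first exact: derivableD.
rewrite (_ : 'D_ _ _ = fun x => 'D_(dir j) f x + 'D_(dir j) g x); first exact: IH.
by apply/funext => x; rewrite deriveD.
Qed.

Lemma CkM k f g : Ck k f -> Ck k g -> Ck k (fun x => f x * g x).
Proof.
elim: k f g => [|k IH] f g; first by move=> [cf _] [cg _]; split => // x; apply: cvgM; [exact: cf|exact: cg].
move=> Cf Cg; have Cf' := CkS Cf; have Cg' := CkS Cg.
case: Cf => [cf df]; case: Cg => [cg dg]; split => [x|j]; first by apply: cvgM; [exact: cf|exact: cg].
have [df1 df2] := df j; have [dg1 dg2] := dg j.
split=> [x|]; first exact: derivableM.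
rewrite (_ : 'D_ _ _ = fun x => f x * 'D_(dir j) g x + g x * 'D_(dir j) f x).
  by apply: CkD; apply: IH.
by apply/funext => x; rewrite deriveM.
Qed.

Lemma derive_shift_plane f v h x : 'D_v (fun y => f (y + h)) x = 'D_v f (x + h).
Proof.
rewrite /derive; do 2 f_equal; apply/funext => t /=.
by rewrite !addrA.
Qed.

Lemma derivable_shift_plane f v h x :
  derivable f (x + h) v -> derivable (fun y => f (y + h)) x v.
Proof.
rewrite /derivable.
rewrite (_ : (fun t => _) = (fun t => t^-1 *: ((fun y => f (y + h)) (t *: v + x) - f (x + h))))//.
by apply/funext => t /=; rewrite !addrA.
Qed.

Lemma continuous_shift_plane f (h : plane R) : continuous f -> continuous (fun x : plane R => f (x + h)).
Proof.
move=> cf x.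
have h1 : (fun y : plane R => y + h) y @[y --> x] --> x + h.
  by apply: cvgD; [exact: cvg_id|exact: cvg_cst].
exact: (@cvg_comp _ _ _ (fun y : plane R => y + h) f _ _ _ h1 (cf (x + h))).
Qed.

Lemma Ck_shift k f (h : plane R) : Ck k f -> Ck k (fun x => f (x + h)).
Proof.
elim: k f => [|k IH] f; first by move=> [cf _]; split => //; exact: continuous_shift_plane.
move=> [cf df]; split => [|j]; first exact: continuous_shift_plane.
have [df1 df2] := df j.
split=> [x|]; first exact: derivable_shift_plane.
rewrite (_ : 'D_ _ _ = fun x => 'D_(dir j) f (x + h)); first exact: (IH _ df2).
by apply/funext => x; rewrite derive_shift_plane.
Qed.

Lemma smooth_cst c : smooth (fun=> c). Proof. by move=> k; exact: Ck_cst. Qed.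
Lemma smoothD f g : smooth f -> smooth g -> smooth (fun x => f x + g x).
Proof. by move=> sf sg k; exact: CkD. Qed.
Lemma smoothM f g : smooth f -> smooth g -> smooth (fun x => f x * g x).
Proof. by move=> sf sg k; exact: CkM. Qed.
Lemma smoothB f g : smooth f -> smooth g -> smooth (fun x => f x - g x).
Proof.
move=> sf sg; rewrite (_ : (fun x => _) = fun x => f x + (-1) * g x).
  by apply: smoothD => //; apply: smoothM => //; exact: smooth_cst.
by apply/funext => x; rewrite mulN1r.
Qed.
Lemma smooth_shift f (h : plane R) : smooth f -> smooth (fun x => f (x + h)).
Proof. by move=> sf k; exact: Ck_shift. Qed.

Definition crd (j : 'I_2) (x : plane R) : R := if j == ord0 then x.1 else x.2.

Lemma crd_cts j : continuous (crd j).
Proof. by move=> x; rewrite /crd; case: (j == ord0); [exact: cvg_fst|exact: cvg_snd]. Qed.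

Lemma crdD j x y : crd j (x + y) = crd j x + crd j y.
Proof. by rewrite /crd; case: ifP. Qed.

Lemma crd_dir i j (t : R) : crd j (t *: dir i) = (i == j)%:R * t.
Proof.
by rewrite /crd /dir; move: i j => [[|[|//]] hi] [[|[|//]] hj] //=;
  rewrite ?(mul1r, mul0r); first [exact: mulr1|exact: mulr0].
Qed.

(* The span of the functions t^-m e^(-1/t), extended by zero, is stable under derivation,
   hence their smoothness. *)
Definition flat (m : nat) (t : R) : R := if 0 < t then t ^- m * expR (- t^-1) else 0.

Lemma flat_ge0 m (t : R) : 0 <= flat m t.
Proof. by rewrite /flat; case: ifP => // t0; rewrite mulr_ge0 ?expR_ge0// invr_ge0 exprn_ge0// ltW. Qed.

(** With N = m + 2, exp (1/t) is the N-th power of exp (1/(N t)), which is at least 1/(N t).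
    Quadratic decay is what makes the derivative at 0 vanish. *)
Lemma flat_bound m (t : R) : 0 <= t -> flat m t <= m.+2%:R ^+ m.+2 * t ^+ 2.
Proof.
rewrite le_eqVlt => /orP[/eqP <-|t0]; first by rewrite /flat ltxx expr0n mulr0.
rewrite /flat t0.
set N := m.+2.
have N0 : (0 : R) < N%:R by rewrite ltr0n.
have e1 : (N%:R * t)^-1 <= expR ((N%:R * t)^-1).
  by apply: le_trans (expR_ge1Dx _); rewrite lerDr.
have e2 : (N%:R * t)^-1 ^+ N <= expR (t^-1).
  have -> : t^-1 = (N%:R * t)^-1 *+ N.
    by rewrite -[RHS]mulr_natr; field; rewrite !gt_eqF.
  rewrite -[X in expR X]mulr_natr expRM_natr; apply: lerXn2r => //; rewrite nnegrE ?expR_ge0//.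
  by rewrite invr_ge0 mulr_ge0// ltW.
rewrite expRN.
have tm : 0 < t ^+ m by rewrite exprn_gt0.
have : (expR t^-1)^-1 <= (N%:R * t) ^+ N.
  rewrite -[leRHS]invrK lef_pV2 ?posrE ?expR_gt0 ?invr_gt0 ?exprn_gt0 ?mulr_gt0//.
  by rewrite -exprVn.
move=> h; apply: le_trans (ler_wpM2l _ h) _; first by rewrite invr_ge0 ltW.
by rewrite exprMn /N !exprS mulrC -!mulrA divff ?gt_eqF// mulr1 expr0 mulr1.
Qed.

Lemma is_derive_flat m (t : R) :
  is_derive t 1 (flat m) (flat m.+2 t - m%:R * flat m.+1 t).
Proof.
have [t0|t0|->] := ltgtP t 0.
- rewrite {2 3}/flat !ltNge !(ltW t0)/= mulr0 subr0.
  apply: (@near_eq_is_derive _ _ _ (cst 0)).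
  near=> s; rewrite /flat ltNge ifN// negbK; apply: ltW; near: s.
  exact: lt_nbhsl.
- apply: (@near_eq_is_derive _ _ _ (fun t : R => t ^- m * expR (- t^-1))).
    near=> s; rewrite /flat ifT//; near: s; exact: lt_nbhsr.
  rewrite /flat t0.
  have tn0 : t != 0 by rewrite gt_eqF.
  have d1 : is_derive t 1 (fun t : R => t^-1) (- t ^- 2).
    have := @is_deriveV R id t 1 1 tn0 (is_derive_id _ _).
    by rewrite /= [_ *: _]mulr1.
  have d2 : is_derive t 1 (fun t : R => expR (- t^-1)) (expR (- t^-1) * t ^- 2).
    have d3 : is_derive t 1 (fun t : R => - t^-1) (t ^- 2).
      by have := is_deriveN d1; rewrite opprK.
    exact: (@is_derive1_comp _ expR (fun t => - t^-1) _ _ _ (is_derive_expR _) d3).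
  have d4 : is_derive t 1 (fun t : R => t ^- m) (- m%:R * t ^- m.+1).
    rewrite (_ : (fun _ => _) = (fun t : R => t^-1) ^+ m); last first.
      by apply/funext => s; rewrite -exprVn fctE.
    apply: is_derive_eq.
    case: m {d2} => [|m]; first by rewrite !mul0r/= scale0r oppr0 mul0r.
    rewrite /= [_ *: _]mulrN mulNr; congr (- _).
    by rewrite -!mulrA; congr (_ * _); rewrite exprVn -invfM -exprD addn2.
  apply: is_derive_eq.
    rewrite /= -![_ *: _]/(_ * _).
  by rewrite !exprS; field; rewrite tn0 ?expf_neq0.
- rewrite {2 3}/flat ltxx mulr0 subr0.
  (* The difference quotient is zero for h < 0, and [flat_bound] makes it O(h) for h > 0. *)
  have lim0 : h^-1 *: ((flat m \o shift 0) (h *: (1 : R)) - flat m 0) @[h --> 0^'] --> (0 : R).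
    rewrite /= {2}/flat ltxx.
    apply/cvgrPdist_le => e e0.
    near=> h.
    have hn0 : h != 0 by near: h; exact: nbhs_dnbhs_neq.
    rewrite sub0r normrN subr0 addr0 [h *: 1]mulr1 [_ *: _]/(_ * _) normrM normfV.
    rewrite ler_pdivrMl ?normr_gt0//.
    have [h0|h0] := leP h 0.
      by rewrite /flat ltNge h0/= normr0 mulr_ge0// ltW.
    rewrite (ger0_norm (flat_ge0 _ _)) (gtr0_norm h0).
    apply: le_trans (flat_bound m (ltW h0)) _.
    rewrite expr2 mulrCA ler_pM2l//.
    have M0 : 0 < m.+2%:R ^+ m.+2 :> R by rewrite exprn_gt0// ltr0n.
    rewrite -ler_pdivlMl// mulrC -(gtr0_norm h0).
    near: h; apply: dnbhs0_le; exact: divr_gt0.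
  by apply: DeriveDef; [apply/cvg_ex; exists 0|apply/cvg_lim].
Unshelve. all: by end_near. Qed.

Lemma flat_cts m : continuous (flat m).
Proof.
move=> t; apply: differentiable_continuous; apply/derivable1_diffP.
by have [] := is_derive_flat m t.
Qed.

Lemma is_derive_line f v x (t : R) d :
  is_derive (x + t *: v) v f d -> is_derive t 1 (fun s : R => f (x + s *: v)) d.
Proof.
move=> [h1 h2].
have E : (fun h : R => h^-1 *: (((fun s : R => f (x + s *: v)) \o shift t) (h *: (1 : R)) -
   f (x + t *: v))) = (fun h => h^-1 *: ((f \o shift (x + t *: v)) (h *: v) - f (x + t *: v))).
  apply/funext => h /=; do 2 f_equal.
  by rewrite [h *: 1]mulr1 scalerDl addrCA.
by apply: DeriveDef; rewrite /derivable /derive E.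
Qed.

Lemma line_is_derive f v x d :
  is_derive (0 : R) 1 (fun s : R => f (x + s *: v)) d -> is_derive x v f d.
Proof.
move=> [h1 h2].
have E : (fun h : R => h^-1 *: (((fun s : R => f (x + s *: v)) \o shift 0) (h *: (1 : R)) -
   f (x + (0 : R) *: v))) = (fun h => h^-1 *: ((f \o shift x) (h *: v) - f x)).
  by apply/funext => h /=; rewrite scale0r !addr0 [h *: 1]mulr1 [x + _]addrC.
by apply: DeriveDef; rewrite /derivable /derive -E.
Qed.

Lemma is_derive_flat_plane m c d i j x :
  is_derive x (dir i) (fun x => flat m (c * crd j x + d))
    ((c * (i == j)%:R) * (flat m.+2 (c * crd j x + d) - m%:R * flat m.+1 (c * crd j x + d))).
Proof.
apply: line_is_derive.
rewrite (_ : (fun s : R => _) =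
    flat m \o (fun s : R => (c * (i == j)%:R) * s + (c * crd j x + d))); last first.
  apply/funext => s /=; congr flat.
  by rewrite crdD crd_dir mulrDr -mulrA addrCA addrA.
rewrite [X in is_derive _ _ _ X]mulrC; apply: is_derive1_comp.
  by rewrite mulr0 add0r; exact: is_derive_flat.
apply: is_derive_eq.
rewrite addr0.
by rewrite -[_ *: _]/(_ * _) mulr1.
Qed.

Lemma smooth_flat m c d j : smooth (fun x => flat m (c * crd j x + d)).
Proof.
have ct n : continuous (fun x => flat n (c * crd j x + d)).
  move=> x.
  have h1 : (fun y => c * crd j y + d) y @[y --> x] --> c * crd j x + d.
    apply: cvgD; last exact: cvg_cst.
    by apply: cvgM; [exact: cvg_cst|exact: crd_cts].
  apply: (@continuous_comp _ _ _ (fun y => c * crd j y + d) (flat n)); first exact: h1.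
  exact: flat_cts.
move=> k; elim: k m => [|k IH] m; first by split => //; exact: ct.
split=> [|i]; first exact: ct.
split=> [x|]; first by have [] := is_derive_flat_plane m c d i j x.
rewrite (_ : 'D_ _ _ = fun x => (c * (i == j)%:R) *
  (flat m.+2 (c * crd j x + d) + (- m%:R) * flat m.+1 (c * crd j x + d))); last first.
  by apply/funext => x; have [_ ->] := is_derive_flat_plane m c d i j x; rewrite mulNr.
apply: CkM; first exact: Ck_cst.
apply: CkD; first exact: IH.
by apply: CkM; [exact: Ck_cst|exact: IH].
Qed.

End Smooth.

(** * Increments as integrals of derivatives along lines *)

Section Lines.
Context {R : realType}.
Implicit Types (f g : plane R -> R).
Local Notation mu := (@lebesgue_measure R).

(** A linear substitute for Hölder's inequality: after integration over a set of measure h, the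
    integral of a is at most c h plus c^(1-p) times that of a^p, and c is still free. *)
Lemma le_cst_powR (p a c : R) : 1 <= p -> 0 <= a -> 0 < c ->
  a <= c + c `^ (1 - p) * a `^ p.
Proof.
move=> p1 a0 c0; have [ac|ca] := leP a c.
  by apply: le_trans ac _; rewrite lerDl mulr_ge0 ?powR_ge0.
apply: (@le_trans _ _ (c `^ (1 - p) * a `^ p)); last by rewrite lerDr ltW.
have p0 : 0 < p by lra.
rewrite -(mulr_powRB1 a0 p0) -opprB powRN mulrCA ler_peMr// -ler_pdivrMl ?invr_gt0 ?powR_gt0//.
rewrite invrK mulr1.
by apply: ge0_ler_powR; rewrite ?subr_ge0// ?nnegrE ltW.
Qed.

Lemma integral_in_indic (A : set (measurableTypeR R)) (g : R -> R) :
  (\int[mu]_(t in A) (g t)%:E = \int[mu]_t (g t * \1_A t)%:E)%E.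
Proof.
rewrite integral_mkcond; apply: eq_integral => t _.
by rewrite patchE indicE; case: ifP => _; rewrite ?mulr1 ?mulr0.
Qed.

Lemma continuous_line f v x : continuous f -> continuous (fun t : R => f (x + t *: v)).
Proof.
move=> cf t.
apply: (@continuous_comp _ _ _ (fun t : R => x + t *: v) f); last exact: cf.
by apply: cvgD; [exact: cvg_cst|apply: cvgZl; exact: cvg_id].
Qed.

Section Line.
Variables (f : plane R -> R) (j : 'I_2).
Hypothesis sf : smooth f.
Let v : plane R := dir j.

Lemma line_ftc_itv x (a b : R) : a < b ->
  (\int[mu]_(t in `[a, b]) ('D_v f (x + t *: v))%:E = (f (x + b *: v) - f (x + a *: v))%:E)%E.
Proof.
move=> ab.
have dF (t : R) : is_derive t 1 (fun s : R => f (x + s *: v)) ('D_v f (x + t *: v)).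
  by apply: is_derive_line; apply: derivableP; exact: smooth_derivable.
have cF : continuous (fun s : R => f (x + s *: v)).
  by apply: continuous_line; exact: smooth_continuous.
rewrite (@continuous_FTC2 _ _ (fun s : R => f (x + s *: v)))//.
- apply: continuous_subspaceT => t.
  by apply: (@continuous_line ('D_v f)); apply: smooth_continuous; exact: smooth_D.
- split.
  + by move=> t _; have [] := dF t.
  + by apply: cvg_at_right_filter; exact: cF.
  + by apply: cvg_at_left_filter; exact: cF.
- by move=> t _; rewrite derive1E; have [] := dF t.
Qed.

Lemma line_ftc x (h : R) : 0 < h ->
  (\int[mu]_(t in `[0%R, h]) ('D_v f (x + t *: v))%:E = (f (x + h *: v) - f x)%:E)%E.
Proof. by move=> h0; rewrite line_ftc_itv// scale0r addr0. Qed.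

Let mline x : measurable_fun setT (fun t : measurableTypeR R => 'D_v f (x + t *: v)).
Proof.
apply: (@continuous_measurable_fun R); apply: (@continuous_line ('D_v f)).
by apply: smooth_continuous; exact: smooth_D.
Qed.

Lemma line_abs x (h : R) : 0 < h ->
  ((`|f (x + h *: v) - f x|)%:E <= \int[mu]_(t in `[0%R, h]) `|'D_v f (x + t *: v)|%:E)%E.
Proof.
move=> h0; rewrite -abse_EFin -line_ftc//.
apply: le_abse_integral => //.
by apply/measurable_EFinP; apply: measurable_funTS; exact: mline.
Qed.

Lemma line_pow (p : R) x (h : R) : 1 <= p -> 0 < h ->
  ((`|f (x + h *: v) - f x| `^ p)%:E <=
   (2 * (2 * h) `^ (p - 1))%:E * \int[mu]_(t in `[0%R, h]) (`|'D_v f (x + t *: v)| `^ p)%:E)%E.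
Proof.
move=> p1 h0; set D := `|_|; set G := (\int[_]_(_ in _) _)%E.
have G0 : (0 <= G)%E by apply: integral_ge0 => t _; rewrite lee_fin powR_ge0.
have K0 : 0 < 2 * (2 * h) `^ (p - 1) by rewrite mulr_gt0// powR_gt0// mulr_gt0.
have [D0|D0] := eqVneq D 0.
  by rewrite D0 powR0 ?mule_ge0 ?lee_fin ?(ltW K0)//; lra.
have {}D0 : 0 < D by rewrite lt_neqAle eq_sym D0 normr_ge0.
(* With this c the constant integrates to D / 2, which the left-hand side absorbs; this is the
   origin of the factors 2 in the bound. *)
set c := D / (2 * h).
have c0 : 0 < c by rewrite divr_gt0// mulr_gt0.
have h1 : (D%:E <= (c * h)%:E + (c `^ (1 - p))%:E * G)%E.
  apply: le_trans (line_abs x h0) _.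
  apply: (@le_trans _ _ (\int[mu]_(t in `[0%R, h]) (c%:E + (c `^ (1 - p) * `|'D_v f (x + t *: v)| `^ p)%:E))%E).
    apply: ge0_le_integral => //.
    - apply/measurable_EFinP; apply: measurable_funTS.
      by apply: measurableT_comp => //; exact: mline.
    - apply: emeasurable_funD => //; apply/measurable_EFinP; apply: measurable_funTS.
      apply: measurable_funM => //.
      apply: (measurableT_comp (measurable_powR p)).
      by apply: measurableT_comp => //; exact: mline.
    - by move=> t _; rewrite lee_fin; exact: le_cst_powR.
  rewrite ge0_integralD//; first last.
  - apply/measurable_EFinP; apply: measurable_funTS; apply: measurable_funM => //.
    apply: (measurableT_comp (measurable_powR p)).
    by apply: measurableT_comp => //; exact: mline.
  - by move=> t _; rewrite lee_fin mulr_ge0 ?powR_ge0.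
  - by move=> t _; rewrite lee_fin ltW.
  rewrite leeD//.
    rewrite (_ : (\int[_]_(_ in _) _)%E = (c%:E * mu `[0%R, h])%E); last exact: integral_cst.
    by rewrite lebesgue_measure_itv/= lte_fin h0 sube0 EFinM.
  under eq_integral do rewrite EFinM.
  rewrite ge0_integralZl_EFin ?powR_ge0//.
  apply/measurable_EFinP; apply: measurable_funTS.
  apply: (measurableT_comp (measurable_powR p)).
  by apply: measurableT_comp => //; exact: mline.
move: h1; case: G G0 => [G| |]//; last first.
  by move=> _ _; rewrite gt0_muley ?lte_fin ?leey.
rewrite lee_fin => G0; rewrite -!EFinM -EFinD !lee_fin => h1.
have p0 : 0 < p by lra.
rewrite -(mulr_powRB1 (ltW D0) p0).
have ch : c * h = D / 2 by rewrite /c; field; rewrite gt_eqF.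
rewrite ch in h1.
have cE : c `^ (1 - p) = (2 * h) `^ (p - 1) / D `^ (p - 1).
  have hh : 0 < 2 * h by rewrite mulr_gt0.
  have -> : D = c * (2 * h) by rewrite /c divfK// gt_eqF.
  rewrite [in RHS](powRM _ (ltW c0) (ltW hh)) -opprB powRN.
  by field; rewrite !gt_eqF// powR_gt0.
have DD : 0 < D `^ (p - 1) by rewrite powR_gt0.
have h2 : D <= 2 * ((2 * h) `^ (p - 1) / D `^ (p - 1) * G) by rewrite -cE; lra.
rewrite mulrC -ler_pdivlMl//; apply: le_trans h2 _.
by rewrite le_eqVlt; apply/orP; left; apply/eqP; ring.
Qed.

End Line.

Lemma measurable_plane_line (v : plane R) :
  measurable_fun setT (fun z : (mplane * measurableTypeR R)%type => (z.1 + z.2 *: v : mplane)).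
Proof.
apply: measurable_fun_pair => /=.
  apply: measurable_funD.
    by apply: (measurableT_comp measurable_fst); exact: measurable_fst.
  by apply: measurable_funM => //; exact: measurable_snd.
apply: measurable_funD.
  by apply: (measurableT_comp measurable_snd); exact: measurable_fst.
by apply: measurable_funM => //; exact: measurable_snd.
Qed.

(** For fixed t the integral over x is that of a translate of f and does not depend on t. *)
Lemma tonelli_line f (v : plane R) (h : R) : pmeas f -> (forall x, 0 <= f x) -> 0 <= h ->
  (\int[leb2 R]_x \int[mu]_(t in `[0%R, h]) (f (x + t *: v))%:E = h%:E * pint f)%E.
Proof.
move=> mf f0 h0.
under eq_integral do rewrite integral_in_indic.
pose F (z : mplane * measurableTypeR R) := (f (z.1 + z.2 *: v) * \1_(`[0%R, h]) z.2)%:E.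
have F0 z : (0 <= F z)%E by rewrite lee_fin mulr_ge0// indicE.
have mF : measurable_fun setT F.
  apply/measurable_EFinP; apply: measurable_funM.
    by apply: (measurableT_comp mf (measurable_plane_line v)).
  apply: (measurableT_comp _ measurable_snd).
  exact: measurable_indic.
rewrite (@fubini_tonelli _ _ _ _ _ (@sleb2 R) mu F mF F0).
transitivity (\int[mu]_t ((\1_(`[0%R, h]) t)%:E * pint f)%E)%E.
  apply: eq_integral => t _; rewrite /F /=.
  under eq_integral do rewrite mulrC EFinM.
  rewrite ge0_integralZl_EFin ?indicE//; first last.
  - by apply/measurable_EFinP; exact: pmeas_shift.
  - by move=> x _; rewrite lee_fin.
  by congr (_ * _)%E; exact: (@pint_shift _ (t *: v) f).
rewrite ge0_integralZr//; first last.
- exact: pint_ge0.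
- by apply/measurable_EFinP; exact: measurable_indic.
congr (_ * _)%E.
transitivity (mu `[0%R, h]); first by rewrite integral_indic// setIT.
rewrite lebesgue_measure_itv/= lte_fin; case: ltP => [_|h1]; first by rewrite sube0.
by rewrite (@le_anti _ _ h 0)// h0 h1.
Qed.

End Lines.

(** * Translation estimates and integration of slices *)

Section Sobolev.
Context {R : realType}.
Implicit Types (f g : plane R -> R).
Local Notation mu := (@lebesgue_measure R).

Lemma measurable_line_integral f (v : plane R) (h : R) : pmeas f -> (forall x, 0 <= f x) ->
  measurable_fun (setT : set mplane)
    (fun x => \int[mu]_(t in `[0%R, h]) (f (x + t *: v))%:E)%E.
Proof.
move=> mf f0.
pose F (z : mplane * measurableTypeR R) := (f (z.1 + z.2 *: v) * \1_(`[0%R, h]) z.2)%:E.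
rewrite (_ : (fun x => _) = (fun x => \int[mu]_t F (x, t))%E); last first.
  by apply/funext => x; rewrite integral_in_indic.
apply: (@measurable_fun_fubini_tonelli_F _ _ _ _ _ mu F).
  apply/measurable_EFinP; apply: measurable_funM.
    by apply: (measurableT_comp mf (measurable_plane_line v)).
  by apply: (measurableT_comp _ measurable_snd); exact: measurable_indic.
by move=> z; rewrite lee_fin mulr_ge0// indicE.
Qed.

Lemma pmeas_continuous f : continuous f -> pmeas f.
Proof. exact: continuous_measurable_plane. Qed.

Lemma pmeas_smooth f : smooth f -> pmeas f.
Proof. by move=> /smooth_continuous; exact: pmeas_continuous. Qed.

Lemma pmeas_norm_powR f p : pmeas f -> pmeas (fun x => `|f x| `^ p).
Proof.
move=> mf; apply: (measurableT_comp (measurable_powR p)).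
exact: measurableT_comp.
Qed.

Lemma translate_pow f j (p h C : R) : smooth f -> 1 <= p -> 0 < h ->
  intle (fun x => `|'D_(dir j) f x| `^ p) C ->
  intle (fun x => `|f (x + h *: dir j) - f x| `^ p) (2 * (2 * h) `^ (p - 1) * (h * C)).
Proof.
move=> sf p1 h0 fC.
have mD : pmeas (fun x => `|f (x + h *: dir j) - f x| `^ p).
  apply: pmeas_norm_powR; apply: measurable_funB; last exact: pmeas_smooth.
  by apply: pmeas_shift; exact: pmeas_smooth.
split => //.
case: fC => mf f0 fC.
apply: (@le_trans _ _ ((2 * (2 * h) `^ (p - 1))%:E * (h%:E * pint (fun x => (`|'D_(dir j) f x| `^ p)%R)))%E).
  rewrite -(tonelli_line (dir j) mf f0 (ltW h0)).
  rewrite -ge0_integralZl//; first last.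
  - by rewrite lee_fin mulr_ge0 ?powR_ge0.
  - by move=> x _; apply: integral_ge0 => t _; rewrite lee_fin.
  - exact: (measurable_line_integral (dir j) h mf f0).
  apply: ge0_le_integral => //.
  - exact/measurable_EFinP.
  - by apply: measurable_funeM; exact: (measurable_line_integral (dir j) h mf f0).
  - by move=> x _; exact: line_pow.
rewrite [leRHS]EFinM; apply: lee_wpmul2l; first by rewrite lee_fin mulr_ge0 ?powR_ge0.
by rewrite [leRHS]EFinM; apply: lee_wpmul2l => //; rewrite lee_fin ltW.
Qed.

Lemma sqr_powR (a : R) : `|a| `^ 2 = a ^+ 2.
Proof. by rewrite -[2]/(2%:R) powR_mulrn// real_normK// num_real. Qed.

Lemma translate_dir f j (h C : R) : smooth f ->
  intle (fun x => ('D_(dir j) f x) ^+ 2) C ->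
  intle (fun x => (f (x + h *: dir j) - f x) ^+ 2) (4 * h ^+ 2 * C).
Proof.
move=> sf fC.
have pos (k : R) : 0 < k -> intle (fun x => (f (x + k *: dir j) - f x) ^+ 2) (4 * k ^+ 2 * C).
  move=> k0.
  have -> : (fun x => (f (x + k *: dir j) - f x) ^+ 2) = (fun x => `|f (x + k *: dir j) - f x| `^ 2).
    by apply/funext => x; rewrite sqr_powR.
  have -> : 4 * k ^+ 2 * C = 2 * (2 * k) `^ (2 - 1) * (k * C).
    have -> : 2 - 1 = 1 :> R by lra.
    by rewrite powRr1 ?mulr_ge0 ?(ltW k0)//; ring.
  apply: translate_pow => //; first by rewrite ler1n.
  have -> : (fun x => `|'D_(dir j) f x| `^ 2) = (fun x => ('D_(dir j) f x) ^+ 2).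
    by apply/funext => x; rewrite sqr_powR.
  exact: fC.
have [h0|h0|->] := ltgtP h 0; last 2 first.
- exact: pos.
- rewrite expr0n mulr0 mul0r (_ : (fun x => _) = cst 0); last first.
    by apply/funext => x; rewrite scale0r addr0 subrr expr0n.
  exact: intle0.
(* A negative increment at x is, up to sign, the positive one at x + h, so its square is a
   translate. *)
have k0 : 0 < - h by lra.
have := intle_shift (h *: dir j) (pos _ k0).
rewrite sqrrN.
rewrite (_ : (fun x => _) = (fun x => (f (x + h *: dir j) - f x) ^+ 2))//.
apply/funext => x; rewrite scaleNr addrK.
by rewrite -sqrrN opprB.
Qed.

Lemma plane_dir (h : plane R) : h = h.1 *: dir ord0 + h.2 *: dir ord_max.
Proof.
case: h => h1 h2; rewrite /dir /=; congr pair => /=.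
- by rewrite [_ *: 1]mulr1 [_ *: 0]mulr0 addr0.
- by rewrite [_ *: 1]mulr1 [_ *: 0]mulr0 add0r.
Qed.

Lemma sqrD_le (a b : R) : (a + b) ^+ 2 <= 2 * a ^+ 2 + 2 * b ^+ 2.
Proof. by have := sqr_ge0 (a - b); rewrite sqrrB sqrrD; lra. Qed.

(** The path follows the second axis and then the first. Each leg costs 4 r^2 C by [translate_dir],
    and splitting the square doubles both. *)
Lemma translate f (h : plane R) (r C : R) : smooth f -> `|h.1| <= r -> `|h.2| <= r ->
  (forall j, intle (fun x => ('D_(dir j) f x) ^+ 2) C) ->
  intle (fun x => (f (x + h) - f x) ^+ 2) (16 * r ^+ 2 * C).
Proof.
move=> sf h1 h2 fC.
have C0 := intle_ge0 (fC ord0).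
have sq (a : R) : `|a| <= r -> a ^+ 2 <= r ^+ 2.
  by move=> ar; rewrite -(real_normK (num_real a)) lerXn2r// nnegrE// (le_trans _ ar).
have i1 := translate_dir h.1 sf (fC ord0).
have i2 := translate_dir h.2 sf (fC ord_max).
have := intleD (intleZ (_ : 0 <= 2) (intle_shift (h.2 *: dir ord_max) i1)) (intleZ (_ : 0 <= 2) i2).
move=> /(_ _ _)/wrap[]// H.
apply: (@intle_weak _ _ (2 * (4 * h.1 ^+ 2 * C) + 2 * (4 * h.2 ^+ 2 * C))).
  have := ler_wpM2r C0 (sq _ h1); have := ler_wpM2r C0 (sq _ h2); lra.
apply: intle_mono H.
  apply: (measurableT_comp (exprn_measurable 2)).
  apply: measurable_funB; last exact: pmeas_smooth.
  by apply: pmeas_shift; exact: pmeas_smooth.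
move=> x; rewrite sqr_ge0/=.
have -> : x + h = x + h.2 *: dir ord_max + h.1 *: dir ord0.
  by rewrite {1}(plane_dir h) [_ *: _ + _ *: _]addrC addrA.
have := sqrD_le (f (x + h.2 *: dir ord_max + h.1 *: dir ord0) - f (x + h.2 *: dir ord_max))
  (f (x + h.2 *: dir ord_max) - f x).
by rewrite addrA subrK.
Qed.

Lemma measurable_shiftR (c : R) : measurable_fun setT (fun x : measurableTypeR R => (c + x : measurableTypeR R)).
Proof. by rewrite (_ : (fun x => _) = (fun x => x + c)); [exact: measurable_addr1|apply/funext => x; rewrite addrC]. Qed.

Lemma lebesgue_integral_shift (c : R) (g : R -> \bar R) : measurable_fun (setT : set (measurableTypeR R)) g ->
  (forall t, (0 <= g t)%E) -> (\int[mu]_t g (c + t)%R = \int[mu]_t g t)%E.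
Proof.
move=> mg g0.
have := @ge0_integral_pushforward _ _ _ _ _ _ (measurable_shiftR c) mu setT g measurableT mg.
rewrite preimage_setT => <-//.
apply: eq_measure_integral; first exact: measurable_shiftR.
move=> m A mA _; rewrite /= /pushforward -[RHS](lebesgue_measure_shift c mA).
by congr (mu _); apply/seteqP; split => t /=; rewrite addrC.
Qed.

Lemma measurable_slice1 f (s : R) : pmeas f -> measurable_fun setT (fun t : measurableTypeR R => f (t, s)).
Proof. by move=> mf; apply: (measurableT_comp mf); exact: measurable_fun_pair. Qed.

Lemma measurable_slice2 f (s : R) : pmeas f -> measurable_fun setT (fun t : measurableTypeR R => f (s, t)).
Proof. by move=> mf; apply: (measurableT_comp mf); exact: measurable_fun_pair. Qed.

Lemma measurable_integral_slice1 f : pmeas f -> (forall x, 0 <= f x) ->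
  measurable_fun (setT : set (measurableTypeR R)) (fun s => \int[mu]_t (f (t, s))%:E)%E.
Proof.
move=> mf f0; apply: (@measurable_fun_fubini_tonelli_G _ _ _ _ _ mu (EFin \o f)).
  exact/measurable_EFinP.
by move=> x; rewrite lee_fin.
Qed.

Lemma measurable_integral_slice2 f : pmeas f -> (forall x, 0 <= f x) ->
  measurable_fun (setT : set (measurableTypeR R)) (fun s => \int[mu]_t (f (s, t))%:E)%E.
Proof.
move=> mf f0; apply: (@measurable_fun_fubini_tonelli_F _ _ _ _ _ mu (EFin \o f)).
  exact/measurable_EFinP.
by move=> x; rewrite lee_fin.
Qed.

(** The core of the planar Gagliardo-Nirenberg inequality: one bound depends on the second
    coordinate only, the other on the first only, so the integral of their product factorizes. *)
Lemma pint_slices f f0 f1 (K C0 C1 : R) : 0 <= K -> pmeas f -> (forall x, 0 <= f x) ->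
  intle f0 C0 -> intle f1 C1 ->
  (forall x, (f x)%:E <= K%:E * \int[mu]_t (f0 (t, x.2))%:E)%E ->
  (forall x, (f x)%:E <= K%:E * \int[mu]_t (f1 (x.1, t))%:E)%E ->
  intle (fun x => f x ^+ 2) (K ^+ 2 * (C0 * C1)).
Proof.
move=> K0 mf fp [m0 p0 h0] [m1 p1 h1] b0 b1.
split => [|x|]; [exact: measurable_funX|exact: sqr_ge0|].
set A0 := (fun s => \int[mu]_t (f0 (t, s))%:E)%E.
set A1 := (fun s => \int[mu]_t (f1 (s, t))%:E)%E.
have A00 s : (0 <= A0 s)%E by apply: integral_ge0 => t _; rewrite lee_fin.
have A10 s : (0 <= A1 s)%E by apply: integral_ge0 => t _; rewrite lee_fin.
have mA0 : measurable_fun (setT : set (measurableTypeR R)) A0 by exact: measurable_integral_slice1.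
have mA1 : measurable_fun (setT : set (measurableTypeR R)) A1 by exact: measurable_integral_slice2.
have f20 x : 0 <= f x ^+ 2 by exact: sqr_ge0.
have mf2 : pmeas (fun x => f x ^+ 2) by exact: measurable_funX.
have KE : (0 <= K%:E)%E by rewrite lee_fin.
rewrite pint_tonelli12//.
apply: (@le_trans _ _ (\int[mu]_x ((K%:E * A1 x) * (K%:E * pint f0)))%E).
  apply: ge0_le_integral => //.
  - by move=> x _; apply: integral_ge0 => y _; rewrite lee_fin.
  - exact: (measurable_integral_slice2 mf2).
  - apply: emeasurable_funM => //.
    by apply: measurable_funeM.
  move=> x _.
  have e1 : (K%:E * pint f0 = \int[mu]_y (K%:E * A0 y))%E.
    by rewrite (pint_tonelli21 m0 p0) ge0_integralZl.
  have e2 : (K%:E * A1 x * (\int[mu]_y (K%:E * A0 y)) = \int[mu]_y (K%:E * A1 x * (K%:E * A0 y)))%E.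
    apply/esym; apply: ge0_integralZl => //; first exact: measurable_funeM.
    - by move=> y _; exact: mule_ge0.
    - exact: mule_ge0.
  rewrite e1 e2.
  apply: ge0_le_integral => //.
  - by move=> y _; rewrite lee_fin.
  - by apply/measurable_EFinP; exact: (measurable_slice2 x mf2).
  - by apply: measurable_funeM; apply: measurable_funeM.
  - move=> y _; rewrite expr2 EFinM.
    apply: lee_pmul; first [by rewrite lee_fin|exact: (b1 (x, y))|exact: (b0 (x, y))].
rewrite ge0_integralZr//; first last.
- by apply: mule_ge0 => //; exact: pint_ge0.
- by move=> x _; exact: mule_ge0.
- exact: measurable_funeM.
rewrite ge0_integralZl// -(pint_tonelli12 m1 p1).
have q0 : (0 <= pint f0)%E by exact: pint_ge0.
have q1 : (0 <= pint f1)%E by exact: pint_ge0.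
apply: (@le_trans _ _ ((K%:E * C1%:E) * (K%:E * C0%:E))%E).
  by apply: lee_pmul; rewrite ?mule_ge0//; exact: lee_wpmul2l.
rewrite -!EFinM (_ : K * C1 * (K * C0) = K ^+ 2 * (C0 * C1))//; ring.
Qed.

End Sobolev.

(** * Sobolev inequalities with constants depending only on the box *)

Section SobolevPowers.
Context {R : realType}.
Implicit Types (f g : plane R -> R).
Local Notation mu := (@lebesgue_measure R).

Lemma intle_ext f g C : (forall x, f x = g x) -> intle f C -> intle g C.
Proof. by move=> /funext ->. Qed.

Definition supp_box (L : R) f := forall x, f x != 0 -> `|x.1| < L /\ `|x.2| < L.

Section Bound.
Variables (f : plane R -> R) (L p : R).
Hypotheses (sf : smooth f) (L0 : 0 < L) (sL : supp_box L f) (p1 : 1 <= p).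
(** A point of the box is joined to its left or lower side, where f vanishes, by a segment of length
    h at most 2 L; [line_pow] then costs 2 (2 h)^(p-1) at most. *)
Let K := 2 * (4 * L) `^ (p - 1).

Let Dp j : pmeas (fun x => `|'D_(dir j) f x| `^ p).
Proof. by apply: pmeas_norm_powR; apply: pmeas_smooth; exact: smooth_D. Qed.

Let K0 : 0 < K.
Proof. by rewrite mulr_gt0// powR_gt0// mulr_gt0. Qed.

Let supp0 x : ~ (`|x.1| < L /\ `|x.2| < L) -> f x = 0.
Proof. by move=> h; apply/eqP; apply: contra_notT h; exact: sL. Qed.

Let bound_dir j (x' : plane R) (h : R) (g : R -> R) :
  0 < h -> h <= 2 * L -> f x' = 0 ->
  measurable_fun (setT : set (measurableTypeR R)) g ->
  (forall t, 0 <= g t) ->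
  (forall t, `|'D_(dir j) f (x' + t *: dir j)| `^ p = g (- L + t)) ->
  ((`|f (x' + h *: dir j)| `^ p)%:E <= K%:E * \int[mu]_t (g t)%:E)%E.
Proof.
move=> h0 hL fx mg g0 gE.
have := line_pow j sf x' p1 h0; rewrite fx subr0 => /le_trans; apply.
apply: lee_pmul.
- by rewrite lee_fin mulr_ge0 ?powR_ge0.
- by apply: integral_ge0 => t _; rewrite lee_fin powR_ge0.
- rewrite lee_fin /K ler_pM2l//; apply: ge0_ler_powR; rewrite ?nnegrE ?subr_ge0//; lra.
- have mg' : measurable_fun (setT : set (measurableTypeR R)) (fun t => (g (- L + t))%:E).
    apply/measurable_EFinP.
    exact: (measurableT_comp mg (measurable_shiftR (- L))).
  rewrite -(@lebesgue_integral_shift _ (- L) (EFin \o g)).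
  + under eq_integral do rewrite gE.
    by apply: ge0_subset_integral => // t _; rewrite lee_fin.
  + exact/measurable_EFinP.
  + by move=> t; rewrite lee_fin.
Qed.

Lemma line_bound0 x :
  ((`|f x| `^ p)%:E <= K%:E * \int[mu]_t (`|'D_(dir ord0) f (t, x.2)| `^ p)%:E)%E.
Proof.
have [fx|fx] := eqVneq (f x) 0.
  rewrite fx normr0 powR0; last by rewrite gt_eqF// (lt_le_trans ltr01).
  by apply: mule_ge0; [rewrite lee_fin ltW|apply: integral_ge0 => t _; rewrite lee_fin powR_ge0].
have [] := sL fx; rewrite !ltr_norml => /andP[a1 a2] /andP[b1 b2].
have E : x = (- L, x.2) + (x.1 + L) *: dir ord0.
  case: x {fx a1 a2 b1 b2} => u w; rewrite /dir/=; congr pair => /=.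
    by rewrite [_ *: 1]mulr1; ring.
  by rewrite [_ *: 0]mulr0 addr0.
rewrite {1}E.
apply: (@bound_dir ord0 _ _ (fun t => `|'D_(dir ord0) f (t, x.2)| `^ p)).
- by rewrite -ltrBlDr sub0r.
- by lra.
- by apply: supp0 => /= -[]; rewrite normrN gtr0_norm// ltxx.
- exact: (measurable_slice1 x.2 (Dp ord0)).
- by move=> t; exact: powR_ge0.
- move=> t; rewrite (_ : (- L, x.2) + t *: dir ord0 = (- L + t, x.2))//.
  rewrite /dir/=; congr pair => /=; first by rewrite [_ *: 1]mulr1.
  by rewrite [_ *: 0]mulr0 addr0.
Qed.

Lemma line_bound1 x :
  ((`|f x| `^ p)%:E <= K%:E * \int[mu]_t (`|'D_(dir ord_max) f (x.1, t)| `^ p)%:E)%E.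
Proof.
have [fx|fx] := eqVneq (f x) 0.
  rewrite fx normr0 powR0; last by rewrite gt_eqF// (lt_le_trans ltr01).
  by apply: mule_ge0; [rewrite lee_fin ltW|apply: integral_ge0 => t _; rewrite lee_fin powR_ge0].
have [] := sL fx; rewrite !ltr_norml => /andP[a1 a2] /andP[b1 b2].
have E : x = (x.1, - L) + (x.2 + L) *: dir ord_max.
  case: x {fx a1 a2 b1 b2} => u w; rewrite /dir/=; congr pair => /=.
    by rewrite [_ *: 0]mulr0 addr0.
  by rewrite [_ *: 1]mulr1; ring.
rewrite {1}E.
apply: (@bound_dir ord_max _ _ (fun t => `|'D_(dir ord_max) f (x.1, t)| `^ p)).
- by rewrite -ltrBlDr sub0r.
- by lra.
- by apply: supp0 => /= -[_]; rewrite normrN gtr0_norm// ltxx.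
- exact: (measurable_slice2 x.1 (Dp ord_max)).
- by move=> t; exact: powR_ge0.
- move=> t; rewrite (_ : (x.1, - L) + t *: dir ord_max = (x.1, - L + t))//.
  rewrite /dir/=; congr pair => /=; last by rewrite [_ *: 1]mulr1.
  by rewrite [_ *: 0]mulr0 addr0.
Qed.

(** The exponent 2p stays below Sobolev's 2p/(2-p) for 1 < p < 2. It exceeds 2 as soon as p > 1, and
    this is what the state y is used for. *)
Lemma sobolev_powR C0 C1 :
  intle (fun x => `|'D_(dir ord0) f x| `^ p) C0 ->
  intle (fun x => `|'D_(dir ord_max) f x| `^ p) C1 ->
  intle (fun x => (`|f x| `^ p) ^+ 2) (K ^+ 2 * (C0 * C1)).
Proof.
move=> h0 h1.
apply: (pint_slices (ltW K0) _ _ h0 h1).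
- by apply: pmeas_norm_powR; exact: pmeas_smooth.
- by move=> x; exact: powR_ge0.
- exact: line_bound0.
- exact: line_bound1.
Qed.

End Bound.

Lemma smoothX f n : smooth f -> smooth (fun x => f x ^+ n).
Proof.
move=> sf; elim: n => [|n IH]; first exact: smooth_cst.
rewrite (_ : (fun x => _) = (fun x => f x * f x ^+ n)); first exact: smoothM.
by apply/funext => x; rewrite exprS.
Qed.

Lemma deriveX_plane f j n x : smooth f ->
  'D_(dir j) (fun x => f x ^+ n.+1) x = n.+1%:R * f x ^+ n * 'D_(dir j) f x.
Proof.
move=> sf.
have df : is_derive x (dir j) f ('D_(dir j) f x) by apply: derivableP; exact: smooth_derivable.
have [_] := @is_deriveX _ _ _ n.+1 _ _ _ df.
rewrite (_ : f ^+ n.+1 = (fun x => f x ^+ n.+1)); last by rewrite fctE.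
by move=> ->.
Qed.

Lemma amgm (t a b : R) : 0 < t -> `|a * b| <= t * a ^+ 2 + t^-1 * b ^+ 2.
Proof.
move=> t0; rewrite -(ler_pM2l t0) mulrDr mulrA mulVKf ?gt_eqF//.
have h1 := sqr_ge0 (t * a - b); have h2 := sqr_ge0 (t * a + b).
have h3 := sqr_ge0 (t * a); have h4 := sqr_ge0 b.
have h5 : t * `|a * b| = `|t * (a * b)| by rewrite [RHS]normrM (gtr0_norm t0).
rewrite h5 ler_norml; move: h1 h2 h3 h4; rewrite !expr2 => *; nra.
Qed.

(** Stands in for the Cauchy-Schwarz inequality: with t the ratio of the L^2 norms it gives their
    product, up to a factor. *)
Lemma intle_amgm t f g A B : 0 < t -> pmeas f -> pmeas g ->
  intle (fun x => f x ^+ 2) A -> intle (fun x => g x ^+ 2) B ->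
  intle (fun x => `|f x * g x|) (t * A + t^-1 * B).
Proof.
move=> t0 mf mg fA gB.
apply: (@intle_mono _ _ (fun x => t * f x ^+ 2 + t^-1 * g x ^+ 2)).
- by apply: measurableT_comp => //; exact: measurable_funM.
- by move=> x; rewrite normr_ge0/= amgm.
- by apply: intleD; apply: intleZ; rewrite ?invr_ge0 ?ltW.
Qed.

Lemma sobolev_sqr f (L C0 C1 : R) : smooth f -> 0 < L -> supp_box L f ->
  intle (fun x => `|'D_(dir ord0) f x|) C0 ->
  intle (fun x => `|'D_(dir ord_max) f x|) C1 ->
  intle (fun x => f x ^+ 2) (4 * (C0 * C1)).
Proof.
move=> sf L0 sL h0 h1.
have ext g C : intle (fun x => `|g x|) C -> intle (fun x => `|g x| `^ 1) C.
  by apply: intle_ext => x; rewrite powRr1.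
have := @sobolev_powR f L 1 sf L0 sL (lexx _) C0 C1 (ext _ _ h0) (ext _ _ h1).
have -> : (2 * (4 * L) `^ (1 - 1)) ^+ 2 = 4.
  by rewrite subrr powRr0 mulr1 expr2; lra.
by apply: intle_ext => x; rewrite powRr1// real_normK// num_real.
Qed.

(** The embedding of W^(1,1) in L^2 is applied to f^(k+2), whose gradient (k+2) f^(k+1) Df is a
    product of two functions that the induction bounds in L^2. C is chosen before f, so the bound
    survives limits of test functions. *)
Lemma sobolev_pow (L A : R) (k : nat) : 0 < L -> exists C, forall f, smooth f -> supp_box L f ->
  intle (fun x => f x ^+ 2) A -> (forall j, intle (fun x => ('D_(dir j) f x) ^+ 2) A) ->
  intle (fun x => (f x ^+ k.+1) ^+ 2) C.
Proof.
move=> L0; elim: k => [|k [C IH]]; first by exists A.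
exists (4 * ((k.+2%:R * (1 * C + 1^-1 * A)) * (k.+2%:R * (1 * C + 1^-1 * A)))) => f sf sL fA dA.
have {}IH := IH f sf sL fA dA.
have H j : intle (fun x => `|'D_(dir j) (fun x => f x ^+ k.+2) x|) (k.+2%:R * (1 * C + 1^-1 * A)).
  rewrite (_ : (fun x => `| _ |) = (fun x => k.+2%:R * `|f x ^+ k.+1 * 'D_(dir j) f x|)); last first.
    by apply/funext => x; rewrite deriveX_plane// -mulrA normrM ger0_norm.
  apply: intleZ => //; apply: intle_amgm => //.
    by apply: pmeas_smooth; exact: smoothX.
  by apply: pmeas_smooth; exact: smooth_D.
apply: (sobolev_sqr (smoothX _ sf) L0 _ (H _) (H _)).
by move=> x; rewrite expf_eq0/= => /sL.
Qed.

End SobolevPowers.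

(** * Test functions and weak derivatives *)

Section Test.
Context {R : realType}.
Implicit Types (f g : plane R -> R).
Local Notation mu := (@lebesgue_measure R).

Definition obox (L : R) : set (plane R) := `]- L, L[ `*` `]- L, L[.

Lemma oboxP L x : obox L x <-> `|x.1| < L /\ `|x.2| < L.
Proof. by rewrite /obox /= !in_itv/= !ltr_norml. Qed.

Lemma measurable_rect (A B : set (measurableTypeR R)) : measurable A -> measurable B ->
  measurable (A `*` B : set mplane).
Proof. exact: measurableX. Qed.

Lemma measurable_obox L : measurable (obox L : set mplane).
Proof. by apply: measurable_rect; exact: measurable_itv. Qed.

Lemma intle_indic_rect (a b c d : R) : a <= b -> c <= d ->
  intle (\1_(`[a, b] `*` `[c, d] : set (plane R))) ((b - a) * (d - c)).
Proof.
move=> ab cd.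
pose A : set (measurableTypeR R) := [set` `[a, b] ].
pose B : set (measurableTypeR R) := [set` `[c, d] ].
have mA : measurable A by exact: measurable_itv.
have mB : measurable B by exact: measurable_itv.
have mAB : measurable (A `*` B : set mplane) by exact: measurable_rect.
split; [exact: measurable_indic|by move=> x; rewrite indicE|].
rewrite /pint integral_indic// setIT.
rewrite (_ : leb2 R _ = mu A * mu B)%E; last exact: (product_measure1E _ _ mA mB).
have -> : mu A = (b - a)%:E.
  rewrite /A lebesgue_measure_itv/= lte_fin; case: ltP => // ba.
  by rewrite (@le_anti _ _ a b) ?subrr ?ab ?ba.
have -> : mu B = (d - c)%:E.
  rewrite /B lebesgue_measure_itv/= lte_fin; case: ltP => // ba.
  by rewrite (@le_anti _ _ c d) ?subrr ?cd ?ba.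
by [].
Qed.

Lemma intle_indic_obox L : 0 < L -> intle (\1_(obox L)) (4 * L ^+ 2).
Proof.
move=> L0; have := @intle_indic_rect (- L) L (- L) L.
move=> /(_ _ _)/wrap[]; [lra|lra|].
rewrite (_ : (L - - L) * (L - - L) = 4 * L ^+ 2); last by rewrite expr2; lra.
apply: intle_mono; first by apply: measurable_indic; exact: measurable_obox.
move=> x; rewrite !indicE ler0n/= ler_nat.
have [/set_mem/oboxP[]|//] := boolP (x \in obox L).
rewrite !ltr_norml => /andP[a1 a2] /andP[b1 b2].
by rewrite mem_set//=; split => /=; rewrite in_itv/= !ltW.
Qed.

Lemma compact_obox (K : set (plane R)) : compact K -> exists2 L, 0 < L & K `<=` obox L.
Proof.
move=> /compact_bounded [M [_ MK]].
exists (`|M| + 2); first by rewrite ltr_wpDl.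
move=> x Kx; have : `|x| <= `|M| + 1.
  by apply: (MK (`|M| + 1)) => //; rewrite (le_lt_trans (ler_norm _))// ltrDl.
rewrite prod_normE ge_max; by move=> /andP[h1 h2]; apply/oboxP; split; lra.
Qed.

Lemma compact_support_bounded (K : set (plane R)) f : compact K -> continuous f ->
  (forall x, ~ K x -> f x = 0) -> exists2 M, 0 < M & forall x, `|f x| <= M.
Proof.
move=> cK cf f0.
have : compact (f @` K) by apply: continuous_compact => //; exact: continuous_subspaceT.
move=> /compact_bounded [M [_ MK]].
exists (`|M| + 1); first by rewrite ltr_wpDl.
move=> x; have [Kx|nKx] := pselect (K x); last by rewrite f0// normr0 addr_ge0.
by apply: (MK (`|M| + 1)); [rewrite (le_lt_trans (ler_norm _))// ltrDl|exists x].
Qed.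

Lemma compact_support_intle (K : set (plane R)) f : compact K -> continuous f ->
  (forall x, ~ K x -> f x = 0) -> exists C, intle (fun x => `|f x|) C.
Proof.
move=> cK cf f0.
have [M M0 fM] := compact_support_bounded cK cf f0.
have [L L0 KL] := compact_obox cK.
exists (M * (4 * L ^+ 2)).
apply: (@intle_mono _ _ (fun x => M * \1_(obox L) x)).
- by apply: measurableT_comp => //; exact: pmeas_continuous.
- move=> x; rewrite normr_ge0/=; have [Kx|nKx] := pselect (K x).
    by rewrite indicE mem_set ?mulr1//; exact: KL.
  by rewrite f0// normr0 indicE mulr_ge0// ltW.
- by apply: intleZ; [exact: ltW|exact: intle_indic_obox].
Qed.

Lemma compact_support_integrable (K : set (plane R)) f : compact K -> continuous f ->
  (forall x, ~ K x -> f x = 0) -> (leb2 R).-integrable setT (EFin \o f).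
Proof.
move=> cK cf f0; have [C fC] := compact_support_intle cK cf f0.
by have [] := intle_integrable (pmeas_continuous cf) (fun x => lexx _) fC.
Qed.

Section TestFunctions.
Variable Omega : set (plane R).
Hypothesis oO : open Omega.

Lemma test_smooth f : test_fun Omega f -> smooth f. Proof. by case. Qed.

Lemma compact_closed_plane (K : set (plane R)) : compact K -> closed K.
Proof. by apply: compact_closed; exact: norm_hausdorff. Qed.

Lemma derive_support (K : set (plane R)) f j : closed K -> (forall x, ~ K x -> f x = 0) ->
  forall x, ~ K x -> 'D_(dir j) f x = 0.
Proof.
move=> cK f0 x Kx.
rewrite (@near_eq_derive _ _ _ f (cst 0)) ?derive_cst//.
have : nbhs x (~` K) by apply: open_nbhs_nbhs; split => //; exact: closed_openC.
by apply: filterS => y; exact: f0.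
Qed.

Lemma test_D f j : test_fun Omega f -> test_fun Omega ('D_(dir j) f).
Proof.
move=> [sf [K [cK KO f0]]]; split; first exact: smooth_D.
exists K; split => // x; apply: derive_support => //; exact: compact_closed_plane.
Qed.

Lemma test_M f g : smooth f -> test_fun Omega g -> test_fun Omega (fun x => f x * g x).
Proof.
move=> sf [sg [K [cK KO g0]]]; split; first exact: smoothM.
by exists K; split => // x Kx; rewrite g0 ?mulr0.
Qed.

Lemma test_out f x : test_fun Omega f -> ~ Omega x -> f x = 0.
Proof. by move=> [_ [K [_ KO f0]]] Ox; apply: f0 => /KO. Qed.

Lemma test_integrable f : test_fun Omega f -> (leb2 R).-integrable setT (EFin \o f).
Proof.
move=> [sf [K [cK _ f0]]]; apply: compact_support_integrable cK _ f0.
exact: smooth_continuous.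
Qed.

Lemma test_bounded f : test_fun Omega f -> exists2 M, 0 < M & forall x, `|f x| <= M.
Proof.
move=> [sf [K [cK _ f0]]]; apply: compact_support_bounded cK _ f0.
exact: smooth_continuous.
Qed.

Lemma measurable_Omega : measurable (Omega : set mplane).
Proof. exact: open_measurable_plane. Qed.

Definition ext0 f : plane R -> R := f \_ Omega.

Lemma ext0_in f x : Omega x -> ext0 f x = f x.
Proof. by move=> Ox; rewrite /ext0 patchE mem_set. Qed.

Lemma ext0_out f x : ~ Omega x -> ext0 f x = 0.
Proof. by move=> Ox; rewrite /ext0 patchE memNset. Qed.

Lemma intO_ext0 f : intO Omega f = \int[leb2 R]_x ext0 f x.
Proof. by rewrite /intO Rintegral_mkcond. Qed.

Lemma measO_ext0 f : measO Omega f -> pmeas (ext0 f).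
Proof. by move=> mf; apply/(measurable_restrictT _ measurable_Omega). Qed.

Lemma pmeas_measO f : pmeas f -> measO Omega f.
Proof. exact: measurable_funTS. Qed.

Lemma intO_support f : (forall x, ~ Omega x -> f x = 0) -> intO Omega f = \int[leb2 R]_x f x.
Proof.
move=> f0; rewrite intO_ext0; congr (Rintegral _ _ _); apply/funext => x.
by have [Ox|Ox] := pselect (Omega x); [rewrite ext0_in|rewrite ext0_out ?f0].
Qed.

End TestFunctions.
End Test.

Section Weak.
Context {R : realType}.
Implicit Types f : plane R -> R.
Local Notation mu := (@lebesgue_measure R).
Variable Omega : set (plane R).
Hypothesis oO : open Omega.

Lemma integral_line_D f j (x : plane R) (L : R) : smooth f -> 0 < L ->
  (forall t, L <= `|t| -> f (x + t *: dir j) = 0) ->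
  (\int[mu]_t ('D_(dir j) f (x + t *: dir j))%:E = 0)%E.
Proof.
move=> sf L0 f0.
rewrite (_ : (\int[mu]_t _)%E = \int[mu]_(t in `[(- L)%R, L]) ('D_(dir j) f (x + t *: dir j))%:E)%E.
  rewrite line_ftc_itv ?f0 ?subrr//; last by lra.
    by rewrite normrN gtr0_norm.
  by rewrite gtr0_norm.
rewrite [RHS]integral_mkcond; apply: eq_integral => t _; rewrite patchE.
case: ifPn => //; rewrite notin_setE/= in_itv/= => /negP tL.
have {}tL : L < `|t| by rewrite ltNge ler_norml.
have h : is_derive t 1 (fun s : R => f (x + s *: dir j)) ('D_(dir j) f (x + t *: dir j)).
  by apply: is_derive_line; apply: derivableP; exact: smooth_derivable.
have [_ <-] := h; congr (_%:E).
rewrite (@near_eq_derive _ _ _ _ (cst 0)) ?derive_cst//.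
near=> s; rewrite f0//; apply: ltW; near: s.
have : (fun s : R => `|s|) s @[s --> (t : R)] --> `|t| by apply: cvg_norm; exact: cvg_id.
by move=> /cvgr_gt; apply.
Unshelve. all: by end_near. Qed.

Lemma Rintegral_D f j : test_fun Omega f -> \int[leb2 R]_x ('D_(dir j) f x) = 0.
Proof.
move=> tf; have iD := test_integrable (test_D j tf).
have [sf [K [cK KO f0]]] := tf.
have [L L0 KL] := compact_obox cK.
rewrite /Rintegral.
suff -> : (\int[leb2 R]_x ('D_(dir j) f x)%:E = 0)%E by [].
move: j iD => [[|[|//]] hj] iD.
- rewrite -(@integral21_prod_meas1 _ _ _ _ _ mu mu _ iD).
  rewrite (@integral0_eq _ _ _ _ setT)// => y _.
  rewrite -(@integral_line_D f (Ordinal hj) (0, y) L sf L0).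
    apply: eq_integral => t _; congr (('D__ _ _)%:E).
    rewrite /dir/=; congr pair => /=; first by rewrite add0r [_ *: 1]mulr1.
    by rewrite [_ *: 0]mulr0 addr0.
  move=> t tL; apply: f0 => /KL /oboxP[] /=.
  by rewrite add0r [_ *: 1]mulr1 ltNge tL.
- rewrite -(@integral12_prod_meas1 _ _ _ _ _ mu mu _ iD).
  rewrite (@integral0_eq _ _ _ _ setT)// => y _.
  rewrite -(@integral_line_D f (Ordinal hj) (y, 0) L sf L0).
    apply: eq_integral => t _; congr (('D__ _ _)%:E).
    rewrite /dir/=; congr pair => /=; last by rewrite add0r [_ *: 1]mulr1.
    by rewrite [_ *: 0]mulr0 addr0.
  move=> t tL; apply: f0 => /KL /oboxP[] /=.
  by move=> _; rewrite add0r [_ *: 1]mulr1 ltNge tL.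
Qed.

Lemma loc_integrable_continuous f : continuous f -> loc_integrable Omega f.
Proof.
move=> cf; split; first by apply: pmeas_measO; exact: pmeas_continuous.
move=> K cK KO.
have mK : measurable (K : set mplane).
  by apply: closed_measurable_plane; exact: compact_closed_plane.
have : compact (f @` K) by apply: continuous_compact => //; exact: continuous_subspaceT.
move=> /compact_bounded [M [_ MK]].
have [L L0 KL] := compact_obox cK.
apply/integrable_mkcond => //.
rewrite restrict_EFin.
have fK : intle (fun x => (`|M| + 1) * \1_(obox L) x) ((`|M| + 1) * (4 * L ^+ 2)).
  by apply: intleZ; [rewrite addr_ge0|exact: intle_indic_obox].
apply: (intle_integrable _ _ fK).1.
  by apply/(measurable_restrictT _ mK); apply: measurable_funTS; exact: pmeas_continuous.
move=> x; rewrite patchE; case: ifPn => [/set_mem Kx|_].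
  rewrite indicE mem_set ?mulr1; last exact: KL.
  by apply: (MK (`|M| + 1)); [rewrite (le_lt_trans (ler_norm _))// ltrDl|exists x].
by rewrite normr0 mulr_ge0// addr_ge0.
Qed.

(** Integration by parts is the vanishing of the integral of the derivative of f phi, a test
    function. *)
Lemma is_wpartial_smooth f j : smooth f -> is_wpartial Omega j f ('D_(dir j) f).
Proof.
move=> sf; split.
- by apply: loc_integrable_continuous; exact: smooth_continuous.
- by apply: loc_integrable_continuous; apply: smooth_continuous; exact: smooth_D.
move=> phi tphi.
have tD := test_D j tphi.
have t1 := test_M sf tD.
have t2 := test_M (smooth_D j sf) tphi.
rewrite !(@intO_support _ Omega); [|by move=> x /(test_out tphi) ->; rewrite mulr0
  |by move=> x /(test_out tD) ->; rewrite mulr0].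
apply/eqP; rewrite -subr_eq0 opprK -RintegralD//; [|exact: test_integrable t1|exact: test_integrable t2].
rewrite -(@Rintegral_D (fun x => f x * phi x) j); last exact: test_M.
apply/eqP; congr (Rintegral _ _ _); apply/funext => x.
have [s2 _] := tphi.
by rewrite (@deriveM _ _ f phi)//; [congr (_ + _); exact: mulrC|exact: smooth_derivable|exact: smooth_derivable].
Qed.

(** This is exp (-1/((n+1) t)) for t > 0 and 0 otherwise: smooth functions with values in [0, 1]
    that increase with n to the indicator of the positive half-line. *)
Definition step (n : nat) (t : R) : R := flat 0 (n.+1%:R * t).

Lemma step_ge0 n t : 0 <= step n t. Proof. exact: flat_ge0. Qed.

Lemma step_le1 n t : step n t <= 1.
Proof.
rewrite /step /flat; case: ifP => // t0.
by rewrite expr0 invr1 mul1r -[leRHS]expR0 ler_expR oppr_le0 invr_ge0 ltW.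
Qed.

Lemma step_cvg t : step n t @[n --> \oo] --> ((0 < t)%R%:R : R).
Proof.
have [t0|t0] := ltP 0 t; last first.
  rewrite (_ : (fun n => _) = cst 0); first exact: cvg_cst.
  apply/funext => n; rewrite /step /flat ifF//; apply/negbTE.
  by rewrite -leNgt pmulr_rle0// ltr0n.
rewrite (_ : (fun n => _) = (fun n => expR (- (n.+1%:R^-1 * t^-1)))); last first.
  by apply/funext => n; rewrite /step /flat mulr_gt0// ?ltr0n// expr0 invr1 mul1r invfM.
rewrite -[X in _ --> X]expR0.
apply: continuous_cvg; first exact: continuous_expR.
rewrite -oppr0; apply: cvgN; rewrite -(mul0r t^-1).
by apply: cvgM; [exact: cvg_harmonic|exact: cvg_cst].
Qed.

Definition oquad (a b c d : R) : set (plane R) := `]a, b[ `*` `]c, d[.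
Definition cquad (a b c d : R) : set (plane R) := `[a, b] `*` `[c, d].

Definition ray (a c : R) : set (plane R) := `]a, +oo[ `*` `]c, +oo[.

(** The factors with p, q, s, t confine the support to a rectangle; those with a, c converge to the
    indicator of a quadrant, even when its corner lies inside the rectangle. *)
Definition quad_test (a c p q s t : R) n (x : plane R) : R :=
  step n (x.1 - a) * step n (x.1 - p) * step n (q - x.1) *
  (step n (x.2 - c) * step n (x.2 - s) * step n (t - x.2)).

Lemma smooth_step n j c d : smooth (fun x : plane R => step n (c * crd j x + d)).
Proof.
rewrite (_ : (fun x => _) = (fun x => flat 0 ((n.+1%:R * c) * crd j x + n.+1%:R * d))).
  exact: smooth_flat.
by apply/funext => x; rewrite /step; congr flat; ring.
Qed.

Lemma smooth_quad_test a c p q s t n : smooth (quad_test a c p q s t n).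
Proof.
have h1 e : smooth (fun x : plane R => step n (x.1 - e)).
  by have := @smooth_step n ord0 1 (- e); under [X in smooth X]eq_fun do rewrite mul1r.
have h2 e : smooth (fun x : plane R => step n (x.2 - e)).
  by have := @smooth_step n ord_max 1 (- e); under [X in smooth X]eq_fun do rewrite mul1r.
have h3 e : smooth (fun x : plane R => step n (e - x.1)).
  by have := @smooth_step n ord0 (-1) e; under [X in smooth X]eq_fun do rewrite mulN1r addrC.
have h4 e : smooth (fun x : plane R => step n (e - x.2)).
  by have := @smooth_step n ord_max (-1) e; under [X in smooth X]eq_fun do rewrite mulN1r addrC.
by rewrite /quad_test; repeat (apply: smoothM => //).
Qed.

Lemma step_eq0 n t : t <= 0 -> step n t = 0.
Proof.
by move=> t0; rewrite /step /flat ifF//; apply/negbTE; rewrite -leNgt pmulr_rle0// ltr0n.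
Qed.

Lemma quad_test_out a c p q s t n x : ~ oquad p q s t x -> quad_test a c p q s t n x = 0.
Proof.
move=> h; rewrite /quad_test.
have [h1|h1] := leP (x.1 - p) 0; first by rewrite (step_eq0 n h1) mulr0 !mul0r.
have [h2|h2] := leP (q - x.1) 0; first by rewrite (step_eq0 n h2) mulr0 !mul0r.
have [h3|h3] := leP (x.2 - s) 0; first by rewrite (step_eq0 n h3) mulr0 mul0r mulr0.
have [h4|h4] := leP (t - x.2) 0; first by rewrite (step_eq0 n h4) !mulr0.
by exfalso; apply: h; split; rewrite /= in_itv/=; apply/andP; split; lra.
Qed.

Lemma quad_test_bound a c p q s t n x : 0 <= quad_test a c p q s t n x <= 1.
Proof.
by rewrite /quad_test; apply/andP; split;
  repeat (first [apply: mulr_ge0|apply: mulr_ile1]); rewrite ?step_ge0 ?step_le1.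
Qed.

Lemma quad_test_cvg a c p q s t x : oquad p q s t x ->
  quad_test a c p q s t n x @[n --> \oo] --> (\1_(ray a c) x : R).
Proof.
move=> [/=]; rewrite !in_itv/= => /andP[x1 x2] /andP[x3 x4].
have -> : \1_(ray a c) x = (0 < x.1 - a)%R%:R * (0 < x.1 - p)%R%:R * (0 < q - x.1)%R%:R *
   ((0 < x.2 - c)%R%:R * (0 < x.2 - s)%R%:R * (0 < t - x.2)%R%:R) :> R.
  rewrite !subr_gt0 x1 x2 x3 x4 !mulr1 indicE -natrM mulnb; congr (_%:R).
  congr nat_of_bool; apply/idP/idP.
    by move=> /set_mem[/=]; rewrite !in_itv/= !andbT => -> ->.
  by move=> /andP[h1 h2]; rewrite mem_set//; split => /=; rewrite in_itv/= andbT.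
by do ! apply: cvgM; exact: step_cvg.
Qed.

Lemma compact_cquad a b c d : compact (cquad a b c d).
Proof. by apply: compact_setX; exact: segment_compact. Qed.

Lemma oquad_sub a b c d : oquad a b c d `<=` cquad a b c d.
Proof. by move=> x [/= h1 h2]; split => /=; apply: subset_itv_oo_cc. Qed.

Lemma test_quad a c p q s t n : cquad p q s t `<=` Omega -> test_fun Omega (quad_test a c p q s t n).
Proof.
move=> h; split; first exact: smooth_quad_test.
exists (cquad p q s t); split => //; first exact: compact_cquad.
by move=> x hx; apply: quad_test_out => /oquad_sub.
Qed.

End Weak.

(** * The fundamental lemma of the calculus of variations *)

Section Dubois.
Context {R : realType}.
Implicit Types d : plane R -> R.

Lemma aeS (P Q : plane R -> Prop) : (forall x, P x -> Q x) ->
  {ae leb2 R, forall x, P x} -> {ae leb2 R, forall x, Q x}.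
Proof.
by move=> PQ; apply: (@negligibleS _ mplane) => x /= nQ Px; apply: nQ; exact: PQ.
Qed.

Lemma aeI (P Q : plane R -> Prop) : {ae leb2 R, forall x, P x} ->
  {ae leb2 R, forall x, Q x} -> {ae leb2 R, forall x, P x /\ Q x}.
Proof.
move=> hP hQ; apply: (@negligibleS _ mplane _ _ _ _ _ (negligibleU hP hQ)).
by move=> x /= /not_andP[h|h]; [left|right].
Qed.

(** A family stable under intersection that generates the sigma-algebra of the plane, as Dynkin's
    lemma requires. *)
Definition rays : set (set (plane R)) := [set A | exists a c, A = ray a c].

Lemma setI_closed_rays : setI_closed rays.
Proof.
move=> _ _ [a [c ->]] [a' [c' ->]]; exists (Num.max a a'), (Num.max c c').
apply/seteqP; split => x /=; rewrite /ray /= !in_itv/= !andbT !gt_max.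
  by move=> [[-> ->] [-> ->]].
by move=> [/andP[-> ->] /andP[-> ->]].
Qed.

Let raysT : measurableType rays.-sigma := g_sigma_algebraType rays.

Lemma measurable_rays : @measurable _ (@mplane R) = <<s rays >>.
Proof.
apply/seteqP; split; last first.
  apply: smallest_sub; first exact: sigma_algebra_measurable.
  by move=> _ [a [c ->]]; apply: measurable_rect; exact: measurable_itv.
have mg : forall A, rays A -> measurable (A : set raysT) by move=> A; exact: sub_sigma_algebra.
have cov (x : R) : exists n : nat, - n%:R < x.
  exists (Num.bound `|x|); have h := @archi_boundP R `|x| (normr_ge0 x).
  by rewrite ltrNl; apply: le_lt_trans h; rewrite -normrN ler_norm.
have m1 : measurable_fun setT (fun x : raysT => (x.1 : measurableTypeR R)).
  apply: (measurability _ (RGenOInfty.measurableE R)) => _ [_ [a ->] <-].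
  rewrite setTI (_ : _ @^-1` _ = \bigcup_n ray a (- n%:R)).
    by apply: bigcupT_measurable => n; apply: mg; exists a, (- n%:R).
  apply/seteqP; split => [x /=|x [n _] [/=]//].
  move=> xa; have [n xn] := cov x.2; exists n => //; split => //=.
  by rewrite in_itv/= xn.
have m2 : measurable_fun setT (fun x : raysT => (x.2 : measurableTypeR R)).
  apply: (measurability _ (RGenOInfty.measurableE R)) => _ [_ [a ->] <-].
  rewrite setTI (_ : _ @^-1` _ = \bigcup_n ray (- n%:R) a).
    by apply: bigcupT_measurable => n; apply: mg; exists (- n%:R), a.
  apply/seteqP; split => [x /=|x [n _] [/=]//].
  move=> xa; have [n xn] := cov x.1; exists n => //; split => //=.
  by rewrite in_itv/= xn.
move=> A mA.
have := measurable_fun_pair m1 m2 measurableT mA.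
rewrite setTI (_ : _ @^-1` _ = A)//.
by apply/seteqP; split => -[].
Qed.

Variable Omega : set (plane R).
Hypothesis oO : open Omega.

Section Quad.
Variables (d : plane R -> R) (p q s t : R).
Hypotheses (ld : loc_integrable Omega d) (cO : cquad p q s t `<=` Omega).
Hypothesis d0 : forall phi, test_fun Omega phi -> intO Omega (fun x => d x * phi x) = 0.

Let Q := oquad p q s t.
Let mQ : measurable (Q : set mplane).
Proof. by apply: measurable_rect; exact: measurable_itv. Qed.
Let D := d \_ Q.

Let iD : (leb2 R).-integrable setT (EFin \o D).
Proof.
rewrite /D -restrict_EFin.
have h : (leb2 R).-integrable (Q : set mplane) (EFin \o d).
  apply: (@integrableS _ _ _ _ (cquad p q s t : set mplane)) => //.
  - by apply: measurable_rect; exact: measurable_itv.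
  - exact: oquad_sub.
  - by have [_] := ld; apply => //; exact: compact_cquad.
have [h1 _] := @integrable_mkcond _ _ _ (leb2 R) _ (EFin \o d) mQ.
exact: (h1 h).
Qed.

Let mD : measurable_fun setT (EFin \o D).
Proof. exact: measurable_int iD. Qed.

(** The functions D times [quad_test] converge to D times the indicator of the quadrant and are
    dominated by |D|, while each of their integrals vanishes by [d0]. *)
Let int_ray a c : (\int[leb2 R]_(x in ray a c) (D x)%:E = 0)%E.
Proof.
have mr : measurable (ray a c : set mplane) by apply: measurable_rect; exact: measurable_itv.
rewrite integral_mkcond.
pose f_ n x := (D x * quad_test a c p q s t n x)%:E.
pose f' x := (D x * \1_(ray a c) x)%:E.
have H1 n : measurable_fun setT (f_ n : mplane -> _).
  apply/measurable_EFinP; apply: measurable_funM; first exact/measurable_EFinP.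
  by apply: pmeas_smooth; exact: smooth_quad_test.
have H2 : measurable_fun setT (f' : mplane -> _).
  apply/measurable_EFinP; apply: measurable_funM; first exact/measurable_EFinP.
  exact: measurable_indic.
have H3 : {ae leb2 R, forall x, setT x -> f_ ^~ x @ \oo --> f' x}.
  apply: aeW => x _; apply: cvg_EFin; first exact: nearW.
  have [Qx|Qx] := pselect (Q x); last first.
    rewrite /D patchE memNset// mul0r.
    rewrite (_ : _ \o _ = cst 0); first exact: cvg_cst.
    by apply/funext => n; rewrite /f_ /D /= patchE memNset// mul0r.
  by apply: cvgM; [exact: cvg_cst|exact: quad_test_cvg].
have H5 : {ae leb2 R, forall x n, setT x -> (`|f_ n x| <= `|(D x)%:E|)%E}.
  apply: aeW => x n _; rewrite lee_fin normrM ler_piMr//.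
  by have /andP[h1 h2] := quad_test_bound a c p q s t n x; rewrite ger0_norm.
have [_ _] := @dominated_convergence _ _ _ (leb2 R) setT measurableT f_ f' _ H1 H2 H3 (integrable_abse iD) H5.
rewrite (_ : [sequence _]_n = cst 0%E).
  move=> /cvg_lim; rewrite lim_cst// => ->//.
  by apply: eq_integral => x _; rewrite patchE /f' indicE; case: ifP; rewrite ?mulr1 ?mulr0.
apply/funext => n /=.
have := d0 (test_quad a c n cO).
rewrite intO_ext0 /Rintegral.
have E x : ext0 Omega (fun x => d x * quad_test a c p q s t n x) x = D x * quad_test a c p q s t n x.
  have [Qx|Qx] := pselect (Q x).
    by rewrite ext0_in /D ?patchE ?mem_set//; apply: cO; exact: oquad_sub.
  rewrite quad_test_out// mulr0.
  have [Ox|Ox] := pselect (Omega x); last by rewrite ext0_out.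
  by rewrite ext0_in// quad_test_out// mulr0.
under eq_integral do rewrite E.
move=> h; rewrite -[LHS]fineK ?h//.
apply: integrable_fin_num => //.
have [mD' [C DC]] := integrable_intle iD.
apply: (intle_integrable _ _ DC).1.
  apply: measurable_funM; first exact/measurable_EFinP.
  by apply: pmeas_smooth; exact: smooth_quad_test.
move=> x; rewrite normrM ler_piMr//.
by have /andP[h1 h2] := quad_test_bound a c p q s t n x; rewrite ger0_norm.
Qed.

(** The sets over which D integrates to zero form a Dynkin system containing the quadrants; hence
    all measurable sets are among them. *)
Lemma dubois_quad : {ae leb2 R, forall x, Q x -> d x = 0}.
Proof.
have D0 : ae_eq (leb2 R) (setT : set mplane) (EFin \o D) (cst 0%E).
  apply: integral_ae_eq => //.
  move=> E _ mE; rewrite [RHS]integral0.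
  move: E mE; rewrite measurable_rays.
  (* D vanishes outside the rectangle, so the whole plane counts as the quadrant at its lower left
     corner. *)
  have intT : (\int[leb2 R]_(x in setT) (D x)%:E = 0)%E.
    rewrite -(int_ray p s) [RHS]integral_mkcond; apply: eq_integral => x _.
    rewrite patchE; case: ifPn => //; rewrite notin_setE => h.
    rewrite /D patchE; case: ifPn => // /set_mem [/=]; rewrite !in_itv/= => /andP[h1 _] /andP[h2 _].
    by exfalso; apply: h; split; rewrite /= in_itv/= andbT.
  apply: (@dynkin_induction _ mplane rays) => //.
  - exact: measurable_rays.
  - exact: setI_closed_rays.
  - by move=> _ [a [c ->]]; exact: int_ray.
  - move=> S mS hS; move: intT.
    rewrite -(setUv S) integral_setU//; first by rewrite hS add0e.
    + exact: measurableC.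
    + by rewrite setUv.
    + by rewrite disj_set2E setICr.
  - move=> F mF tF hF; rewrite integral_bigcup//.
      by rewrite eseries0.
    by apply: integrableS iD => //; exact: bigcupT_measurable.
apply: aeS D0 => x /(_ Logic.I) /= [+] Qx.
by rewrite /D patchE mem_set.
Qed.

End Quad.

(** Omega is covered by the open rational rectangles whose closed versions lie in it; there are
    countably many of them, so the exceptional sets add up to a negligible one. *)
Lemma dubois d : loc_integrable Omega d ->
  (forall phi, test_fun Omega phi -> intO Omega (fun x => d x * phi x) = 0) ->
  aeO Omega d (fun=> 0).
Proof.
move=> ld d0.
pose rQ (k : rat * rat * (rat * rat)) := (ratr k.1.1 : R, ratr k.1.2 : R, ratr k.2.1 : R, ratr k.2.2 : R).
pose P n (x : plane R) := forall k, unpickle n = Some k ->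
  cquad (ratr k.1.1 : R) (ratr k.1.2) (ratr k.2.1) (ratr k.2.2) `<=` Omega ->
  oquad (ratr k.1.1 : R) (ratr k.1.2) (ratr k.2.1) (ratr k.2.2) x -> d x = 0.
have : {ae leb2 R, forall x, forall n, P n x}.
  apply/ae_foralln => n; rewrite /P.
  case: (unpickle n) => [k|]; last by apply: aeW => x k.
  have [sub|nsub] := pselect (cquad (ratr k.1.1 : R) (ratr k.1.2) (ratr k.2.1) (ratr k.2.2) `<=` Omega).
    by apply: aeS (dubois_quad ld sub d0) => x h _ [<-] _; exact: h.
  by apply: aeW => x _ [<-].
apply: aeS => x Px Ox.
have /nbhs_ballP[e /= e0 eA] := open_nbhs_nbhs (conj oO Ox).
have h1 : x.1 - e < x.1 by rewrite ltrBlDr ltrDl.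
have h2 : x.1 < x.1 + e by rewrite ltrDl.
have h3 : x.2 - e < x.2 by rewrite ltrBlDr ltrDl.
have h4 : x.2 < x.2 + e by rewrite ltrDl.
have [a1 /[!in_itv]/= /andP[a11 a12]] := rat_in_itvoo h1.
have [b1 /[!in_itv]/= /andP[b11 b12]] := rat_in_itvoo h2.
have [c1 /[!in_itv]/= /andP[c11 c12]] := rat_in_itvoo h3.
have [d1 /[!in_itv]/= /andP[d11 d12]] := rat_in_itvoo h4.
apply: (Px (pickle ((a1, b1), (c1, d1))) ((a1, b1), (c1, d1))).
- by rewrite pickleK.
- case=> y1 y2 [/=]; rewrite !in_itv/= => /andP[ya yb] /andP[yc yd].
  by apply: eA; split; rewrite /ball/= ltr_norml; apply/andP; split; lra.
- by split; rewrite /= in_itv/=; apply/andP; split.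
Qed.

End Dubois.

Section WeakCalculus.
Context {R : realType}.
Implicit Types f g : plane R -> R.

Lemma intle_ae f g C : intle f C -> pmeas g -> (forall x, 0 <= g x) ->
  {ae leb2 R, forall x, g x = f x} -> intle g C.
Proof.
move=> [mf f0 fC] mg g0 fg; split => //; apply: le_trans fC.
rewrite le_eqVlt; apply/orP; left; apply/eqP.
apply: ge0_ae_eq_integral => //.
- exact/measurable_EFinP.
- exact/measurable_EFinP.
- by move=> x _; rewrite lee_fin.
- by move=> x _; rewrite lee_fin.
- by apply: aeS fg => x -> _.
Qed.

Lemma intle_mono_ae f g C : intle f C -> pmeas g -> (forall x, 0 <= g x) ->
  {ae leb2 R, forall x, g x <= f x} -> intle g C.
Proof.
move=> [mf f0 fC] mg g0 fg; split => //; apply: le_trans fC.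
apply: ae_ge0_le_integral => //.
- by move=> x _; rewrite lee_fin.
- exact/measurable_EFinP.
- by move=> x _; rewrite lee_fin.
- exact/measurable_EFinP.
- by apply: aeS fg => x h _; rewrite lee_fin.
Qed.

Lemma negligible_point (a : plane R) : {ae leb2 R, forall x, x <> a}.
Proof.
exists ([set a.1] `*` [set a.2]); split.
- by apply: measurable_rect; exact: measurable_set1.
- rewrite (_ : leb2 R _ = lebesgue_measure [set a.1] * lebesgue_measure [set a.2])%E.
    by rewrite lebesgue_measure_set1 mul0e.
  by apply: product_measure1E; exact: measurable_set1.
- by move=> x /= /contrapT ->.
Qed.

Variable Omega : set (plane R).
Hypothesis oO : open Omega.

Local Notation ext := (ext0 Omega).

Lemma ext0M f g x : ext (fun x => f x * g x) x = ext f x * ext g x.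
Proof. by have [Ox|Ox] := pselect (Omega x); [rewrite !ext0_in|rewrite !ext0_out// mulr0]. Qed.

Lemma ext0B f g x : ext (fun x => f x - g x) x = ext f x - ext g x.
Proof. by have [Ox|Ox] := pselect (Omega x); [rewrite !ext0_in|rewrite !ext0_out// subr0]. Qed.

Lemma ext0_ge0 f : (forall x, 0 <= f x) -> forall x, 0 <= ext f x.
Proof. by move=> f0 x; have [Ox|Ox] := pselect (Omega x); [rewrite !ext0_in|rewrite !ext0_out]. Qed.

Lemma ext0_test f x : test_fun Omega f -> ext f x = f x.
Proof.
by move=> tf; have [Ox|Ox] := pselect (Omega x); [rewrite !ext0_in|rewrite !ext0_out// (test_out tf)].
Qed.

Lemma aeO_ext0 f g : aeO Omega f g -> {ae leb2 R, forall x, ext f x = ext g x}.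
Proof.
apply: aeS => x h.
by have [Ox|Ox] := pselect (Omega x); [rewrite !ext0_in ?h|rewrite !ext0_out].
Qed.

Lemma loc_test_integrable g phi : loc_integrable Omega g -> test_fun Omega phi ->
  (leb2 R).-integrable setT (EFin \o ext (fun x => g x * phi x)).
Proof.
move=> [mg lg] tphi; have [sphi [K [cK KO phi0]]] := tphi.
have [M M0 phiM] := test_bounded tphi.
have mK : measurable (K : set mplane).
  by apply: closed_measurable_plane; exact: compact_closed_plane.
have : (leb2 R).-integrable setT (EFin \o (g \_ K)).
  by have [h _] := @integrable_mkcond _ _ _ (leb2 R) _ (EFin \o g) mK;
     rewrite -restrict_EFin; apply: h; exact: lg.
move=> /integrable_intle[mgK [C gC]].
apply: (intle_integrable _ _ (intleZ (ltW M0) gC)).1.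
  apply: (measO_ext0 oO); apply: measurable_funM => //.
  by apply: pmeas_measO; exact: pmeas_smooth.
move=> x; rewrite ext0M (ext0_test _ tphi) normrM.
have [Kx|Kx] := pselect (K x); last first.
  by rewrite phi0// normr0 mulr0 mulr_ge0// ltW.
rewrite ext0_in ?patchE ?mem_set//; last exact: KO.
by rewrite mulrC ler_wpM2r.
Qed.

Lemma loc_integrableB f g : loc_integrable Omega f -> loc_integrable Omega g ->
  loc_integrable Omega (fun x => f x - g x).
Proof.
move=> [mf lf] [mg lg]; split; first exact: measurable_funB.
move=> K cK KO.
have mK : measurable (K : set mplane).
  by apply: closed_measurable_plane; exact: compact_closed_plane.
exact: (@integrableB _ _ _ _ _ mK _ _ (lf K cK KO) (lg K cK KO)).
Qed.

Lemma intO_B f g : (leb2 R).-integrable setT (EFin \o ext f) ->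
  (leb2 R).-integrable setT (EFin \o ext g) ->
  intO Omega (fun x => f x - g x) = intO Omega f - intO Omega g.
Proof.
move=> fi gi; rewrite !intO_ext0 -RintegralB//.
by congr (Rintegral _ _ _); apply/funext => x; rewrite ext0B.
Qed.

Lemma is_wpartialB j f g f' g' : is_wpartial Omega j f g -> is_wpartial Omega j f' g' ->
  is_wpartial Omega j (fun x => f x - f' x) (fun x => g x - g' x).
Proof.
move=> [lf lg h] [lf' lg' h']; split; [exact: loc_integrableB|exact: loc_integrableB|].
move=> phi tphi; have tD := test_D j tphi.
rewrite (_ : (fun x => (f x - f' x) * _) = (fun x => f x * 'D_(dir j) phi x - f' x * 'D_(dir j) phi x)); last first.
  by apply/funext => x; rewrite mulrBl.
rewrite [in RHS](_ : (fun x => _ * phi x) = (fun x => g x * phi x - g' x * phi x)); last first.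
  by apply/funext => x; rewrite mulrBl.
rewrite !intO_B; try exact: loc_test_integrable.
by rewrite h// h'// opprB addrC opprK.
Qed.

Lemma weak_unique j f g g' : is_wpartial Omega j f g -> is_wpartial Omega j f g' -> aeO Omega g g'.
Proof.
move=> [lf lg h] [_ lg' h'].
have : aeO Omega (fun x => g x - g' x) (fun=> 0).
  apply: dubois => //; first exact: loc_integrableB.
  move=> phi tphi.
  rewrite (_ : (fun x => _ * phi x) = (fun x => g x * phi x - g' x * phi x)); last first.
    by apply/funext => x; rewrite mulrBl.
  rewrite intO_B; try exact: loc_test_integrable.
  by apply/eqP; rewrite subr_eq0 -eqr_opp -h// -h'.
by apply: aeS => x hx Ox; apply/eqP; rewrite -subr_eq0 hx.
Qed.

Lemma wpartialP j f g : is_wpartial Omega j f g -> is_wpartial Omega j f (wpartial Omega j f).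
Proof. by move=> h; rewrite /wpartial; case: xgetP => [g' ->//|/(_ g)]. Qed.

Lemma wpartial_ae j f g : is_wpartial Omega j f g -> aeO Omega (wpartial Omega j f) g.
Proof. by move=> h; exact: weak_unique (wpartialP h) h. Qed.

Lemma wpartial_smooth j f : smooth f -> aeO Omega (wpartial Omega j f) ('D_(dir j) f).
Proof. by move=> sf; apply: wpartial_ae; exact: is_wpartial_smooth. Qed.

Lemma wpartial_measO j f g : is_wpartial Omega j f g -> measO Omega (wpartial Omega j f).
Proof. by move=> /wpartialP[_ []]. Qed.

Section Weighted.
Variable w : plane R -> R.
Hypotheses (mw : pmeas w) (w0 : forall x, 0 <= w x).
Variable Cw : R.
Hypothesis iw : intle (ext w) Cw.

Lemma intle_ext0_ae f g C : aeO Omega f g -> measO Omega g -> (forall x, 0 <= g x) ->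
  intle (ext f) C -> intle (ext g) C.
Proof.
move=> fg mg g0 fC; apply: intle_ae fC _ _ _.
- exact: measO_ext0.
- exact: ext0_ge0.
- by apply: aeS (aeO_ext0 fg) => x ->.
Qed.

Lemma L2w_intle f : L2w Omega w f <-> measO Omega f /\ exists C, intle (ext (fun x => f x ^+ 2 * w x)) C.
Proof.
have E : (\int[leb2 R]_(x in Omega) (`|f x| ^+ 2 * w x)%:E = pint (ext (fun x => (f x ^+ 2 * w x)%R)))%E.
  rewrite integral_mkcond /pint; apply: eq_integral => x _.
  rewrite /ext0 !patchE; case: ifP => // _.
  by rewrite real_normK// num_real.
rewrite /L2w E; split => -[mf h]; split => //.
  apply: intle_exists => //.
    apply: measO_ext0 => //; apply: measurable_funM; first exact: measurable_funX.
    exact: pmeas_measO.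
  by apply: ext0_ge0 => x; rewrite mulr_ge0// sqr_ge0.
by case: h => C /intle_lty.
Qed.

Lemma test_weighted phi : test_fun Omega phi -> exists C, intle (ext (fun x => phi x ^+ 2 * w x)) C.
Proof.
move=> tphi; have [M M0 phiM] := test_bounded tphi.
exists (M ^+ 2 * Cw).
apply: (@intle_mono _ _ (fun x => M ^+ 2 * ext w x)).
- apply: measO_ext0 => //; apply: measurable_funM; last exact: pmeas_measO.
  by apply: measurable_funX; apply: pmeas_measO; apply: pmeas_smooth; exact: test_smooth tphi.
- move=> x; rewrite ext0_ge0/=; last by move=> y; rewrite mulr_ge0// sqr_ge0.
  have [Ox|Ox] := pselect (Omega x); last by rewrite !ext0_out// mulr0.
  rewrite !ext0_in// ler_wpM2r// -(real_normK (num_real (phi x))).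
  by rewrite lerXn2r// nnegrE// ltW.
- by apply: intleZ => //; exact: sqr_ge0.
Qed.

Lemma weighted_sqrB f g C C' : measO Omega f -> measO Omega g ->
  intle (ext (fun x => f x ^+ 2 * w x)) C -> intle (ext (fun x => g x ^+ 2 * w x)) C' ->
  intle (ext (fun x => (f x - g x) ^+ 2 * w x)) (2 * C + 2 * C').
Proof.
move=> mf mg fC gC.
apply: (@intle_mono _ _ (fun x => 2 * ext (fun x => f x ^+ 2 * w x) x + 2 * ext (fun x => g x ^+ 2 * w x) x)).
- apply: measO_ext0 => //; apply: measurable_funM; last exact: pmeas_measO.
  by apply: measurable_funX; exact: measurable_funB.
- move=> x; rewrite ext0_ge0/=; last by move=> y; rewrite mulr_ge0// sqr_ge0.
  have [Ox|Ox] := pselect (Omega x); last by rewrite !ext0_out// mulr0 addr0.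
  rewrite !ext0_in//; have h := ler_wpM2r (w0 x) (sqrD_le (f x) (- g x)).
  by apply: le_trans h _; rewrite sqrrN le_eqVlt; apply/orP; left; apply/eqP; ring.
- by apply: intleD; apply: intleZ.
Qed.

Lemma intO_intle f e : (forall x, 0 <= f x) -> measO Omega f -> (exists C, intle (ext f) C) ->
  intO Omega f <= e -> intle (ext f) e.
Proof.
move=> f0 mf [C fC] fe; split; [exact: measO_ext0|exact: ext0_ge0|].
rewrite -lee_fin in fe; apply: le_trans fe; rewrite intO_ext0 /Rintegral fineK//.
rewrite ge0_fin_numE; first exact: intle_lty fC.
by apply: integral_ge0 => x _; rewrite lee_fin; exact: ext0_ge0.
Qed.

Lemma vcompB (v phi : vfield R) i x : vcomp (v - phi) i x = vcomp v i x - vcomp phi i x.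
Proof. by rewrite /vcomp !mxE. Qed.

Lemma ext0_sum (J : Type) (s : seq J) (F : J -> plane R -> R) x :
  ext (fun x => \sum_(j <- s) F j x) x = \sum_(j <- s) ext (F j) x.
Proof.
have [Ox|Ox] := pselect (Omega x).
  by rewrite ext0_in//; apply: eq_bigr => j _; rewrite ext0_in.
by rewrite ext0_out// big1// => j _; rewrite ext0_out.
Qed.

Lemma ext0_le f g : (forall x, f x <= g x) -> forall x, ext f x <= ext g x.
Proof. by move=> fg x; have [Ox|Ox] := pselect (Omega x); [rewrite !ext0_in|rewrite !ext0_out]. Qed.

Lemma measO_sqrw f : measO Omega f -> measO Omega (fun x => f x ^+ 2 * w x).
Proof. by move=> mf; apply: measurable_funM; [exact: measurable_funX|exact: pmeas_measO]. Qed.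

(** The separate bounds exclude the default value that [intO] takes on a non-integrable function;
    without them a bound on [intO] says nothing. *)
Lemma intle_sum_elim (J : finType) (F : J -> plane R -> R) e :
  (forall j x, 0 <= F j x) -> (forall j, measO Omega (F j)) -> (forall j, exists C, intle (ext (F j)) C) ->
  intO Omega (fun x => \sum_j F j x) <= e -> forall j, intle (ext (F j)) e.
Proof.
move=> F0 mF iF Fe j.
have mS : measO Omega (fun x => \sum_j F j x) by exact: measurable_sum.
have S0 x : 0 <= \sum_j F j x by exact: sumr_ge0.
have : intle (ext (fun x => \sum_j F j x)) e.
  apply: intO_intle => //.
  pose C j := xget 0 [set C | intle (ext (F j)) C].
  exists (\sum_j C j).
  apply: intle_ext (intle_sum _ (C := C) _); first by move=> x; rewrite ext0_sum.
  by move=> k; rewrite /C; case: xgetP => [c ->//|h]; have [c /h] := iF k.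
apply: intle_mono; first exact: measO_ext0.
move=> x; rewrite ext0_ge0//= ext0_le// => y.
by rewrite (bigD1 j)//= lerDl sumr_ge0.
Qed.

(** Splits the single norm of the definition into separate bounds on the components and on their
    derivatives, with the classical derivatives of phi in place of the weak ones. *)
Lemma H01v_approx v : H01v Omega w v -> forall e, 0 < e -> exists phi, [/\ test_field Omega phi,
  forall i, intle (ext (fun x => (vcomp v i x - vcomp phi i x) ^+ 2 * w x)) e &
  forall i j, intle (ext (fun x => (wpartial Omega j (vcomp v i) x - 'D_(dir j) (vcomp phi i) x) ^+ 2 * w x)) e].
Proof.
move=> [Hv av] e e0; have := av (Num.sqrt e); rewrite sqrtr_gt0 => /(_ e0)[phi tphi].
rewrite /H1vnorm /L2vnorm ltr_sqrt//.
set A := intO _ _; set B := intO _ _.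
have A0 : 0 <= A.
  apply: Rintegral_ge0 => x _; rewrite mulr_ge0//.
  by apply: sumr_ge0 => i _; rewrite -expr2 sqr_ge0.
have B0 : 0 <= B.
  apply: Rintegral_ge0 => x _; rewrite mulr_ge0//.
  by apply: sumr_ge0 => i _; apply: sumr_ge0 => j _; rewrite -expr2 sqr_ge0.
rewrite sqr_sqrtr// => ABe.
have Ae : A <= e by lra.
have Be : B <= e by lra.
exists phi; split => //.
  have mt i : measO Omega (fun x => vcomp v i x - vcomp phi i x).
    apply: measurable_funB; first by have [[]] := Hv i.
    by apply: pmeas_measO; apply: pmeas_smooth; apply: test_smooth; exact: tphi.
  apply: intle_sum_elim.
  - by move=> i x; rewrite mulr_ge0// sqr_ge0.
  - by move=> i; exact: measO_sqrw.
  - move=> i; have [/(L2w_intle _).1[m1 [C1 h1]] _] := Hv i.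
    have [C2 h2] := test_weighted (tphi i).
    exists (2 * C1 + 2 * C2); apply: weighted_sqrB => //.
    by apply: pmeas_measO; apply: pmeas_smooth; apply: test_smooth; exact: tphi.
  - rewrite (_ : (fun x => _) = (fun x => dot ((v - phi) x) ((v - phi) x) * w x))//.
    apply/funext => x; rewrite /dot mulr_suml; apply: eq_bigr => i _.
    by rewrite expr2 -[(v - phi) x ord0 i]/(vcomp (v - phi) i x) vcompB.
have wp i j : exists2 g, is_wpartial Omega j (vcomp v i) g & L2w Omega w g.
  by have [_ /(_ j)[g [h1 h2]]] := Hv i; exists g.
have mD i j : measO Omega ('D_(dir j) (vcomp phi i)).
  by apply: pmeas_measO; apply: pmeas_smooth; apply: smooth_D; apply: test_smooth; exact: tphi.
(* The norm contains the derivative that [wpartial] picks for v - phi; uniqueness of weak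
   derivatives identifies it almost everywhere with the difference. *)
have aeE i j : aeO Omega (wpartial Omega j (vcomp (v - phi) i))
    (fun x => wpartial Omega j (vcomp v i) x - 'D_(dir j) (vcomp phi i) x).
  have [g hg _] := wp i j.
  apply: wpartial_ae; rewrite (_ : vcomp (v - phi) i = (fun x => vcomp v i x - vcomp phi i x)).
    apply: is_wpartialB; first exact: wpartialP hg.
    by apply: is_wpartial_smooth => //; apply: test_smooth; exact: tphi.
  by apply/funext => x; rewrite vcompB.
have mwp i j : measO Omega (wpartial Omega j (vcomp v i)).
  by have [g hg _] := wp i j; exact: wpartial_measO hg.
have mwp' i j : measO Omega (wpartial Omega j (vcomp (v - phi) i)).
  have [g hg _] := wp i j.
  apply: (@wpartial_measO _ _ (fun x => wpartial Omega j (vcomp v i) x - 'D_(dir j) (vcomp phi i) x)).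
  rewrite (_ : vcomp (v - phi) i = (fun x => vcomp v i x - vcomp phi i x)).
    apply: is_wpartialB; first exact: wpartialP hg.
    by apply: is_wpartial_smooth => //; apply: test_smooth; exact: tphi.
  by apply/funext => x; rewrite vcompB.
have i1 i j : exists C, intle (ext (fun x => (wpartial Omega j (vcomp v i) x - 'D_(dir j) (vcomp phi i) x) ^+ 2 * w x)) C.
  have [g hg /(L2w_intle _).1[m1 [C1 h1]]] := wp i j.
  have [C2 h2] := test_weighted (test_D j (tphi i)).
  exists (2 * C1 + 2 * C2); apply: weighted_sqrB => //.
  apply: intle_ext0_ae h1; [|exact: measO_sqrw|by move=> x; rewrite mulr_ge0// sqr_ge0].
  by apply: aeS (wpartial_ae hg) => x hx Ox; rewrite hx.
move=> i j.
have mB i' j' : measO Omega (fun x => (wpartial Omega j' (vcomp v i') x - 'D_(dir j') (vcomp phi i') x)).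
  by apply: measurable_funB; [exact: mwp|exact: mD].
apply: (@intle_ext0_ae (fun x => wpartial Omega j (vcomp (v - phi) i) x ^+ 2 * w x)).
- by apply: aeS (aeE i j) => x hx Ox; rewrite hx.
- exact: measO_sqrw.
- by move=> x; rewrite mulr_ge0// sqr_ge0.
apply: (@intle_sum_elim _ (fun (k : 'I_2 * 'I_2) x => wpartial Omega k.2 (vcomp (v - phi) k.1) x ^+ 2 * w x) e _ _ _ _ (i, j)).
- by move=> k x; rewrite mulr_ge0// sqr_ge0.
- by move=> k; exact: measO_sqrw.
- move=> k; have [C hC] := i1 k.1 k.2; exists C.
  apply: intle_ext0_ae hC; [|exact: measO_sqrw|by move=> x; rewrite mulr_ge0// sqr_ge0].
  by apply: aeS (aeE k.1 k.2) => x hx Ox; rewrite hx.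
- rewrite (_ : (fun x => _) = (fun x => frob (wgrad Omega (v - phi) x) (wgrad Omega (v - phi) x) * w x))//.
  apply/funext => x; rewrite /frob pair_bigA/= mulr_suml; apply: eq_bigr => k _.
  by rewrite /wgrad mxE expr2.
Qed.

End Weighted.
End WeakCalculus.

Section Fatou.
Context {R : realType}.

(** Fatou's lemma for an f that is almost everywhere below the lower limit of the F n. Convergence
    is not assumed, so the lemma serves for limits of test functions and for dyadic majorants
    alike. *)
Lemma intle_fatou (F : nat -> plane R -> R) f C :
  (forall n, intle (F n) C) -> pmeas f -> (forall x, 0 <= f x) ->
  {ae leb2 R, forall x, forall e, 0 < e -> \forall n \near \oo, f x <= F n x + e} ->
  intle f C.
Proof.
move=> FC mf f0 fF; split => //.
have mF n : measurable_fun setT (fun x : mplane => (F n x)%:E).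
  by have [m _ _] := FC n; exact: measurableT_comp.
apply: (@le_trans _ _ (\int[leb2 R]_x limn_einf (fun n => (F n x)%:E))%E).
  apply: ae_ge0_le_integral => //.
  - by move=> x _; rewrite lee_fin.
  - exact: measurableT_comp.
  - move=> x _; rewrite limn_einf_lim; apply: lime_ge; first exact: is_cvg_einfs.
    by near=> n; apply: le_ereal_inf_tmp => _ [k _ <-]; rewrite lee_fin; have [] := FC k.
  - rewrite (_ : (fun x => _) = (fun x => - limn_esup (fun n => (- F n x)%:E))%E).
      apply: (measurableT_comp (@oppe_measurable _ setT)); apply: measurable_fun_limn_esup => n.
      by apply: measurableT_comp => //; apply: measurableT_comp => //; have [] := FC n.
    by apply/funext => x; rewrite -limn_einfN; congr limn_einf; apply/funext => n /=; rewrite opprK.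
  - apply: aeS fF => x h _; apply/lee_addgt0Pr => e e0.
    rewrite -leeBlDr// -EFinB limn_einf_lim.
    apply: lime_ge; first exact: is_cvg_einfs.
    have [N _ hN] := h _ e0.
    near=> n; apply: le_ereal_inf_tmp => _ [k /= nk <-]; rewrite lee_fin lerBlDr; apply: hN => /=.
    by apply: leq_trans nk; near: n; exact: nbhs_infty_ge.
apply: le_trans (fatou _ _ _ _) _ => //.
  by move=> n x _; rewrite lee_fin; have [] := FC n.
rewrite limn_einf_lim; apply: lime_le; first exact: is_cvg_einfs.
near=> n; have [_ _ h] := FC n; apply: le_trans h.
by apply: ereal_inf_lbound; exists n => //=.
Unshelve. all: by end_near.
Qed.

Lemma powR_exprn (a b : R) n : 0 <= a -> (a ^+ n) `^ b = (a `^ b) ^+ n.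
Proof.
move=> a0; elim: n => [|n IH]; first by rewrite !expr0 powR1.
by rewrite !exprS powRM ?exprn_ge0// IH.
Qed.

End Fatou.

(** * The weights *)

Section Weights.
Context {R : realType}.
Local Notation edist := (@Defs.edist R).
Variables (Omega : set (plane R)) (l : nat) (D : 'I_l -> plane R) (alpha : R).
Hypotheses (a0 : 0 < alpha) (a2 : alpha < 2).
Variable L : R.
Hypotheses (L0 : 0 < L) (OL : Omega `<=` obox L) (oO : open Omega).
Hypothesis (OD : forall t, Omega (D t)).
Local Notation ext := (ext0 Omega).
Local Notation rh := (rho Omega D alpha).
Local Notation irh := (irho Omega D alpha).

Lemma edist_ge0 (x y : plane R) : 0 <= edist x y. Proof. exact: sqrtr_ge0. Qed.

Lemma edist_eq0 (x y : plane R) : edist x y = 0 -> x = y.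
Proof.
move=> /eqP; rewrite sqrtr_eq0 => h.
have h1 := sqr_ge0 (x.1 - y.1); have h2 := sqr_ge0 (x.2 - y.2).
have e1 : (x.1 - y.1) ^+ 2 = 0 by lra.
have e2 : (x.2 - y.2) ^+ 2 = 0 by lra.
move/eqP: e1; move/eqP: e2; rewrite !sqrf_eq0 !subr_eq0 => /eqP e2 /eqP e1.
by case: x y e1 e2 {h h1 h2} => ? ? [? ?] /= -> ->.
Qed.

Lemma continuous_edist (y : plane R) : continuous (fun x => edist x y).
Proof.
move=> x; rewrite /edist.
apply: (@continuous_comp _ _ _ (fun x : plane R => (x.1 - y.1) ^+ 2 + (x.2 - y.2) ^+ 2) Num.sqrt).
  apply: cvgD.
    apply: (@continuous_comp _ _ _ (fun x : plane R => x.1 - y.1) (fun t : R => t ^+ 2)).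
      by apply: cvgB; [exact: cvg_fst|exact: cvg_cst].
    exact: exprn_continuous.
  apply: (@continuous_comp _ _ _ (fun x : plane R => x.2 - y.2) (fun t : R => t ^+ 2)).
    by apply: cvgB; [exact: cvg_snd|exact: cvg_cst].
  exact: exprn_continuous.
exact: sqrt_continuous.
Qed.

Lemma rho_cases x : (exists t, rh x = edist x (D t) `^ alpha) \/ rh x = 1.
Proof. by rewrite /rho; case: pickP => [t _|_]; [left; exists t|right]. Qed.

Lemma rho_ge0 x : 0 <= rh x.
Proof. by have [[t ->]|->] := rho_cases x; rewrite ?powR_ge0. Qed.

Lemma irho_ge0 x : 0 <= irh x. Proof. by rewrite invr_ge0 rho_ge0. Qed.

Lemma rho_gt0 x : (forall t, x <> D t) -> 0 < rh x.
Proof.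
move=> h; have [[t ->]|->//] := rho_cases x.
rewrite powR_gt0// lt_neqAle edist_ge0 andbT eq_sym; apply/eqP => /edist_eq0; exact: h.
Qed.

Lemma rho_gt0_ae : {ae leb2 R, forall x, 0 < rh x}.
Proof.
apply: (@aeS _ (fun x => forall t : 'I_l, x <> D t)); first exact: rho_gt0.
apply: filter_forall => t; exact: negligible_point.
Qed.

Lemma measurable_rho : pmeas rh.
Proof.
(* The outcome of [pick] depends only on this vector of tests. It takes finitely many values, each
   on a measurable set where the weight is 1 or a power of the distance to one fixed point. *)
pose P (x : plane R) := [ffun t : 'I_l => (l == 1%N) || (edist x (D t) < dD Omega D / 2)].
have mP (v : {ffun 'I_l -> bool}) : measurable ([set x | P x = v] : set mplane).
  rewrite (_ : [set x | P x = v] = \bigcap_(t in [set: 'I_l])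
      [set x | ((l == 1%N) || (edist x (D t) < dD Omega D / 2)) = v t]); last first.
    apply/seteqP; split => x /=.
      by move=> <- t _ /=; rewrite ffunE.
    by move=> h; apply/ffunP => t; rewrite ffunE h.
  apply: fin_bigcap_measurable => // t _.
  have mlt : measurable ([set x | edist x (D t) < dD Omega D / 2] : set mplane).
    apply: open_measurable_plane.
    have := @open_comp _ _ (fun x => edist x (D t)) [set y | y < dD Omega D / 2].
    by apply => [x _|]; [exact: continuous_edist|exact: open_lt].
  case: (l == 1%N) => /=.
    case: (v t).
      by rewrite (_ : [set x | _] = setT)//; apply/seteqP.
    by rewrite (_ : [set x | _] = set0)//; apply/seteqP; split.
  case: (v t) => //=; rewrite (_ : [set x | _] = ~` [set x | edist x (D t) < dD Omega D / 2]).
    exact: measurableC.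
  by apply/seteqP; split => x /=; [move=> -> |move=> /negP/negbTE].
pose F (v : {ffun 'I_l -> bool}) (x : plane R) : R :=
  if [pick t | v t] is Some t then edist x (D t) `^ alpha else 1.
have mF v : pmeas (F v).
  rewrite /F; case: pickP => [t _|_]; last exact: measurable_cst.
  apply: (measurableT_comp (measurable_powR alpha)); apply: pmeas_continuous.
  exact: continuous_edist.
have -> : rh = (fun x => \sum_(v : {ffun 'I_l -> bool}) F v x * \1_([set x | P x = v]) x).
  apply/funext => x; rewrite (bigD1 (P x))//= big1 ?addr0; last first.
    by move=> v vP; rewrite indicE memNset ?mulr0//=; apply/eqP; rewrite eq_sym.
  rewrite indicE mem_set// mulr1 /F /rho.
  by rewrite (eq_pick (Q := P x))// => t; rewrite ffunE.
apply: measurable_sum => v; apply: measurable_funM; first exact: mF.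
exact: measurable_indic.
Qed.

Lemma measurable_irho : pmeas irh.
Proof.
rewrite (_ : irh = fun x => rh x `^ (-1)).
  exact: (measurableT_comp (measurable_powR (-1)) measurable_rho).
by apply/funext => x; rewrite powR_inv1// rho_ge0.
Qed.

Lemma rho_bounded : exists2 M, 0 < M & forall x, Omega x -> rh x <= M.
Proof.
exists (1 + (4 * L) `^ alpha); first by rewrite ltr_wpDr// powR_ge0.
move=> x Ox; have [[t ->]|->] := rho_cases x; last by rewrite lerDl powR_ge0.
apply: (@le_trans _ _ ((4 * L) `^ alpha)); last by rewrite lerDr.
apply: ge0_ler_powR; rewrite ?nnegrE ?edist_ge0 ?(ltW a0)//; first by rewrite mulr_ge0// ltW.
have /oboxP[] := OL Ox; rewrite !ltr_norml => /andP[h1 h2] /andP[h3 h4].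
have /oboxP[] := OL (OD t); rewrite !ltr_norml => /andP[h5 h6] /andP[h7 h8].
have L4 : 0 <= 4 * L by lra.
rewrite -(ger0_norm L4) -sqrtr_sqr /edist ler_wsqrtr//.
have b1 : (x.1 - (D t).1) ^+ 2 <= (2 * L) ^+ 2.
  by rewrite -(real_normK (num_real (x.1 - _))) lerXn2r ?nnegrE ?normr_ge0 ?ler_norml//; lra.
have b2 : (x.2 - (D t).2) ^+ 2 <= (2 * L) ^+ 2.
  by rewrite -(real_normK (num_real (x.2 - _))) lerXn2r ?nnegrE ?normr_ge0 ?ler_norml//; lra.
have L2 := sqr_ge0 L.
by move: b1 b2; rewrite !exprMn; lra.
Qed.

Definition cube (t : plane R) (r : R) : set (plane R) :=
  `[t.1 - r, t.1 + r] `*` `[t.2 - r, t.2 + r].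

Lemma cubeP t r x : cube t r x <-> `|x.1 - t.1| <= r /\ `|x.2 - t.2| <= r.
Proof.
rewrite /cube /=; rewrite !in_itv /= !ler_norml.
by split => -[/andP[? ?] /andP[? ?]]; split; apply/andP; split; lra.
Qed.

Lemma norm_le_edist (x t : plane R) : `|x.1 - t.1| <= edist x t /\ `|x.2 - t.2| <= edist x t.
Proof.
by split; rewrite -sqrtr_sqr; apply: ler_wsqrtr; rewrite (lerDl, lerDr) sqr_ge0.
Qed.

Lemma intle_edist_powR b t : 0 < b -> b < 2 ->
  exists C, intle (ext (fun x => edist x t `^ (- b))) C.
Proof.
move=> b0 b2.
have p1 : (1 : R) `^ b = 1 by rewrite powR1.
pose B : R := 2 `^ b.
have B0 : 0 < B by rewrite powR_gt0.
pose q : R := B / 4.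
have q0 : 0 <= q by rewrite divr_ge0// ltW.
have q1 : q < 1.
  rewrite ltr_pdivrMr// mul1r (_ : 4 = 2 `^ 2%:R); last by rewrite powR_mulrn//; lra.
  rewrite /B /powR pnatr_eq0/= ltr_expR ltr_pM2r//; apply: ln_gt0; lra.
(* A dyadic majorant: at distance between 2^-(k+1) and 2^-k from t the function is at most B^(k+1),
   and at distance at least 1 the first indicator suffices. The k-th term integrates to 4 B q^k, and
   q = 2^b / 4 < 1 because b < 2. *)
pose S n x : R := \1_(obox L) x + \sum_(k < n) (B * B ^+ k) * \1_(cube t (2^-1 ^+ k)) x.
pose C : R := 4 * L ^+ 2 + 4 * B * (1 - q)^-1.
have SC n : intle (S n) C.
  rewrite /S; apply: intleD; first exact: intle_indic_obox.
  apply: (@intle_weak _ _ (\sum_(k < n) (B * B ^+ k) * (4 * (2^-1 ^+ k) ^+ 2))).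
    rewrite (eq_bigr (fun k : 'I_n => 4 * B * q ^+ k)); last first.
      move=> k _; rewrite /q exprMn -(exprM _ k 2) mulnC exprM.
      rewrite (_ : (2^-1 : R) ^+ 2 = 4^-1); last by rewrite expr2; lra.
      by ring.
    rewrite -mulr_sumr ler_wpM2l//; first by rewrite mulr_ge0// ltW.
    have q1' : 0 < 1 - q by rewrite subr_gt0.
    rewrite -(ler_pM2l q1') divff ?gt_eqF//.
    have -> : (1 - q) * \sum_(i < n) q ^+ i = 1 - q ^+ n.
      by rewrite -opprB mulNr -subrX1 opprB.
    by rewrite lerBlDr lerDl exprn_ge0.
  apply: intle_sum => k; apply: intleZ; first by rewrite mulr_ge0// ?exprn_ge0// ltW.
  have k0 : 0 <= (2^-1 ^+ k : R) by rewrite exprn_ge0.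
  have := @intle_indic_rect R (t.1 - 2^-1 ^+ k) (t.1 + 2^-1 ^+ k) (t.2 - 2^-1 ^+ k) (t.2 + 2^-1 ^+ k).
  move=> /(_ _ _)/wrap[]; [lra|lra|].
  apply: intle_weak; rewrite le_eqVlt; apply/orP; left; apply/eqP; ring.
exists C; apply: (intle_fatou SC).
- apply: measO_ext0 => //; apply: pmeas_measO => //.
  apply: (measurableT_comp (measurable_powR (- b))); apply: pmeas_continuous.
  exact: continuous_edist.
- by apply: ext0_ge0 => x; rewrite powR_ge0.
apply: aeS (negligible_point t) => x xt e e0.
have [Ox|nOx] := pselect (Omega x); last first.
  by apply: nearW => n; rewrite ext0_out// addr_ge0// ?(ltW e0)//; have [] := SC n.
rewrite ext0_in//.
pose m := edist x t.
have m0 : 0 < m by rewrite lt_neqAle edist_ge0 andbT eq_sym; apply/eqP => /edist_eq0.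
have S0 k : 0 <= (B * B ^+ k) * \1_(cube t (2^-1 ^+ k)) x :> R.
  by rewrite !mulr_ge0// ?exprn_ge0 ?powR_ge0// ltW.
have [m1|m1] := leP 1 m.
  apply: nearW => n; apply: (@le_trans _ _ 1); last first.
    rewrite /S indicE mem_set; last exact: OL.
    by rewrite -addrA lerDl addr_ge0// ?(ltW e0)//; apply: sumr_ge0.
  rewrite powRN invf_le1 ?powR_gt0//.
  rewrite -p1; apply: ge0_ler_powR; rewrite ?nnegrE ?(ltW b0)//; exact: ltW.
have [k /andP[hk1 hk2]] : exists k, 2^-1 ^+ k.+1 <= m <= 2^-1 ^+ k.
  have ex : exists n, 2^-1 ^+ n <= m.
    have [N hN] : exists N, m^-1 <= 2 ^+ N.
      exists (Num.bound m^-1).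
      have h : 0 <= m^-1 by rewrite invr_ge0 ltW.
      apply: le_trans (ltW (archi_boundP h)) _.
      by rewrite -natrX ler_nat; apply: ltnW; exact: ltn_expl.
    by exists N; rewrite exprVn -[m]invrK lef_pV2 ?posrE ?invr_gt0 ?exprn_gt0.
  case: (ex_minnP ex) => [[|n] hn mn]; first by move: hn; rewrite expr0 leNgt m1.
  exists n; rewrite hn/= leNgt; apply/negP => /ltW /mn; by rewrite ltnn.
exists k.+1 => // n /= kn.
apply: (@le_trans _ _ ((B * B ^+ k) * \1_(cube t (2^-1 ^+ k)) x)); last first.
  rewrite /S (bigD1 (Ordinal kn))//=.
  rewrite -!addrA [X in _ <= X]addrCA lerDl !addr_ge0 ?(ltW e0)//; by apply: sumr_ge0.
rewrite indicE mem_set ?mulr1; last first.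
  by apply/cubeP; have [h1 h2] := norm_le_edist x t; split; [apply: le_trans h1 _|apply: le_trans h2 _].
rewrite -exprS -/m powRN -[X in X <= _]mul1r ler_pdivrMr ?powR_gt0//.
have -> : B ^+ k.+1 = (2 ^+ k.+1) `^ b.
  by rewrite powR_exprn.
rewrite -powRM ?exprn_ge0 ?(ltW m0)//.
rewrite -[X in X <= _]p1; apply: ge0_ler_powR; rewrite ?nnegrE ?(ltW b0)//.
  by rewrite mulr_ge0 ?exprn_ge0 ?(ltW m0).
by move: hk1; rewrite exprVn -[X in X <= _]mul1r ler_pdivrMr ?exprn_gt0// mulrC.
Qed.

Lemma intle_irho_powR (b : R) : 0 < b -> alpha * b < 2 ->
  exists C, intle (ext (fun x => irh x `^ b)) C.
Proof.
move=> b0 ab2.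
pose E t x := edist x (D t) `^ (- (alpha * b)).
have ab0 : 0 < alpha * b by rewrite mulr_gt0.
have /choice[C hC] : forall t, exists C, intle (ext (E t)) C.
  by move=> t; exact: intle_edist_powR.
exists (4 * L ^+ 2 + \sum_t C t).
have h := intleD (intle_indic_obox L0) (intle_sum (index_enum _) hC).
apply: (intle_mono _ _ h).
  apply: measO_ext0 => //; apply: pmeas_measO => //.
  exact: (measurableT_comp (measurable_powR b) measurable_irho).
move=> x; have [Ox|nOx] := pselect (Omega x); last first.
  rewrite ext0_out// lexx/= addr_ge0//; apply: sumr_ge0 => t _.
  by have [_ ->] := hC t.
rewrite !ext0_in// powR_ge0/= indicE mem_set; last exact: OL.
have sum0 : 0 <= \sum_t ext (E t) x by apply: sumr_ge0 => t _; have [_ ->] := hC t.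
rewrite /irho; have [[t ->]|->] := rho_cases x; last by rewrite invr1 powR1 lerDl.
rewrite -powRN -powRrM mulNr (bigD1 t)//= ext0_in// /E.
rewrite addrCA lerDl addr_ge0//; apply: sumr_ge0 => s _; have [_ ->//] := hC s.
Qed.

(** Where the weight vanishes its inverse is 0 by convention, hence the condition on x; it fails on
    a negligible set only. *)
Lemma irho_ge : exists2 c, 0 < c & forall x, Omega x -> 0 < rh x -> c <= irh x.
Proof.
have [M M0 h] := rho_bounded; exists M^-1; first by rewrite invr_gt0.
by move=> x Ox r0; rewrite lef_pV2// h.
Qed.

End Weights.

Section AeLimits.
Context {R : realType}.

(** The lower half of the continuity of t^q, which is what [intle_fatou] asks for. It follows from
    monotonicity, u being the point where u^q = t^q - e. *)
Lemma powR_lsc (t q e : R) : 0 <= t -> 0 < q -> 0 < e ->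
  exists2 d, 0 < d & forall s, 0 <= s -> `|t - s| < d -> t `^ q <= s `^ q + e.
Proof.
move=> t0 q0 e0; have [te|te] := leP (t `^ q) e.
  by exists 1 => // s s0 _; rewrite (le_trans te)// lerDr powR_ge0.
pose u := (t `^ q - e) `^ q^-1.
have ue : u `^ q = t `^ q - e.
  by rewrite /u -powRrM mulVf ?gt_eqF// powRr1// subr_ge0 ltW.
have u0 : 0 <= u by exact: powR_ge0.
have ut : u < t.
  rewrite ltNge; apply/negP => tu.
  have : t `^ q <= u `^ q by apply: ge0_ler_powR => //; exact: ltW.
  by rewrite ue; lra.
exists (t - u); first by rewrite subr_gt0.
move=> s s0 ts; have us : u <= s by move: ts; rewrite ltr_norml => /andP[]; lra.
have : u `^ q <= s `^ q by apply: ge0_ler_powR => //; exact: ltW.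
by rewrite ue; lra.
Qed.

(** The integrals are summable, so the series of the F n x converges for almost every x and its
    terms tend to zero. The prescribed rate 2^-n spares the extraction of a subsequence. *)
Lemma ae_small (F : nat -> plane R -> R) : (forall n, intle (F n) (2^-1 ^+ n)) ->
  {ae leb2 R, forall x, forall e, 0 < e -> \forall n \near \oo, F n x < e}.
Proof.
move=> FC.
have mF n : measurable_fun setT (fun x : mplane => (F n x)%:E).
  by have [m _ _] := FC n; exact: measurableT_comp.
have F0 n x : (0 <= (F n x)%:E)%E by rewrite lee_fin; have [] := FC n.
pose g x := (\sum_(0 <= n <oo) (F n x)%:E)%E.
have g0 x : (0 <= g x)%E by apply: nneseries_ge0.
have mg : measurable_fun (setT : set mplane) g.
  by apply: ge0_emeasurable_sum => // n x _ _; exact: F0.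
have ig : (leb2 R).-integrable setT g.
  apply/integrableP; split => //.
  rewrite (_ : (\int[leb2 R]_x `|g x| = \sum_(0 <= n <oo) pint (F n))%E); last first.
    under eq_integral do rewrite gee0_abs//.
    by rewrite integral_nneseries.
  apply: (@le_lt_trans _ _ 2%:E); last exact: ltry.
  apply: lime_le; first by apply: is_cvg_nneseries => n _ _; apply: integral_ge0 => x _.
  apply: nearW => N.
  apply: (@le_trans _ _ (\sum_(0 <= n < N) (2^-1 ^+ n)%:E)%E).
    by apply: lee_sum => n _; have [] := FC n.
  rewrite sumEFin lee_fin big_mkord.
  have -> : \sum_(i < N) 2^-1 ^+ i = 2 * (1 - 2^-1 ^+ N) :> R.
    have h := subrX1 (2^-1 : R) N.
    have -> : 1 - 2^-1 ^+ N = - (2^-1 ^+ N - 1) :> R by rewrite opprB.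
    by rewrite h; lra.
  have : 0 <= 2^-1 ^+ N :> R by rewrite exprn_ge0.
  lra.
apply: aeS (integrable_ae measurableT ig) => x /(_ I) gx e e0.
have gf : (g x < +oo)%E by rewrite -ge0_fin_numE.
have := nneseries_tail_cvg (P := xpredT) gf (fun k _ => F0 k x).
move=> /fine_cvgP[_]; move/cvgrPdist_lt => /(_ _ e0).
move=> [N _ hN]; have fin N' : \big[+%E/0%E]_(N' <= k <oo) (F k x)%:E \is a fin_num.
  rewrite ge0_fin_numE; last by apply: nneseries_ge0.
  apply: le_lt_trans gf; rewrite /g (nneseries_split 0 N'); last by move=> *; exact: F0.
  by rewrite add0n leeDr// sume_ge0.
exists N => // n /= Nn; have := hN _ Nn; rewrite /= sub0r normrN.
rewrite ger0_norm; last by apply: fine_ge0; apply: nneseries_ge0.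
apply: le_lt_trans; rewrite -lee_fin fineK//.
rewrite (nneseries_split n 1); last by move=> *; exact: F0.
by rewrite addn1 big_nat1 leeDl// nneseries_ge0.
Qed.

End AeLimits.

Section WeightedLimits.
Context {R : realType}.
Variable Omega : set (plane R).
Hypothesis oO : open Omega.
Local Notation ext := (ext0 Omega).
Variable w : plane R -> R.
Hypotheses (mw : pmeas w) (w0 : forall x, 0 <= w x).
Hypothesis wpos : {ae leb2 R, forall x, 0 < w x}.

Lemma ae_weighted (f : plane R -> R) (phi : nat -> plane R -> R) :
  (forall n, intle (ext (fun x => (f x - phi n x) ^+ 2 * w x)) (2^-1 ^+ n)) ->
  {ae leb2 R, forall x, Omega x -> forall e, 0 < e -> \forall n \near \oo, `|f x - phi n x| < e}.
Proof.
move=> h; apply: aeS (aeI wpos (ae_small h)) => x [wx hx] Ox e e0.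
have ew : 0 < e ^+ 2 * w x by rewrite mulr_gt0// exprn_gt0.
apply: filterS (hx _ ew) => n /=; rewrite ext0_in// ltr_pM2r//.
by rewrite -(real_normK (num_real (f x - _))) ltr_pXn2r// nnegrE ltW.
Qed.

Lemma intle_powR_limit (f : plane R -> R) (phi : nat -> plane R -> R) q C : 0 < q ->
  measO Omega f ->
  (forall n, intle (ext (fun x => (f x - phi n x) ^+ 2 * w x)) (2^-1 ^+ n)) ->
  (forall n, intle (fun x => `|phi n x| `^ q) C) ->
  intle (ext (fun x => `|f x| `^ q)) C.
Proof.
move=> q0 mf fphi phiC; apply: (intle_fatou phiC).
- apply: measO_ext0 => //; apply: (measurableT_comp (measurable_powR q)).
  exact: measurableT_comp.
- by apply: ext0_ge0 => x; rewrite powR_ge0.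
apply: aeS (ae_weighted fphi) => x hx e e0.
have [Ox|nOx] := pselect (Omega x); last first.
  by apply: nearW => n; rewrite ext0_out// addr_ge0// ?powR_ge0 ?ltW.
rewrite ext0_in//; have [d d0 hd] := powR_lsc (normr_ge0 (f x)) q0 e0.
apply: filterS (hx Ox _ d0) => n fn; apply: hd => //.
exact: le_lt_trans (ler_dist_dist _ _) fn.
Qed.

End WeightedLimits.

Section Elementary.
Context {R : realType}.
Implicit Types a b c : R.

(** Young's inequality for the exponents (m+1)/m and m+1 without the sharp constants: either b <= t
    c or c < b / t, and one term on the right suffices in each case. *)
Lemma young_pow (t b c : R) (m : nat) : 0 < t -> 0 <= b -> 0 <= c ->
  c ^+ m * b <= t * c ^+ m.+1 + t ^- m * b ^+ m.+1.
Proof.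
move=> t0 b0 c0; have [bc|cb] := leP b (t * c).
  apply: (@le_trans _ _ (t * c ^+ m.+1)).
    by rewrite exprSr mulrCA ler_wpM2l// exprn_ge0.
  by rewrite lerDl mulr_ge0 ?invr_ge0 ?exprn_ge0// ltW.
apply: (@le_trans _ _ (t ^- m * b ^+ m.+1)); last first.
  by rewrite lerDr mulr_ge0 ?exprn_ge0// ltW.
rewrite exprSr mulrA ler_wpM2r// -exprVn -exprMn lerXn2r// ?nnegrE ?mulr_ge0 ?invr_ge0 ?ltW//.
- exact: le_lt_trans (mulr_ge0 (ltW t0) c0) cb.
- by rewrite ltr_pdivlMl.
Qed.

(** The pointwise form of the embedding of L^2(rho) in L^p: if a^2 r < a^p, then a^(2-p) < 1/r, and
    raising to the power p/(2-p) bounds a^p. *)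
Lemma powR_weight_le (a p r : R) : 0 <= a -> 1 <= p -> p < 2 -> 0 < r ->
  a `^ p <= a ^+ 2 * r + r^-1 `^ (p / (2 - p)).
Proof.
move=> a0 p1 p2 r0; have p0 : 0 < p by lra.
have q0 : 0 < 2 - p by lra.
have [h|h] := leP (a `^ p) (a ^+ 2 * r).
  by rewrite (le_trans h)// lerDl powR_ge0.
apply: (@le_trans _ _ (r^-1 `^ (p / (2 - p)))); last by rewrite lerDr mulr_ge0 ?sqr_ge0// ltW.
have a1 : 0 < a.
  rewrite lt_neqAle a0 andbT eq_sym; apply/eqP => a00; move: h.
  by rewrite a00 expr0n mul0r powR0 ?ltxx// gt_eqF.
have -> : a `^ p = (a `^ (2 - p)) `^ (p / (2 - p)).
  by rewrite -powRrM mulrC divfK// gt_eqF.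
apply: ge0_ler_powR; rewrite ?nnegrE ?powR_ge0 ?invr_ge0 ?divr_ge0 ?(ltW r0) ?(ltW p0) ?(ltW q0)//.
rewrite -(ler_pM2r r0) mulVf ?gt_eqF//.
have ap : 0 < a `^ p by rewrite powR_gt0.
rewrite -(ler_pM2l ap) mulr1 mulrA -powRD; last by rewrite (gt_eqF a1) implybT.
by rewrite subrKC powR_mulrn// ltW.
Qed.

End Elementary.

(** * Integrability of fields in the weighted spaces *)

Section Fields.
Context {R : realType}.
Variables (Omega : set (plane R)) (l : nat) (D : 'I_l -> plane R) (alpha : R).
Hypotheses (a0 : 0 < alpha) (a2 : alpha < 2).
Variable L : R.
Hypotheses (L0 : 0 < L) (OL : Omega `<=` obox L) (oO : open Omega).
Hypothesis (OD : forall t, Omega (D t)).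
Local Notation ext := (ext0 Omega).
Local Notation rh := (rho Omega D alpha).
Local Notation irh := (irho Omega D alpha).

Lemma test_supp_box f : test_fun Omega f -> supp_box L f.
Proof.
move=> tf x fx; apply/oboxP; apply: OL; apply: contrapT => nOx.
by move: fx; rewrite (test_out tf nOx) eqxx.
Qed.

Lemma irho_gt0_ae : {ae leb2 R, forall x, 0 < irh x}.
Proof. by apply: aeS (rho_gt0_ae Omega D alpha) => x; rewrite invr_gt0. Qed.

Lemma intle_rho : exists C, intle (ext rh) C.
Proof.
have [M M0 hM] := rho_bounded a0 L0 OL OD.
exists (M * (4 * L ^+ 2)); apply: (intle_mono _ _ (intleZ (ltW M0) (intle_indic_obox L0))).
  by apply: measO_ext0 => //; apply: pmeas_measO; exact: measurable_rho.
move=> x; rewrite ext0_ge0 ?andTb; last by move=> y; exact: rho_ge0.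
have [Ox|Ox] := pselect (Omega x); last by rewrite ext0_out// mulr_ge0// ltW.
by rewrite ext0_in// indicE mem_set ?mulr1 ?hM//; exact: OL.
Qed.

Lemma intle_irho : exists C, intle (ext irh) C.
Proof.
have [] := @intle_irho_powR R Omega l D alpha a0 L L0 OL oO 1 ltr01; first by rewrite mulr1.
move=> C h; exists C; apply: intle_ext h => x.
by have [Ox|Ox] := pselect (Omega x); [rewrite !ext0_in// powRr1// irho_ge0|rewrite !ext0_out].
Qed.

Lemma unweight : exists2 c, 0 < c & forall f C, measO Omega f ->
  intle (ext (fun x => f x ^+ 2 * irh x)) C -> intle (ext (fun x => f x ^+ 2)) (c * C).
Proof.
have [c c0 hc] := irho_ge a0 L0 OL OD.
have c1 : 0 < c^-1 by rewrite invr_gt0.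
exists c^-1 => // f C mf fC.
apply: intle_mono_ae (intleZ (ltW c1) fC) _ _ _.
- by apply: measO_ext0 => //; exact: measurable_funX.
- by apply: ext0_ge0 => x; exact: sqr_ge0.
apply: aeS (rho_gt0_ae Omega D alpha) => x x0.
have [Ox|Ox] := pselect (Omega x); last by rewrite !ext0_out// mulr0.
rewrite !ext0_in// -ler_pdivrMl// invrK mulrC ler_wpM2l ?sqr_ge0//.
exact: hc.
Qed.

Lemma H01v_measO w v i : H01v Omega w v -> measO Omega (vcomp v i).
Proof. by move=> [Hv _]; have [[]] := Hv i. Qed.

Lemma H01v_wpartial w v i j : H01v Omega w v ->
  is_wpartial Omega j (vcomp v i) (wpartial Omega j (vcomp v i)).
Proof. by move=> [Hv _]; have [_ /(_ j)[g [hg _]]] := Hv i; exact: wpartialP hg. Qed.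

Lemma H01v_L2 w v i : pmeas w -> (forall x, 0 <= w x) -> H01v Omega w v ->
  exists C, intle (ext (fun x => vcomp v i x ^+ 2 * w x)) C.
Proof. by move=> mw w0 [Hv _]; have [/(L2w_intle oO mw w0 _).1[_]] := Hv i. Qed.

Lemma H01v_grad_L2 w v i j : pmeas w -> (forall x, 0 <= w x) -> H01v Omega w v ->
  exists C, intle (ext (fun x => wpartial Omega j (vcomp v i) x ^+ 2 * w x)) C.
Proof.
move=> mw w0 [Hv _]; have [_ /(_ j)[g [hg /(L2w_intle oO mw w0 _).1[mg [C gC]]]]] := Hv i.
exists C; apply: (intle_ext0_ae oO _ _ _ gC).
- by apply: aeS (wpartial_ae oO hg) => x hx Ox; rewrite hx.
- by apply: measO_sqrw => //; exact: wpartial_measO hg.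
- by move=> x; rewrite mulr_ge0// sqr_ge0.
Qed.

Lemma test_measO f : test_fun Omega f -> measO Omega f.
Proof. by move=> tf; apply: pmeas_measO => //; apply: pmeas_smooth; exact: test_smooth tf. Qed.

Lemma weighted_approx_bound w f g C C' : pmeas w -> (forall x, 0 <= w x) -> measO Omega f -> measO Omega g ->
  intle (ext (fun x => f x ^+ 2 * w x)) C ->
  intle (ext (fun x => (f x - g x) ^+ 2 * w x)) C' ->
  intle (ext (fun x => g x ^+ 2 * w x)) (2 * C + 2 * C').
Proof.
move=> mw w0 mf mg h h'.
have mfg : measO Omega (fun x => f x - g x) by exact: measurable_funB.
have := weighted_sqrB oO mw w0 mf mfg h h'.
by apply: intle_ext => x; congr (ext _ x); apply/funext => y; rewrite subKr.
Qed.

(** Test fields converging to z at the rate 2^-n are bounded in H^1 uniformly in n; [sobolev_pow]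
    bounds their powers by one constant, and Fatou's lemma passes to z. *)
Lemma field_pow z (k : nat) : H01v Omega irh z ->
  exists C, forall i, intle (ext (fun x => (vcomp z i x ^+ k.+1) ^+ 2)) C.
Proof.
move=> Hz.
have mw := measurable_irho Omega D alpha.
have w0 := irho_ge0 Omega D alpha.
have [Cw iw] := intle_irho.
have [c c0 unw] := unweight.
have /choice[phi hphi] : forall n, exists phi, [/\ test_field Omega phi,
  forall i, intle (ext (fun x => (vcomp z i x - vcomp phi i x) ^+ 2 * irh x)) (2^-1 ^+ n) &
  forall i j, intle (ext (fun x => (wpartial Omega j (vcomp z i) x - 'D_(dir j) (vcomp phi i) x) ^+ 2 * irh x)) (2^-1 ^+ n)].
  by move=> n; apply: (H01v_approx oO mw w0 iw Hz); rewrite exprn_gt0.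
have le1 n : 2^-1 ^+ n <= 1 :> R by rewrite exprn_ile1// invf_le1// ler1n.
have [A hA] : exists A, (forall n i, intle (fun x => vcomp (phi n) i x ^+ 2) A) /\
    (forall n i j, intle (fun x => ('D_(dir j) (vcomp (phi n) i) x) ^+ 2) A).
  have /choice[A1 hA1] : forall i, exists C, intle (ext (fun x => vcomp z i x ^+ 2 * irh x)) C.
    by move=> i; exact: H01v_L2.
  have /choice[A2 hA2] : forall ij : 'I_2 * 'I_2, exists C,
      intle (ext (fun x => wpartial Omega ij.2 (vcomp z ij.1) x ^+ 2 * irh x)) C.
    by move=> ij; exact: H01v_grad_L2.
  pose A := c * (2 * (\sum_i A1 i + \sum_i A2 i) + 2 * 1).
  have A10 i : 0 <= A1 i by exact: intle_ge0 (hA1 i).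
  have A20 i : 0 <= A2 i by exact: intle_ge0 (hA2 i).
  exists A; split=> n i => [|j].
    have [t1 h1 h2] := hphi n.
    have tp := t1 i.
    have mp := test_measO tp.
    have := unw _ _ mp (weighted_approx_bound mw w0 (H01v_measO i Hz) mp (hA1 i) (h1 i)).
    move=> h; apply: intle_ext; last apply: intle_weak h.
      by move=> x; rewrite (ext0M Omega (vcomp (phi n) i) (vcomp (phi n) i)) !(ext0_test x tp).
    rewrite /A ler_pM2l// lerD ?ler_pM2l ?le1// (bigD1 i)//= -addrA lerDl addr_ge0//; exact: sumr_ge0.
  have [t1 h1 h2] := hphi n.
  have tp := test_D j (t1 i).
  have mp := test_measO tp.
  have := unw _ _ mp (weighted_approx_bound mw w0 (wpartial_measO (H01v_wpartial i j Hz)) mp (hA2 (i, j)) (h2 i j)).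
  move=> h; apply: intle_ext; last apply: intle_weak h.
    by move=> x; rewrite (ext0M Omega ('D_(dir j) (vcomp (phi n) i)) ('D_(dir j) (vcomp (phi n) i))) !(ext0_test x tp).
  rewrite /A ler_pM2l// lerD ?ler_pM2l ?le1// addrC (bigD1 (i, j))//= -addrA lerDl addr_ge0//; exact: sumr_ge0.
have [C hC] := sobolev_pow A k L0.
exists C => i.
have E (t : R) : `|t| `^ (2 * k.+1)%:R = (t ^+ k.+1) ^+ 2.
  by rewrite powR_mulrn// exprM real_normK ?num_real// -!exprM mulnC.
apply: (@intle_ext _ (ext (fun x => `|vcomp z i x| `^ (2 * k.+1)%:R))).
  by move=> x; congr (ext _ x); apply/funext => y; rewrite E.
apply: (intle_powR_limit oO irho_gt0_ae (phi := fun n => vcomp (phi n) i)).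
- by rewrite ltr0n.
- exact: H01v_measO Hz.
- by move=> n; have [_ h _] := hphi n; exact: h.
move=> n; have [t1 _ _] := hphi n; have [A1 A2] := hA.
apply: intle_ext (hC _ (test_smooth (t1 i)) (test_supp_box (t1 i)) (A1 n i) (A2 n i)).
by move=> x; rewrite E.
Qed.

(** The condition on alpha makes the inverse weight integrable to the power p/(2-p), so
    [powR_weight_le] bounds the gradients of the approximating fields in L^p, and [sobolev_powR] the
    fields themselves in L^(2p). *)
Lemma field_powR y (p : R) : H01v Omega rh y -> 1 < p -> p < 2 -> alpha * (p / (2 - p)) < 2 ->
  exists C, forall i, intle (ext (fun x => `|vcomp y i x| `^ (p * 2))) C.
Proof.
move=> Hy p1 p2 ap.
have mw := measurable_rho Omega D alpha.
have w0 := rho_ge0 Omega D alpha.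
have [Cw iw] := intle_rho.
have s0 : 0 < p / (2 - p) by rewrite divr_gt0//; lra.
have [Cs is_] := @intle_irho_powR R Omega l D alpha a0 L L0 OL oO _ s0 ap.
have /choice[phi hphi] : forall n, exists phi, [/\ test_field Omega phi,
  forall i, intle (ext (fun x => (vcomp y i x - vcomp phi i x) ^+ 2 * rh x)) (2^-1 ^+ n) &
  forall i j, intle (ext (fun x => (wpartial Omega j (vcomp y i) x - 'D_(dir j) (vcomp phi i) x) ^+ 2 * rh x)) (2^-1 ^+ n)].
  by move=> n; apply: (H01v_approx oO mw w0 iw Hy); rewrite exprn_gt0.
have le1 n : 2^-1 ^+ n <= 1 :> R by rewrite exprn_ile1// invf_le1// ler1n.
have /choice[A2 hA2] : forall ij : 'I_2 * 'I_2, exists C,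
    intle (ext (fun x => wpartial Omega ij.2 (vcomp y ij.1) x ^+ 2 * rh x)) C.
  by move=> ij; exact: H01v_grad_L2.
have A20 i : 0 <= A2 i by exact: intle_ge0 (hA2 i).
pose A := (2 * (\sum_i A2 i) + 2 * 1) + Cs.
have hA n i j : intle (fun x => `|'D_(dir j) (vcomp (phi n) i) x| `^ p) A.
  have [t1 h1 h2] := hphi n.
  have tp := test_D j (t1 i).
  have mp := test_measO tp.
  have h := intleD (weighted_approx_bound mw w0 (wpartial_measO (H01v_wpartial i j Hy)) mp (hA2 (i, j)) (h2 i j)) is_.
  apply: (@intle_weak _ _ (2 * A2 (i, j) + 2 * 2^-1 ^+ n + Cs)).
    by rewrite /A lerD2r lerD ?ler_pM2l ?le1// (bigD1 (i, j))//= lerDl sumr_ge0.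
  apply: (intle_mono_ae h).
  - by apply: pmeas_norm_powR; apply: pmeas_smooth; exact: test_smooth tp.
  - by move=> x; exact: powR_ge0.
  apply: aeS (rho_gt0_ae Omega D alpha) => x x0.
  have [Ox|Ox] := pselect (Omega x); last first.
    by rewrite !ext0_out// (test_out tp)// normr0 powR0 ?addr0// gt_eqF//; lra.
  rewrite !ext0_in//.
  have := powR_weight_le (normr_ge0 ('D_(dir j) (vcomp (phi n) i) x)) (ltW p1) p2 x0.
  by rewrite real_normK// num_real.
have E (t : R) : `|t| `^ (p * 2) = (`|t| `^ p) ^+ 2 by rewrite powRrM powR_mulrn// powR_ge0.
exists ((2 * (4 * L) `^ (p - 1)) ^+ 2 * (A * A)) => i.
apply: (intle_powR_limit oO (rho_gt0_ae Omega D alpha) (phi := fun n => vcomp (phi n) i)).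
- by rewrite mulr_gt0//; lra.
- exact: H01v_measO Hy.
- by move=> n; have [_ h _] := hphi n; exact: h.
move=> n; have [t1 _ _] := hphi n.
apply: intle_ext (sobolev_powR (test_smooth (t1 i)) L0 (test_supp_box (t1 i)) (ltW p1) (hA n i _) (hA n i _)).
by move=> x; rewrite E.
Qed.

End Fields.

(** * Cones at the boundary *)

Section Geometry.
Context {R : realType}.
Local Notation mu := (@lebesgue_measure R).

(* A shift by such a [u] sends the complement of [Omega] near [x0] to the complement of
   [Omega], so translating a test function by [u] keeps its support near [x0] inside [Omega]. *)
Definition outward (Omega : set (plane R)) (x0 : plane R) (b : R) (e : plane R) (d : R) :=
  forall x u r, `|x.1 - x0.1| <= b -> `|x.2 - x0.2| <= b -> 0 < r <= b ->
    `|u.1 - r * e.1| <= r * d -> `|u.2 - r * e.2| <= r * d -> ~ Omega x -> ~ Omega (x + u).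

(** Holds vacuously: no point close to x0 lies outside Omega. *)
Lemma outward_interior (Omega : set (plane R)) x0 : open Omega -> Omega x0 ->
  exists2 b, 0 < b & outward Omega x0 b (0, 0) 1.
Proof.
move=> oO Ox0; have /nbhs_ballP[b /= b0 hb] := open_nbhs_nbhs (conj oO Ox0).
exists (b / 2); first by rewrite divr_gt0.
move=> x u r h1 h2 _ _ _ []; apply: hb; split; rewrite /= /ball/= distrC.
- by apply: le_lt_trans h1 _; lra.
- by apply: le_lt_trans h2 _; lra.
Qed.

(* Moving down the graph, in the direction opposite to the second coordinate axis. *)
Lemma outward_boundary (Omega : set (plane R)) x0 : lipschitz_boundary Omega -> bdry Omega x0 ->
  exists b e d, [/\ 0 < b, 0 < d <= 1, `|e.1| <= 1 /\ `|e.2| <= 1 & outward Omega x0 b e d].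
Proof.
move=> lO /lO[c [s [r0 [h0 [gamma [cs r00 h00 lg Og]]]]]].
have [k k0 kg] : exists2 k, 0 <= k & forall a a', `|gamma a - gamma a'| <= k * `|a - a'|.
  have [M [_ hM]] := lg; exists (`|M| + 1); first by rewrite addr_ge0.
  by move=> a a'; apply: (hM (`|M| + 1) _ (a, a')) => //; rewrite (le_lt_trans (ler_norm _))// ltrDl.
have c1 : `|c| <= 1 by rewrite ler_norml; have := sqr_ge0 s; have := cs; nra.
have s1 : `|s| <= 1 by rewrite ler_norml; have := sqr_ge0 c; have := cs; nra.
(* In the rotated frame the error v of the displacement has coordinates at most 2 r d. It raises the
   point by that much and changes the graph by at most k times as much: 2 r d (1 + k) = r / 2 in
   all, less than the descent r. *)
pose d := (4 * (1 + k))^-1.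
have d0 : 0 < d by rewrite invr_gt0; lra.
have dk : 4 * d * (1 + k) = 1 by rewrite /d; field; lra.
have d1 : d <= 1 by nra.
(* Small enough for x and x + u both to stay in the rectangle where Omega is described by the
   graph. *)
pose b := Num.min r0 h0 / 16.
have m0 : 0 < Num.min r0 h0 by rewrite lt_min r00.
have b0 : 0 < b by rewrite divr_gt0.
have br : 16 * b <= r0 by rewrite /b mulrC divfK// ge_min lexx.
have bh : 16 * b <= h0 by rewrite /b mulrC divfK// ge_min lexx orbT.
exists b, (s, - c), d; split; rewrite ?d0 ?normrN//.
move=> x u r x1 x2 /andP[r0' rb] /= u1 u2 nOx Oxu; apply: nOx.
have nM (t1 t2 y B : R) : `|t1| <= 1 -> `|y| <= B -> `|t1 * y| <= B.
  by move=> ht hy; rewrite normrM (le_trans _ hy)// ler_piMl.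
pose A (y : plane R) := (y.1 * c + y.2 * s).
pose B (y : plane R) := (y.2 * c - y.1 * s).
have AB y : y = (x0.1 + A (y - x0) * c - B (y - x0) * s, x0.2 + A (y - x0) * s + B (y - x0) * c).
  rewrite /A /B; case: y => y1 y2 /=; congr pair.
    rewrite (_ : _ - _ = x0.1 + (y1 - x0.1) * (c ^+ 2 + s ^+ 2)); last by ring.
    by rewrite cs mulr1 addrC subrK.
  rewrite (_ : _ + _ = x0.2 + (y2 - x0.2) * (c ^+ 2 + s ^+ 2)); last by ring.
  by rewrite cs mulr1 addrC subrK.
have bndA y t : `|y.1| <= t -> `|y.2| <= t -> `|A y| <= 2 * t.
  move=> h1 h2; rewrite /A (le_trans (ler_normD _ _))// mulr_natl mulr2n.
  by apply: lerD; rewrite mulrC; apply: nM.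
have bndB y t : `|y.1| <= t -> `|y.2| <= t -> `|B y| <= 2 * t.
  move=> h1 h2; rewrite /B (le_trans (ler_normB _ _))// mulr_natl mulr2n.
  by apply: lerD; rewrite mulrC; apply: nM.
have rd : r * d <= b by nra.
pose v : plane R := (u.1 - r * s, u.2 - r * - c).
have Av : `|A v| <= 2 * (r * d) by exact: bndA.
have Bv : `|B v| <= 2 * (r * d) by exact: bndB.
have Au : A (x + u - x0) = A (x - x0) + A v by rewrite /A /v /=; ring.
have Bu : B (x + u - x0) = B (x - x0) - r + B v.
  transitivity (B (x - x0) - r * (c ^+ 2 + s ^+ 2) + B v); last by rewrite cs mulr1.
  by rewrite /B /v /=; ring.
have Ax : `|A (x - x0)| <= 2 * b by exact: bndA.
have Bx : `|B (x - x0)| <= 2 * b by exact: bndB.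
rewrite (AB (x + u)) in Oxu; rewrite (AB x).
have h1 : `|A (x + u - x0)| < r0.
  by rewrite Au (le_lt_trans (ler_normD _ _))//; lra.
have h2 : `|B (x + u - x0)| < h0.
  rewrite Bu (le_lt_trans (ler_normD _ _))// (le_lt_trans (lerD (ler_normB _ _) (lexx _)))//.
  by rewrite (ger0_norm (ltW r0')); lra.
have {}Oxu := (Og _ _ h1 h2).1 Oxu.
apply/(Og _ _ _ _).2; [by lra|by lra|].
have := kg (A (x - x0)) (A (x + u - x0)); rewrite {2}Au opprD addNKr normrN => kA.
have {}kA : gamma (A (x - x0)) <= gamma (A (x + u - x0)) + k * (2 * (r * d)).
  move: kA; rewrite ler_norml => /andP[_]; rewrite lerBlDl => kA.
  by apply: le_trans kA _; rewrite lerD2l ler_wpM2l.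
apply: le_lt_trans kA _; rewrite Bu in Oxu.
have hB : B v <= 2 * (r * d) by apply: le_trans Bv; exact: ler_norm.
have : r * (4 * d * (1 + k)) = r by rewrite dk mulr1.
nra.
Qed.

Lemma outward_closure (Omega : set (plane R)) x0 : open Omega -> lipschitz_boundary Omega ->
  closure Omega x0 ->
  exists b e d, [/\ 0 < b, 0 < d <= 1, `|e.1| <= 1 /\ `|e.2| <= 1 & outward Omega x0 b e d].
Proof.
move=> oO lO cx0; have [Ox|nOx] := pselect (Omega x0).
  have [b b0 h] := outward_interior oO Ox.
  by exists b, (0, 0), 1; split => //=; rewrite ?ltr01 ?lexx ?normr0.
by apply: outward_boundary => //; split=> // /interior_subset.
Qed.

(** A smooth bump with values in [0, 1], zero outside the square of half-side b. It is not constant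
    near x0; positivity at x0 is what the covering argument relies on. *)
Definition cutoff (x0 : plane R) (b : R) : plane R -> R :=
  quad_test (x0.1 - b) (x0.2 - b) (x0.1 - b) (x0.1 + b) (x0.2 - b) (x0.2 + b) 0.

Lemma smooth_cutoff x0 b : smooth (cutoff x0 b). Proof. exact: smooth_quad_test. Qed.

Lemma cutoff_bound x0 b x : 0 <= cutoff x0 b x <= 1. Proof. exact: quad_test_bound. Qed.

Lemma cutoff_out x0 b x : ~ (`|x.1 - x0.1| < b /\ `|x.2 - x0.2| < b) -> cutoff x0 b x = 0.
Proof.
move=> h; apply: quad_test_out => -[/=]; rewrite !in_itv/= => /andP[h1 h2] /andP[h3 h4].
by apply: h; rewrite !ltr_norml; split; apply/andP; split; lra.
Qed.

Lemma cutoff_gt0 x0 b : 0 < b -> 0 < cutoff x0 b x0.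
Proof.
move=> b0.
have h t : 0 < t -> 0 < step 0 t by move=> t0; rewrite /step /flat mul1r t0 expr0 invr1 mul1r expR_gt0.
by rewrite /cutoff /quad_test; repeat apply: mulr_gt0; apply: h; lra.
Qed.

Lemma test_cutoff x0 b : test_fun setT (cutoff x0 b).
Proof. exact: test_quad. Qed.

Lemma lipschitz_dir f j (M : R) x (t : R) : smooth f -> (forall x, `|'D_(dir j) f x| <= M) ->
  `|f (x + t *: dir j) - f x| <= M * `|t|.
Proof.
move=> sf fM.
have pos s y : 0 < s -> `|f (y + s *: dir j) - f y| <= M * s.
  move=> s0; rewrite -lee_fin; apply: le_trans (line_abs j sf y s0) _.
  apply: (@le_trans _ _ (\int[mu]_(t in `[0%R, s]) M%:E)%E).
    apply: ge0_le_integral => //.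
    - apply/measurable_EFinP; apply: measurable_funTS; apply: measurableT_comp => //.
      apply: (@continuous_measurable_fun R); apply: (@continuous_line R ('D_(dir j) f)).
      by apply: smooth_continuous; exact: smooth_D.
    - by move=> u _; rewrite lee_fin.
  have -> : (\int[mu]_(_ in `[0%R, s]) M%:E = M%:E * mu `[0%R, s])%E by rewrite -integral_cst.
  by rewrite lebesgue_measure_itv/= lte_fin s0 -EFinD subr0.
have [t0|t0|->] := ltgtP t 0.
- have := pos (- t) (x + t *: dir j); rewrite oppr_gt0 => /(_ t0).
  have -> : x + t *: dir j + - t *: dir j = x by rewrite -addrA -scalerDl subrr scale0r addr0.
  by rewrite distrC (ltr0_norm t0).
- by rewrite (gtr0_norm t0); exact: pos.
- by rewrite scale0r addr0 subrr !normr0 mulr0.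
Qed.

Lemma lipschitz_plane f (M r : R) x (u : plane R) : smooth f ->
  (forall j x, `|'D_(dir j) f x| <= M) -> `|u.1| <= r -> `|u.2| <= r ->
  `|f (x + u) - f x| <= 2 * M * r.
Proof.
move=> sf fM u1 u2; have M0 : 0 <= M by rewrite (le_trans _ (fM ord0 x)).
rewrite {1}(plane_dir u) addrA.
set y := x + u.1 *: dir ord0.
have h1 := lipschitz_dir x u.1 sf (fM ord0).
have h2 := lipschitz_dir y u.2 sf (fM ord_max).
rewrite -(subrK (f y) (f (y + _))) -addrA (le_trans (ler_normD _ _))//.
have : M * `|u.1| <= M * r by rewrite ler_wpM2l.
have : M * `|u.2| <= M * r by rewrite ler_wpM2l.
rewrite -/y in h1; lra.
Qed.

(** If x is near x0 and x + h is in the support of phi, then x is in Omega, for otherwise x + h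
    would be outside Omega too. So the support of the product is a compact subset of Omega. *)
Lemma test_translate (Omega : set (plane R)) x0 b e d f phi (r : R) (h : plane R) :
  outward Omega x0 b e d -> smooth f ->
  (forall x, ~ (`|x.1 - x0.1| < b /\ `|x.2 - x0.2| < b) -> f x = 0) ->
  0 < r <= b -> `|h.1 - r * e.1| <= r * d -> `|h.2 - r * e.2| <= r * d ->
  test_fun Omega phi -> test_fun Omega (fun x => f x * (phi (x + h) - phi x)).
Proof.
move=> out sf f0 rb h1 h2 [sp [K [cK KO phi0]]].
split; first by apply: smoothM => //; apply: smoothB => //; exact: smooth_shift.
pose B := cquad (x0.1 - b) (x0.1 + b) (x0.2 - b) (x0.2 + b).
have BP x : B x <-> `|x.1 - x0.1| <= b /\ `|x.2 - x0.2| <= b.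
  rewrite /B /cquad /= !in_itv/= !ler_norml.
  by split => -[/andP[? ?] /andP[? ?]]; split; apply/andP; split; lra.
pose K' := (fun x => x + h) @^-1` K.
exists (B `&` (K `|` K')); split.
- apply: compact_closedI; first exact: compact_cquad.
  apply: closedU; first exact: compact_closed_plane.
  apply: closed_comp; last exact: compact_closed_plane.
  by move=> x _; apply: cvgD; [exact: cvg_id|exact: cvg_cst].
- move=> x [/BP[b1 b2]] [/KO//|K'x]; apply: contrapT => nOx.
  exact: (out x h r b1 b2 rb h1 h2 nOx (KO _ K'x)).
move=> x nx; have [Bx|nBx] := pselect (B x); last first.
  by rewrite f0 ?mul0r// => -[/ltW ? /ltW ?]; apply: nBx; apply/BP.
rewrite !phi0 ?subrr ?mulr0// => Kx; apply: nx; split => //; [by left|by right].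
Qed.

End Geometry.

(** * The translation estimate *)

Section Small.
Context {R : realType}.
Implicit Types f g : plane R -> R.

(** The signed counterpart of [intle]. It bounds the integral itself, so that cancellations coming
    from a change of variables or from the weak equation are not lost; [small_eq] exploits them. *)
Definition small f (B : R) :=
  (leb2 R).-integrable setT (EFin \o f) /\ `|\int[leb2 R]_x f x| <= B.

Lemma small_ext f g B : (forall x, f x = g x) -> small f B -> small g B.
Proof. by move=> /funext ->. Qed.

Lemma small_weak f B B' : B <= B' -> small f B -> small f B'.
Proof. by move=> BB [i h]; split => //; exact: le_trans BB. Qed.

Lemma small_dom f g B : pmeas f -> {ae leb2 R, forall x, `|f x| <= g x} -> intle g B -> small f B.
Proof.
move=> mf fg gB.
have h : intle (fun x => `|f x|) B.
  by apply: intle_mono_ae gB _ _ fg => //; exact: measurableT_comp.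
exact: intle_integrable h.
Qed.

Lemma small_abs f B : pmeas f -> intle (fun x => `|f x|) B -> small f B.
Proof. by move=> mf; apply: intle_integrable. Qed.

Lemma smallD f g B C : small f B -> small g C -> small (fun x => f x + g x) (B + C).
Proof.
move=> [fi fB] [gi gC]; split.
  by have := integrableD measurableT fi gi; apply: eq_integrable.
rewrite (RintegralD measurableT fi gi) (le_trans (ler_normD _ _))//; exact: lerD.
Qed.

Lemma smallZ k f B : small f B -> small (fun x => k * f x) (`|k| * B).
Proof.
move=> [fi fB]; split.
  by have := integrableZl measurableT k fi; apply: eq_integrable.
by rewrite RintegralZl// normrM ler_wpM2l.
Qed.

Lemma smallB f g B C : small f B -> small g C -> small (fun x => f x - g x) (B + C).
Proof.
move=> hf hg; have := smallD hf (smallZ (-1) hg); rewrite normrN1 mul1r.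
by apply: small_ext => x; rewrite mulN1r.
Qed.

Lemma small_sum2 (f : 'I_2 -> plane R -> R) B : (forall i, small (f i) B) ->
  small (fun x => \sum_i f i x) (2 * B).
Proof.
move=> h; have := smallD (h ord0) (h (lift ord0 ord0)); rewrite -mulr2n -[_ *+ 2]mulr_natl.
by apply: small_ext => x; rewrite big_ord_recl big_ord_recl big_ord0 addr0.
Qed.

Lemma small_intle f B : small f B -> (forall x, 0 <= f x) -> intle f B.
Proof.
move=> [fi fB] f0; have /integrableP[mf ff] := fi.
split => //; first by apply/measurable_EFinP.
have fin : pint f \is a fin_num.
  by have := integrable_fin_num measurableT fi.
rewrite -(fineK fin) lee_fin; apply: le_trans fB; exact: ler_norm.
Qed.

Lemma small_eq f g B B' : small f B -> small g B' -> \int[leb2 R]_x f x = \int[leb2 R]_x g x ->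
  small f B'.
Proof. by move=> [fi _] [gi gB] fg; split => //; rewrite fg. Qed.

Lemma pmeasM f g : pmeas f -> pmeas g -> pmeas (fun x => f x * g x).
Proof. exact: measurable_funM. Qed.

Lemma pmeasD f g : pmeas f -> pmeas g -> pmeas (fun x => f x + g x).
Proof. exact: measurable_funD. Qed.

Lemma pmeasB f g : pmeas f -> pmeas g -> pmeas (fun x => f x - g x).
Proof. exact: measurable_funB. Qed.

Lemma pmeasX f n : pmeas f -> pmeas (fun x => f x ^+ n).
Proof. exact: measurable_funX. Qed.

Lemma pmeas_norm f : pmeas f -> pmeas (fun x => `|f x|).
Proof. by move=> mf; exact: measurableT_comp. Qed.

Lemma pmeas_sum (J : Type) (s : seq J) (f : J -> plane R -> R) :
  (forall j, pmeas (f j)) -> pmeas (fun x => \sum_(j <- s) f j x).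
Proof. by move=> mf; apply: measurable_sum. Qed.

End Small.

Section Constants.
Context {R : realType}.
Implicit Types (A nu : R) (m k : nat).

(** The first term is the L^2 bound of [translate] for increments of size 2 r, the second comes from
    splitting the power 2k+1 of an increment between its two ends. *)
Definition powK A k := 64 * A + 2 * 4 ^+ k.*2.+1 * A.
(** Three squares are summed: the increment of the divergence contributes 3 times 4 A, and the
    derivatives of the cutoff twice 3 A^2 times 64 A. *)
Definition pressK A := 12 * A + 384 * A ^+ 3.
(** The sum of the bounds on the source, the two convective terms and the pressure, with a factor 2
    for each summation over an index. *)
Definition adjK A m :=
  2 * (65 * A) + (2 * (2 * (2 * A + powK A m)) + 2 * (2 * (3 * A + powK A (2 * m).+1)) + (A + pressK A)).
Definition gradK nu A m :=
  3 * (2 + (16 * A ^+ 2 + 2 * (`|nu^-1| * adjK A m) + 8 * (A + 64 * A ^+ 3) + 8 * (1 + 4 * A))).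

End Constants.

(* [Z], [G], [Y], [DY], [P] and [F] stand for the extensions by zero of z, its gradient, y,
   its gradient, the pressure and y - yO, and [phi] for a test field close to z.  The increment
   over [h] has size [r], a power of [th] large enough to absorb the negative powers of [th]
   created by Young's inequality in the convective terms. *)
Section TranslationEstimate.
Context {R : realType}.
Variables (nu A : R) (m : nat).
Hypotheses (nu0 : 0 < nu) (A1 : 1 <= A) (m0 : (0 < m)%N).
Variable chi : plane R -> R.
Hypotheses (schi : smooth chi) (chi01 : forall x, 0 <= chi x <= 1).
Hypothesis Dchi : forall j x, `|'D_(dir j) chi x| <= A.
Variables (Z Y F : 'I_2 -> plane R -> R) (G DY : 'I_2 -> 'I_2 -> plane R -> R) (P rh irh : plane R -> R).
Hypotheses (mZ : forall i, pmeas (Z i)) (mY : forall i, pmeas (Y i)) (mF : forall i, pmeas (F i))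
  (mG : forall i j, pmeas (G i j)) (mDY : forall i j, pmeas (DY i j)) (mP : pmeas P).
Hypotheses (iF : forall i, intle (fun x => F i x ^+ 2) A) (iP : intle (fun x => P x ^+ 2) A)
  (iG : forall i j, intle (fun x => G i j x ^+ 2) A)
  (iZ : forall i, intle (fun x => (Z i x ^+ (2 * m.+1)) ^+ 2) A)
  (iY : forall i, intle (fun x => (`|Y i x| `^ (2 / m%:R)) ^+ m.+1) A)
  (iDY : forall i j, intle (fun x => DY i j x ^+ 2 * rh x) A)
  (irh0 : forall x, 0 <= irh x)
  (iI : intle (fun x => (irh x `^ (m%:R^-1)) ^+ m.+1) A)
  (rhirh : forall i j, {ae leb2 R, forall x, DY i j x != 0 -> 0 < rh x /\ irh x = (rh x)^-1}).

Variables (th r : R) (h : plane R) (phi : 'I_2 -> plane R -> R).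
Hypotheses (th0 : 0 < th) (th1 : th <= 1) (rth : r = th ^+ (4 * m.+1)).
Hypotheses (h1 : `|h.1| <= 2 * r) (h2 : `|h.2| <= 2 * r).
Hypotheses (sphi : forall i, smooth (phi i))
  (iD : forall i j, intle (fun x => 'D_(dir j) (phi i) x ^+ 2) A)
  (iDG : forall i j, intle (fun x => ('D_(dir j) (phi i) x - G i j x) ^+ 2) (r ^+ 2))
  (iphi : forall i, intle (fun x => (phi i x ^+ m.*2.+1) ^+ 2) A)
  (iphi2 : forall i, intle (fun x => (phi i x ^+ ((2 * m).+1).*2.+1) ^+ 2) A)
  (idiv : intle (fun x => (\sum_i 'D_(dir i) (phi i) x) ^+ 2) (A * r ^+ 2)).

Local Notation dl f x := (f (x + h) - f x).
Local Notation a i j := ('D_(dir j) (phi i)).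

Let w i x := chi x * dl (phi i) x.
Let dw i j x := 'D_(dir j) chi x * dl (phi i) x + chi x * dl (a i j) x.

Let A0 : 0 <= A. Proof. exact: le_trans A1. Qed.
Let r0 : 0 < r. Proof. by rewrite rth exprn_gt0. Qed.
Let rle : r <= th.
Proof.
rewrite rth mulnS exprD -[X in _ <= X]mulr1 (_ : 4 = 1 + 3)%N// exprD expr1 -mulrA ler_pM2l//.
by rewrite mulr_ile1 ?exprn_ge0 ?exprn_ile1 ?(ltW th0).
Qed.

Let mphi i : pmeas (phi i). Proof. exact: pmeas_smooth. Qed.
Let ma i j : pmeas (a i j). Proof. by apply: pmeas_smooth; exact: smooth_D. Qed.
Let mchi : pmeas chi. Proof. exact: pmeas_smooth. Qed.
Let mdphi i : pmeas (fun x => dl (phi i) x).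
Proof. exact: pmeasB (pmeas_shift h (mphi i)) (mphi i). Qed.
Let mda i j : pmeas (fun x => dl (a i j) x).
Proof. exact: pmeasB (pmeas_shift h (ma i j)) (ma i j). Qed.
Let mw i : pmeas (w i). Proof. exact: pmeasM. Qed.
Let mDchi j : pmeas ('D_(dir j) chi). Proof. by apply: pmeas_smooth; exact: smooth_D. Qed.
Let mdw i j : pmeas (dw i j).
Proof. by apply: pmeasD; apply: pmeasM. Qed.

Let chisq x : chi x ^+ 2 <= 1.
Proof. by have /andP[c0 c1] := chi01 x; rewrite exprn_ile1. Qed.

Let idphi i : intle (fun x => dl (phi i) x ^+ 2) (64 * A * r ^+ 2).
Proof. by apply: intle_weak (translate (sphi i) h1 h2 (iD i)); rewrite le_eqVlt; apply/orP; left; apply/eqP; ring. Qed.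

Let idl f C : pmeas f -> intle (fun x => f x ^+ 2) C -> intle (fun x => dl f x ^+ 2) (4 * C).
Proof.
move=> mf fC; apply: intle_mono (_ : intle (fun x => 2 * f (x + h) ^+ 2 + 2 * f x ^+ 2) _).
- by apply: pmeasX; exact: pmeasB (pmeas_shift h mf) mf.
- move=> x; rewrite sqr_ge0/=; have := sqrD_le (f (x + h)) (- f x); by rewrite sqrrN.
have := intleD (intleZ (ler0n _ 2) (intle_shift h fC)) (intleZ (ler0n _ 2) fC).
by apply: intle_weak; lra.
Qed.

Let pow_sub (s t : R) n : ((s - t) ^+ n) ^+ 2 <= 4 ^+ n * (s ^+ n) ^+ 2 + 4 ^+ n * (t ^+ n) ^+ 2.
Proof.
have H (u : R) : (u ^+ n) ^+ 2 = (u ^+ 2) ^+ n by rewrite -!exprM mulnC.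
rewrite !H -!exprMn.
have s2 := sqr_ge0 s; have t2 := sqr_ge0 t.
have S := sqrD_le s (- t); rewrite sqrrN in S.
have [st|/ltW st] := leP (s ^+ 2) (t ^+ 2).
- apply: (@le_trans _ _ ((4 * t ^+ 2) ^+ n)); last by rewrite lerDr exprn_ge0// mulr_ge0.
  by apply: lerXn2r; rewrite ?nnegrE; [exact: sqr_ge0|by rewrite mulr_ge0|apply: le_trans S _; lra].
- apply: (@le_trans _ _ ((4 * s ^+ 2) ^+ n)); last by rewrite lerDl exprn_ge0// mulr_ge0.
  by apply: lerXn2r; rewrite ?nnegrE; [exact: sqr_ge0|by rewrite mulr_ge0|apply: le_trans S _; lra].
Qed.

Let K := powK A.
Let K0 k : 0 <= K k.
Proof. by rewrite /K /powK addr_ge0// ?mulr_ge0 ?exprn_ge0. Qed.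

(** Interpolation: with u the increment, u^(2(k+1)) = u u^(2k+1), where u is O(r) in L^2 and the
    other factor is bounded in L^2. The parameter 1/r in [amgm] balances the two. *)
Let iw i k : intle (fun x => (phi i x ^+ k.*2.+1) ^+ 2) A ->
  intle (fun x => (w i x ^+ k.+1) ^+ 2) (r * K k).
Proof.
move=> ik.
have ip : intle (fun x => (dl (phi i) x ^+ k.*2.+1) ^+ 2) (2 * 4 ^+ k.*2.+1 * A).
  have c0 : 0 <= 4 ^+ k.*2.+1 :> R by rewrite exprn_ge0.
  apply: intle_mono (_ : intle (fun x => 4 ^+ k.*2.+1 * (phi i (x + h) ^+ k.*2.+1) ^+ 2
     + 4 ^+ k.*2.+1 * (phi i x ^+ k.*2.+1) ^+ 2) _).
  - by do 2 apply: pmeasX.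
  - by move=> x; rewrite sqr_ge0/= pow_sub.
  have := intleD (intleZ c0 (intle_shift h ik)) (intleZ c0 ik).
  by apply: intle_weak; lra.
have rV : 0 < r^-1 by rewrite invr_gt0.
have := intleD (intleZ (ltW rV) (idphi i)) (intleZ (ltW r0) ip).
move=> H; have {}H : intle (fun x => r^-1 * dl (phi i) x ^+ 2 + r * (dl (phi i) x ^+ k.*2.+1) ^+ 2) (r * K k).
  apply: intle_weak H; rewrite /K /powK le_eqVlt; apply/orP; left; apply/eqP; field; exact: lt0r_neq0.
apply: intle_mono H; first by do 2 apply: pmeasX.
move=> x; rewrite sqr_ge0/=.
have := amgm (dl (phi i) x) (dl (phi i) x ^+ k.*2.+1) rV; rewrite invrK; apply: le_trans.
rewrite -exprS (_ : k.*2.+2 = (k.+1 * 2)%N); last by rewrite muln2 doubleS.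
rewrite ger0_norm; last by rewrite exprM sqr_ge0.
rewrite (exprAC _ _ 2) mulnC exprM lerXn2r// ?nnegrE ?sqr_ge0//.
by rewrite /w exprMn ler_piMl// sqr_ge0.
Qed.

Let TF i : small (fun x => F i x * w i x) (65 * A * th).
Proof.
apply: small_abs; first exact: pmeasM.
have iw2 : intle (fun x => w i x ^+ 2) (64 * A * r ^+ 2).
  apply: intle_mono (idphi i); first exact: pmeasX.
  by move=> x; rewrite sqr_ge0/= /w exprMn ler_piMl// sqr_ge0.
apply: intle_weak (intle_amgm r0 (mF i) (mw i) (iF i) iw2).
have -> : r * A + r^-1 * (64 * A * r ^+ 2) = 65 * A * r by field; exact: lt0r_neq0.
by rewrite ler_wpM2l// mulr_ge0.
Qed.

Let K2 := pressK A.
(** The divergence of the test field is the gradient of chi times the increment, plus chi times the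
    increment of the divergence of phi. The latter is O(r) by [idiv], since z is divergence free. *)
Let TP : small (fun x => P x * \sum_i dw i i x) ((A + K2) * th).
Proof.
have mS : pmeas (fun x => \sum_i dw i i x) by exact: pmeas_sum.
apply: small_abs; first exact: pmeasM.
have mdiv : pmeas (fun x => \sum_i a i i x) by exact: pmeas_sum.
have iS : intle (fun x => (\sum_i dw i i x) ^+ 2) (K2 * r ^+ 2).
  have hd := idl mdiv idiv.
  have A2 : 0 <= 3 * A ^+ 2 by rewrite mulr_ge0// sqr_ge0.
  have := intleD (intleZ (ler0n _ 3) hd) (intleD (intleZ A2 (idphi ord0)) (intleZ A2 (idphi ord_max))).
  move=> H; apply: intle_mono; last apply: intle_weak H; first exact: pmeasX.
    move=> x; rewrite sqr_ge0/= !big_ord_recl !big_ord0 !addr0 /dw.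
    have -> : lift ord0 ord0 = ord_max :> 'I_2 by apply/val_inj.
    set d0 := dl (phi ord0) x; set d1 := dl (phi ord_max) x.
    set c0 := 'D_(dir ord0) chi x; set c1 := 'D_(dir ord_max) chi x.
    have B0 : (c0 * d0) ^+ 2 <= A ^+ 2 * d0 ^+ 2.
      by rewrite exprMn ler_wpM2r ?sqr_ge0// -(real_normK (num_real c0)) lerXn2r ?nnegrE//; exact: Dchi.
    have B1 : (c1 * d1) ^+ 2 <= A ^+ 2 * d1 ^+ 2.
      by rewrite exprMn ler_wpM2r ?sqr_ge0// -(real_normK (num_real c1)) lerXn2r ?nnegrE//; exact: Dchi.
    set b0 := a ord0 ord0 (x + h); set b0' := a ord0 ord0 x.
    set b1 := a ord_max ord_max (x + h); set b1' := a ord_max ord_max x.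
    have B2 : (chi x * (b0 + b1 - (b0' + b1'))) ^+ 2 <= (b0 + b1 - (b0' + b1')) ^+ 2.
      by rewrite exprMn ler_piMl// sqr_ge0.
    set X := c0 * d0 in B0 *; set Y0 := c1 * d1 in B1 *.
    rewrite (_ : _ + _ = X + Y0 + chi x * (b0 + b1 - (b0' + b1'))); last by ring.
    set W := chi x * _ in B2 *.
    have T3 : (X + Y0 + W) ^+ 2 <= 3 * W ^+ 2 + 3 * X ^+ 2 + 3 * Y0 ^+ 2.
      rewrite -subr_ge0.
      have -> : 3 * W ^+ 2 + 3 * X ^+ 2 + 3 * Y0 ^+ 2 - (X + Y0 + W) ^+ 2 =
        (X - Y0) ^+ 2 + (X - W) ^+ 2 + (Y0 - W) ^+ 2 by ring.
      by rewrite !addr_ge0 ?sqr_ge0.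
    by apply: le_trans T3 _; rewrite -!mulrA addrA; lra.
  rewrite /K2 /pressK; rewrite le_eqVlt; apply/orP; left; apply/eqP; ring.
apply: intle_weak (intle_amgm r0 mP mS iP iS).
have -> : r * A + r^-1 * (K2 * r ^+ 2) = (A + K2) * r by field; exact: lt0r_neq0.
rewrite ler_wpM2l//; have A3 : 0 <= A ^+ 3 by exact: exprn_ge0.
exact: (addr_ge0 A0 (addr_ge0 (mulr_ge0 (ler0n _ 12) A0) (mulr_ge0 (ler0n _ 384) A3))).
Qed.

Let thV : 0 < th^-1. Proof. by rewrite invr_gt0. Qed.
Let th2 : 0 < th ^+ 2. Proof. by rewrite exprn_gt0. Qed.

Let q := th ^+ m.
Let th0' : th != 0. Proof. exact: lt0r_neq0. Qed.
Let q0 : q != 0. Proof. exact: expf_neq0. Qed.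
Let thq : (th ^+ 2) ^+ m = q ^+ 2. Proof. by rewrite exprAC. Qed.
Let thS : th ^+ (2 * m.+1) = q ^+ 2 * th ^+ 2.
Proof. by rewrite mulnS exprD mulnC exprM mulrC. Qed.
Let thD : th ^+ (2 * m + 2) = q ^+ 2 * th ^+ 2.
Proof. by rewrite exprD mulnC exprM. Qed.
Let thr : r = q ^+ 4 * th ^+ 4.
Proof. by rewrite rth mulnS exprD mulnC exprM mulrC. Qed.

Let m0R : m%:R != 0 :> R. Proof. by rewrite pnatr_eq0 -lt0n. Qed.

(** First th G^2 + th^-1 (Y w)^2, then Young with Y^2 = c^m, c = |Y|^(2/m) and the parameter th^2.
    The power of the increment receives th^(-1-2m) r, which is less than th. *)
Let T2 i j : small (fun x => Y j x * G i j x * w i x) ((2 * A + K m) * th).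
Proof.
have mmul : pmeas (fun x => Y j x * G i j x * w i x) by do 2 apply: pmeasM => //.
apply: small_abs => //.
have tm0 : 0 < (th ^+ 2) ^- m by rewrite invr_gt0 exprn_gt0.
have H := intleD (intleZ (ltW th0) (iG i j)) (intleZ (ltW thV)
  (intleD (intleZ (ltW th2) (iY j)) (intleZ (ltW tm0) (iw (iphi i))))).
apply: intle_mono; last apply: intle_weak H.
- exact: pmeas_norm.
- move=> x; rewrite normr_ge0/=.
  rewrite (_ : Y j x * G i j x * w i x = G i j x * (Y j x * w i x)); last by ring.
  apply: le_trans (amgm _ _ th0) _; rewrite lerD2l ler_wpM2l ?(ltW thV)//.
  have c0 : 0 <= `|Y j x| `^ (2 / m%:R) by exact: powR_ge0.
  have := young_pow m th2 (sqr_ge0 (w i x)) c0.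
  have -> : (`|Y j x| `^ (2 / m%:R)) ^+ m = Y j x ^+ 2.
    by rewrite -powR_mulrn// -powRrM divfK// sqr_powR.
  by rewrite [(Y j x * w i x) ^+ 2]exprMn (exprAC _ 2 m.+1).
have -> : th * A + th^-1 * (th ^+ 2 * A + (th ^+ 2) ^- m * (r * K m)) =
    (2 * A + th ^+ (2 * m + 2) * K m) * th.
  by rewrite thD thr thq; field; rewrite th0' q0.
by rewrite ler_pM2r// lerD2l ler_piMl// exprn_ile1// ltW.
Qed.

(** This term dictates r. The weight is shared as th rho DY^2 + th^-1 irh (Z w)^2, Young is applied
    with irh = c^m, and (Z w)^(2(m+1)) is split with the parameter th^(2(m+1)). The increment
    receives th^(-1-2m-2(m+1)) r, which is exactly th for r = th^(4(m+1)). *)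
Let T3 i j : small (fun x => Z i x * DY i j x * w j x) ((3 * A + K (2 * m).+1) * th).
Proof.
have mmul : pmeas (fun x => Z i x * DY i j x * w j x) by do 2 apply: pmeasM => //.
have tm0 : 0 < (th ^+ 2) ^- m by rewrite invr_gt0 exprn_gt0.
have t3 : 0 < th ^+ (2 * m.+1) by rewrite exprn_gt0.
have t3V : 0 < th ^- (2 * m.+1) by rewrite invr_gt0.
have H := intleD (intleZ (ltW th0) (iDY i j)) (intleZ (ltW thV)
  (intleD (intleZ (ltW th2) iI) (intleZ (ltW tm0)
    (intleD (intleZ (ltW t3) (iZ i)) (intleZ (ltW t3V) (iw (iphi2 j))))))).
apply: small_dom => //; last apply: intle_weak H.
  apply: aeS (rhirh i j) => x hx.
  rewrite (_ : Z i x * DY i j x * w j x = DY i j x * (Z i x * w j x)); last by ring.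
  have c0 : 0 <= irh x `^ (m%:R^-1) by exact: powR_ge0.
  have cm : (irh x `^ (m%:R^-1)) ^+ m = irh x.
    by rewrite -powR_mulrn// -powRrM mulVf// powRr1.
  have y1 := young_pow m th2 (sqr_ge0 (Z i x * w j x)) c0; rewrite cm in y1.
  have y2 : ((Z i x * w j x) ^+ 2) ^+ m.+1 <=
     th ^+ (2 * m.+1) * (Z i x ^+ (2 * m.+1)) ^+ 2 + th ^- (2 * m.+1) * (w j x ^+ (2 * m).+2) ^+ 2.
    have := amgm (Z i x ^+ (2 * m.+1)) (w j x ^+ (2 * m.+1)) t3.
    rewrite (_ : (2 * m).+2 = 2 * m.+1)%N; last by rewrite mulnS.
    by apply: le_trans; rewrite -exprMn -exprM ler_norm.
  (* This case covers the points outside Omega, where [irh] is extended by zero and is no longer the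
     inverse of [rh]. *)
  have [DY0|DY0] := eqVneq (DY i j x) 0.
    rewrite DY0 mul0r normr0 expr0n mul0r mulr0 add0r mulr_ge0 ?(ltW thV)//.
    apply: le_trans (le_trans y1 _); first by rewrite mulr_ge0// sqr_ge0.
    by rewrite lerD2l ler_wpM2l// ltW.
  have [rp iE] := hx DY0.
  have tr : 0 < th * rh x by rewrite mulr_gt0.
  apply: le_trans (amgm _ _ tr) _.
  rewrite -mulrA [rh x * _]mulrC lerD2l invfM -mulrA ler_pM2l// -iE.
  by apply: le_trans y1 _; rewrite lerD2l ler_wpM2l// ltW.
set K' := K _.
have -> : th * A + th^-1 * (th ^+ 2 * A + (th ^+ 2) ^- m *
    (th ^+ (2 * m.+1) * A + th ^- (2 * m.+1) * (r * K'))) = (3 * A + K') * th.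
  by rewrite thS thr thq; field; rewrite th0' q0.
by [].
Qed.

Hypothesis weak : \int[leb2 R]_x (nu * (\sum_i \sum_j G i j x * dw i j x)
    - \sum_i \sum_j Y j x * G i j x * w i x + \sum_j \sum_i Z i x * DY i j x * w j x
    - P x * \sum_i dw i i x) = \int[leb2 R]_x (\sum_i F i x * w i x).

Let sG : small (fun x => \sum_i \sum_j G i j x * dw i j x) (`|nu^-1| * (adjK A m * th)).
Proof.
have idw i j : intle (fun x => dw i j x ^+ 2) (2 * (A ^+ 2 * (64 * A * r ^+ 2)) + 2 * (4 * A)).
  have H := intleD (intleZ (ler0n R 2) (intleZ (sqr_ge0 A) (idphi i))) (intleZ (ler0n R 2) (idl (ma i j) (iD i j))).
  apply: intle_mono H; first exact: pmeasX.
  move=> x; rewrite sqr_ge0/=; apply: le_trans (sqrD_le _ _) _.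
  apply: lerD; rewrite ler_pM2l// exprMn.
    by rewrite ler_wpM2r ?sqr_ge0// -(real_normK (num_real ('D_(dir j) chi x))) lerXn2r ?nnegrE//; exact: Dchi.
  by rewrite ler_piMl// sqr_ge0.
(* A crude bound that provides integrability; the size of the integral is read off from the
   equation. *)
have [B sB] : exists B, small (fun x => \sum_i \sum_j G i j x * dw i j x) B.
  eexists; apply: small_sum2 => i; apply: small_sum2 => j.
  by apply: small_abs; [exact: pmeasM|exact: (intle_amgm ltr01 (mG i j) (mdw i j) (iG i j) (idw i j))].
have s2 := small_sum2 (fun i => small_sum2 (fun j => T2 i j)).
have s3 := small_sum2 (fun j => small_sum2 (fun i => T3 i j)).
have ss := smallD (smallB s2 s3) TP.
have sF := smallD (small_sum2 TF) ss.
have st := smallB (smallD (smallB (smallZ nu sB) s2) s3) TP.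
have E : \int[leb2 R]_x (nu * (\sum_i \sum_j G i j x * dw i j x)) =
    \int[leb2 R]_x (\sum_i F i x * w i x + (\sum_i \sum_j Y j x * G i j x * w i x
      - \sum_j \sum_i Z i x * DY i j x * w j x + P x * \sum_i dw i i x)).
  have [iF' _] := small_sum2 TF; have [is' _] := ss; have [it' _] := st.
  rewrite (RintegralD measurableT iF' is') -weak -(RintegralD measurableT it' is').
  by apply: eq_Rintegral => x _; ring.
have := smallZ nu^-1 (small_eq (smallZ nu sB) sF E).
move=> H; apply: small_ext; last apply: small_weak H.
  by move=> x; rewrite /= mulKf// gt_eqF.
rewrite ler_wpM2l// le_eqVlt; apply/orP; left; apply/eqP.
by rewrite /adjK -/K -/K2; ring.
Qed.

(** A change of variables moves the translation from the squared gradient, which has no further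
    regularity uniform in r, to chi, which is Lipschitz: |chi(x - h) - chi(x)| <= 4 A r. *)
Let shift_small i j : small (fun x => chi x * a i j (x + h) ^+ 2 - chi x * a i j x ^+ 2) (4 * A ^+ 2 * r).
Proof.
have ms : pmeas (fun x => chi (x - h)) by exact: (pmeas_shift (- h)).
have i1 : intle (fun x => chi (x - h) * a i j x ^+ 2) A.
  apply: intle_mono (iD i j); first by apply: pmeasM => //; exact: pmeasX.
  by move=> x; have /andP[c0 c1] := chi01 (x - h); rewrite mulr_ge0 ?sqr_ge0//= ler_piMl// sqr_ge0.
have i2 : intle (fun x => chi x * a i j x ^+ 2) A.
  apply: intle_mono (iD i j); first by apply: pmeasM => //; exact: pmeasX.
  by move=> x; have /andP[c0 c1] := chi01 x; rewrite mulr_ge0 ?sqr_ge0//= ler_piMl// sqr_ge0.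
have i3 := intle_shift h i1.
have [m1 p1 _] := i1; have [m2 p2 _] := i2; have [m3 p3 _] := i3.
have abs (f : plane R -> R) C : intle f C -> small f C.
  move=> fC; have [mf f0 _] := fC; apply: small_abs => //.
  by apply: intle_ext fC => x; rewrite ger0_norm.
have [j1 _] := abs _ _ i1; have [j2 _] := abs _ _ i2; have [j3 _] := abs _ _ i3.
have E : \int[leb2 R]_x (chi x * a i j (x + h) ^+ 2 - chi x * a i j x ^+ 2) =
    \int[leb2 R]_x ((chi (x - h) - chi x) * a i j x ^+ 2).
  transitivity (\int[leb2 R]_x (chi (x + h - h) * a i j (x + h) ^+ 2) - \int[leb2 R]_x (chi x * a i j x ^+ 2)).
    rewrite -(RintegralB measurableT j3 j2); apply: eq_Rintegral => x _.
    by rewrite addrK.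
  rewrite {1}/Rintegral -[X in fine X]/(pint (fun x => chi (x + h - h) * a i j (x + h) ^+ 2)).
  rewrite (pint_shift h m1 p1) -[fine _]/(\int[leb2 R]_x (chi (x - h) * a i j x ^+ 2)).
  by rewrite -(RintegralB measurableT j1 j2); apply: eq_Rintegral => x _; rewrite mulrBl.
apply: small_eq E.
  apply: smallB (abs _ _ _) (abs _ _ i2).
  by apply: intle_ext i3 => x; rewrite addrK.
have A4 : 0 <= 4 * A * r by rewrite !mulr_ge0// ltW.
apply: small_abs; first by apply: pmeasM; [exact: pmeasB|exact: pmeasX].
have H := intleZ A4 (iD i j).
apply: intle_mono; last apply: intle_weak H.
- by apply: pmeas_norm; apply: pmeasM; [exact: pmeasB|exact: pmeasX].
- move=> x; rewrite normr_ge0/= normrM (ger0_norm (sqr_ge0 _)) ler_wpM2r ?sqr_ge0//.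
  have := @lipschitz_plane R chi A (2 * r) x (- h) schi Dchi; rewrite !normrN => /(_ h1 h2).
  by rewrite (_ : 2 * A * (2 * r) = 4 * A * r)//; ring.
by rewrite le_eqVlt; apply/orP; left; apply/eqP; ring.
Qed.

(** The equation contains the gradient of the truncated increment; this is the part where the
    derivative falls on the cutoff, and it has to be removed. *)
Let cross1 i j : small (fun x => G i j x * ('D_(dir j) chi x * dl (phi i) x)) ((A + 64 * A ^+ 3) * r).
Proof.
have H : intle (fun x => ('D_(dir j) chi x * dl (phi i) x) ^+ 2) (A ^+ 2 * (64 * A * r ^+ 2)).
  apply: intle_mono (intleZ (sqr_ge0 A) (idphi i)); first by apply: pmeasX; exact: pmeasM.
  move=> x; rewrite sqr_ge0/= exprMn ler_wpM2r ?sqr_ge0//.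
  by rewrite -(real_normK (num_real ('D_(dir j) chi x))) lerXn2r ?nnegrE//; exact: Dchi.
apply: small_abs; first by apply: pmeasM => //; exact: pmeasM.
apply: intle_weak (intle_amgm r0 (mG i j) _ (iG i j) H); last exact: pmeasM.
rewrite le_eqVlt; apply/orP; left; apply/eqP; field; exact: lt0r_neq0.
Qed.

(** The cost of exchanging the gradient of phi for that of z next to the increment. It is O(r)
    because phi is chosen at distance r from z. *)
Let cross2 i j : small (fun x => chi x * (a i j x - G i j x) * dl (a i j) x) ((1 + 4 * A) * r).
Proof.
have rV : 0 < r^-1 by rewrite invr_gt0.
have mm : pmeas (fun x => chi x * (a i j x - G i j x)) by apply: pmeasM => //; exact: pmeasB.
have H : intle (fun x => (chi x * (a i j x - G i j x)) ^+ 2) (r ^+ 2).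
  apply: intle_mono (iDG i j); first exact: pmeasX.
  by move=> x; rewrite sqr_ge0/= exprMn ler_piMl// sqr_ge0.
apply: small_abs; first exact: pmeasM.
apply: intle_weak (intle_amgm rV mm (mda i j) H (idl (ma i j) (iD i j))).
rewrite le_eqVlt; apply/orP; left; apply/eqP; field; exact: lt0r_neq0.
Qed.

(* |b' - b|^2 = |b'|^2 - |b|^2 - 2 b (b' - b) with b the gradient of [phi] and b' its
   translate: the difference of squares integrates to O(r) by a change of variables, and the
   last term is given by the equation. *)
Lemma grad_translate i j :
  intle (fun x => chi x * (G i j (x + h) - G i j x) ^+ 2) (gradK nu A m * th).
Proof.
pose Q x := \sum_i \sum_j chi x * dl (a i j) x ^+ 2.
have q0' x : 0 <= Q x.
  apply: sumr_ge0 => i' _; apply: sumr_ge0 => j' _; rewrite mulr_ge0 ?sqr_ge0//.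
  by have /andP[] := chi01 x.
(* In this order: the difference of squares, the equation, the gradient of the cutoff, and the
   replacement of G by the gradient of phi. *)
pose Kq := 16 * A ^+ 2 + 2 * (`|nu^-1| * adjK A m) + 8 * (A + 64 * A ^+ 3) + 8 * (1 + 4 * A).
have sq : small Q (Kq * th).
  have s1 := small_sum2 (fun i => small_sum2 (fun j => shift_small i j)).
  have s2 := smallZ 2 sG.
  have s3 := smallZ 2 (small_sum2 (fun i => small_sum2 (fun j => cross1 i j))).
  have s4 := smallZ 2 (small_sum2 (fun i => small_sum2 (fun j => cross2 i j))).
  have H := smallB (smallD (smallB s1 s2) s3) s4.
  apply: small_ext; last apply: small_weak H.
    move=> x; rewrite /Q !mulr_sumr -sumrB -big_split/= -sumrB.
    apply: eq_bigr => i' _; rewrite !mulr_sumr -sumrB -big_split/= -sumrB.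
    by apply: eq_bigr => j' _; rewrite /dw; ring.
  rewrite ger0_norm// /Kq.
  have c1 : 0 <= A ^+ 2 by exact: sqr_ge0.
  have c3 : 0 <= A ^+ 3 by exact: exprn_ge0.
  have c4 : 0 <= A + 64 * A ^+ 3 by rewrite addr_ge0// mulr_ge0.
  have c5 : 0 <= 1 + 4 * A by rewrite addr_ge0// mulr_ge0.
  have e1 := ler_wpM2l c1 rle; have e2 := ler_wpM2l c4 rle; have e3 := ler_wpM2l c5 rle.
  have -> : 2 * (2 * (4 * A ^+ 2 * r)) + 2 * (`|nu^-1| * (adjK A m * th)) +
    2 * (2 * (2 * ((A + 64 * A ^+ 3) * r))) + 2 * (2 * (2 * ((1 + 4 * A) * r))) =
    16 * (A ^+ 2 * r) + 2 * (`|nu^-1| * adjK A m) * th + 8 * ((A + 64 * A ^+ 3) * r) +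
    8 * ((1 + 4 * A) * r) by ring.
  have -> : (16 * A ^+ 2 + 2 * (`|nu^-1| * adjK A m) + 8 * (A + 64 * A ^+ 3) + 8 * (1 + 4 * A)) * th =
    16 * (A ^+ 2 * th) + 2 * (`|nu^-1| * adjK A m) * th + 8 * ((A + 64 * A ^+ 3) * th) +
    8 * ((1 + 4 * A) * th) by ring.
  by apply: lerD; [apply: lerD; [apply: lerD => //|]|]; rewrite ler_pM2l.
have iq : intle Q (Kq * th) by exact: small_intle.
have r1 : r <= 1 by exact: le_trans rle th1.
(* Back from phi to G: the increment of G is that of the gradient of phi up to two errors of square
   integral at most r^2. *)
have H := intleZ (ler0n R 3) (intleD (intleD (intle_shift h (iDG i j)) iq) (iDG i j)).
apply: intle_mono; last apply: intle_weak H.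
- apply: pmeasM => //; apply: pmeasX; exact: pmeasB (pmeas_shift h (mG i j)) (mG i j).
- move=> x; have /andP[c0 c1] := chi01 x; rewrite mulr_ge0 ?sqr_ge0//=.
  have qa : chi x * dl (a i j) x ^+ 2 <= Q x.
    have cd k l : 0 <= chi x * dl (a k l) x ^+ 2 by rewrite mulr_ge0// sqr_ge0.
    rewrite /Q (bigD1 i)//= (bigD1 j)//= -addrA lerDl addr_ge0//; first by apply: sumr_ge0 => ? _.
    by apply: sumr_ge0 => ? _; apply: sumr_ge0.
  set b' := a i j (x + h) in qa *; set b := a i j x in qa *.
  set g' := G i j (x + h); set g := G i j x.
  have T : (g' - g) ^+ 2 <= 3 * ((b' - g') ^+ 2 + (b' - b) ^+ 2 + (b - g) ^+ 2).
    rewrite -subr_ge0.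
    have -> : 3 * ((b' - g') ^+ 2 + (b' - b) ^+ 2 + (b - g) ^+ 2) - (g' - g) ^+ 2 =
      (b' - b + (b' - g')) ^+ 2 + (b' - g' + (b - g)) ^+ 2 + (b - g - (b' - b)) ^+ 2 by ring.
    by rewrite !addr_ge0 ?sqr_ge0.
  apply: le_trans (ler_wpM2l c0 T) _.
  have -> : chi x * (3 * ((b' - g') ^+ 2 + (b' - b) ^+ 2 + (b - g) ^+ 2)) =
    3 * (chi x * (b' - g') ^+ 2 + chi x * (b' - b) ^+ 2 + chi x * (b - g) ^+ 2) by ring.
  by rewrite ler_pM2l// !lerD// ler_piMl// sqr_ge0.
rewrite /gradK -/Kq -mulrA ler_pM2l//.
have : r ^+ 2 <= th by rewrite expr2 (le_trans _ rle)// ler_piMl// ltW.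
by rewrite (mulrDl 2 Kq th) => rt; rewrite addrAC; apply: lerD => //; lra.
Qed.

End TranslationEstimate.

Section TestFields.
Context {R : realType}.
Variable Omega : set (plane R).
Hypothesis oO : open Omega.
Local Notation ext := (ext0 Omega).

Lemma Rintegral_ae (f g : plane R -> R) : pmeas f -> pmeas g ->
  {ae leb2 R, forall x, f x = g x} -> \int[leb2 R]_x f x = \int[leb2 R]_x g x.
Proof.
move=> mf mg fg; congr fine; apply: ae_eq_integral => //; try exact/measurable_EFinP.
by apply: aeS fg => x h _; rewrite h.
Qed.

Lemma intO_ae0 (f : plane R -> R) : measO Omega f -> aeO Omega f (fun=> 0) -> intO Omega f = 0.
Proof.
move=> mf f0; rewrite intO_ext0 (@Rintegral_ae _ (fun=> 0)).
- by rewrite Rintegral_cst// mul0r.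
- exact: measO_ext0.
- exact: measurable_cst.
- apply: aeS f0 => x h; have [Ox|Ox] := pselect (Omega x); [by rewrite ext0_in// h|by rewrite ext0_out].
Qed.

Lemma test_H01v (om : plane R -> R) (Cw : R) (v : vfield R) : pmeas om -> (forall x, 0 <= om x) ->
  intle (ext om) Cw -> test_field Omega v -> H01v Omega om v.
Proof.
move=> mom om0 iom tv; split.
  move=> i; split.
    by apply/(L2w_intle oO mom om0); split; [exact: test_measO|exact: test_weighted iom _ (tv i)].
  move=> j; exists ('D_(dir j) (vcomp v i)); split.
    by apply: is_wpartial_smooth => //; exact: test_smooth (tv i).
  have tD := test_D j (tv i).
  by apply/(L2w_intle oO mom om0); split; [exact: test_measO|exact: test_weighted iom _ tD].
move=> eps eps0; exists v => //; rewrite /H1vnorm /L2vnorm subrr.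
have -> : intO Omega (fun x => dot ((0 : vfield R) x) ((0 : vfield R) x) * om x) = 0.
  rewrite intO_ext0 (_ : ext _ = fun=> 0) ?Rintegral_cst ?mul0r//.
  apply/funext => x; have [Ox|Ox] := pselect (Omega x); last by rewrite ext0_out.
  by rewrite ext0_in// /dot big1 ?mul0r// => i _; rewrite mxE mul0r.
(* Even for the zero function [wpartial] picks some weak derivative, so it is known to vanish only
   almost everywhere. *)
have w0 i j : aeO Omega (wpartial Omega j (vcomp (0 : vfield R) i)) (fun=> 0).
  have := wpartial_smooth oO j (@smooth_cst R 0).
  rewrite (_ : vcomp (0 : vfield R) i = fun=> 0); last by apply/funext => x; rewrite /vcomp mxE.
  by apply: aeS => x h Ox; rewrite (h Ox) derive_cst.
have mw i j : measO Omega (wpartial Omega j (vcomp (0 : vfield R) i)).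
  rewrite (_ : vcomp (0 : vfield R) i = fun=> 0); last by apply/funext => x; rewrite /vcomp mxE.
  apply: (@wpartial_measO _ _ j _ ('D_(dir j) (fun=> 0))).
  by apply: is_wpartial_smooth => //; exact: smooth_cst.
rewrite intO_ae0 ?addr0.
- by rewrite expr2 sqrtr0 mul0r sqrtr0.
- apply: measurable_funM; last exact: pmeas_measO.
  apply: measurable_sum => i; apply: measurable_sum => j.
  by rewrite /wgrad; under eq_fun do rewrite mxE; apply: measurable_funM; exact: mw.
have H := aeI (aeI (w0 ord0 ord0) (w0 ord0 (lift ord0 ord0)))
  (aeI (w0 (lift ord0 ord0) ord0) (w0 (lift ord0 ord0) (lift ord0 ord0))).
apply: aeS H => x [[h1 h2] [h3 h4]] Ox.
by rewrite /frob !big_ord_recl !big_ord0 /wgrad !mxE h1 ?h2 ?h3 ?h4// !mul0r !addr0 mul0r.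
Qed.

Lemma derive_product (f g : plane R -> R) j x : smooth f -> smooth g ->
  'D_(dir j) (fun x => f x * g x) x = 'D_(dir j) f x * g x + f x * 'D_(dir j) g x.
Proof.
move=> sf sg.
have df : derivable f x (dir j) by exact: smooth_derivable.
have dg : derivable g x (dir j) by exact: smooth_derivable.
transitivity (f x *: 'D_(dir j) g x + g x *: 'D_(dir j) f x); first exact: (deriveM df dg).
by rewrite [LHS]addrC; congr (_ + _); exact: mulrC.
Qed.

Lemma derive_increment (f : plane R -> R) j h x : smooth f ->
  'D_(dir j) (fun x => f (x + h) - f x) x = 'D_(dir j) f (x + h) - 'D_(dir j) f x.
Proof.
move=> sf.
have df : derivable f x (dir j) by exact: smooth_derivable.
have dg : derivable (fun x => f (x + h)) x (dir j) by apply: smooth_derivable; exact: smooth_shift.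
by rewrite (@deriveB _ _ _ (fun x => f (x + h)) f)// derive_shift_plane.
Qed.

Lemma measOM f g : measO Omega f -> measO Omega g -> measO Omega (fun x => f x * g x).
Proof. exact: measurable_funM. Qed.

Lemma measOD f g : measO Omega f -> measO Omega g -> measO Omega (fun x => f x + g x).
Proof. exact: measurable_funD. Qed.

Lemma measOB f g : measO Omega f -> measO Omega g -> measO Omega (fun x => f x - g x).
Proof. exact: measurable_funB. Qed.

Lemma measO_sum (J : Type) (s : seq J) (f : J -> plane R -> R) :
  (forall j, measO Omega (f j)) -> measO Omega (fun x => \sum_(j <- s) f j x).
Proof. by move=> mf; apply: measurable_sum. Qed.

Lemma intle_sqrD f g C C' : measO Omega f -> measO Omega g ->
  intle (ext (fun x => f x ^+ 2)) C -> intle (ext (fun x => g x ^+ 2)) C' ->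
  intle (ext (fun x => (f x + g x) ^+ 2)) (2 * (C + C')).
Proof.
move=> mf mg fC gC; apply: intle_mono (intleZ (ler0n R 2) (intleD fC gC)).
  by apply: measO_ext0 => //; apply: measurable_funX; exact: measurable_funD.
move=> x; rewrite ext0_ge0 ?andTb; last by move=> u; exact: sqr_ge0.
have [Ox|Ox] := pselect (Omega x); last by rewrite !ext0_out// addr0 mulr0.
by rewrite !ext0_in// mulrDr; exact: sqrD_le.
Qed.

Lemma intle_sqr_ae0 f : measO Omega f -> intle (ext (fun x => f x ^+ 2)) 0 -> aeO Omega f (fun=> 0).
Proof.
move=> mf [mw w0 le0].
have E : (\int[leb2 R]_x `|(ext (fun x => f x ^+ 2) x)%:E| = 0)%E.
  apply/eqP; rewrite eq_le integral_ge0 ?andbT//.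
  by apply: le_trans le0; rewrite le_eqVlt; apply/orP; left; apply/eqP; apply: eq_integral => x _; rewrite gee0_abs// lee_fin.
have m' : measurable_fun (setT : set mplane) (fun x : mplane => (ext (fun x => f x ^+ 2) x)%:E) by exact/measurable_EFinP.
have := (ae_eq_integral_abs (leb2 R) measurableT m').1 E.
apply: aeS => x h Ox; have [] := h I; rewrite ext0_in// => /eqP.
by rewrite sqrf_eq0 => /eqP.
Qed.

End TestFields.

(** The ratio tends to 1 as m grows, and alpha < 2. It equals p/(2-p) for p = (m+1)/m, the exponent
    at which [field_powR] is applied. *)
Lemma exponent_exists (R : realType) (alpha : R) : 0 < alpha -> alpha < 2 ->
  exists2 m, (1 < m)%N & alpha * (m.+1%:R / m.-1%:R) < 2.
Proof.
move=> a0 a2; have d0 : 0 < 2 - alpha by rewrite subr_gt0.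
have n0 : 0 < 2 + alpha by rewrite addr_gt0.
have h : 0 <= (2 + alpha) / (2 - alpha) by rewrite divr_ge0 ?ltW.
have := archi_boundP h; set n := Num.bound _ => hn.
exists n.+2 => //=.
have n1 : 0 < n.+1%:R :> R by rewrite ltr0n.
rewrite mulrA ltr_pdivrMr//.
move: hn; rewrite ltr_pdivrMr// => hn.
rewrite -(natr1 n.+2) -(natr1 n.+1) -(natr1 n); nra.
Qed.

(** * Higher integrability from translates *)

Section Average.
Context {R : realType}.
Local Notation mu := (@lebesgue_measure R).
Implicit Types f chi : plane R -> R.

Lemma pint_indic_cube v (t : R) : 0 < t -> pint (\1_(cube v t)) = (4 * t ^+ 2)%:E.
Proof.
move=> t0; rewrite /pint integral_indic ?setIT//; last first.
  by apply: measurable_rect; exact: measurable_itv.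
pose A c : set (measurableTypeR R) := [set` `[c - t, c + t] ].
have mA c : measurable (A c) by exact: measurable_itv.
have -> : leb2 R (cube v t) = (mu (A v.1) * mu (A v.2))%E by exact: product_measure1E.
have mE c : mu (A c) = (2 * t)%:E.
  rewrite /A lebesgue_measure_itv/= lte_fin (_ : (c - t < c + t) = true); last by apply/idP; lra.
  by rewrite -EFinB; congr (_%:E); ring.
by rewrite !mE -EFinM; congr (_%:E); ring.
Qed.

Lemma measurable_cube v t : measurable (cube v t : set (@mplane R)).
Proof. by apply: measurable_rect; exact: measurable_itv. Qed.

Lemma measurable_add_plane : measurable_fun setT
  (fun z : @mplane R * @mplane R => (z.1.1 + z.2.1, z.1.2 + z.2.2) : @mplane R).
Proof.
apply: measurable_fun_pair; apply: measurable_funD.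
- exact: (measurableT_comp measurable_fst measurable_fst).
- exact: (measurableT_comp measurable_fst measurable_snd).
- exact: (measurableT_comp measurable_snd measurable_fst).
- exact: (measurableT_comp measurable_snd measurable_snd).
Qed.

Let mulsq_ge0 (a b c : R) : 0 <= a -> 0 <= c -> 0 <= a * b ^+ 2 * c.
Proof. by move=> ? ?; apply: mulr_ge0 => //; apply: mulr_ge0 => //; exact: sqr_ge0. Qed.

(* Average [f x = f (x + u) - (f (x + u) - f x)] over the square of the [u]. *)
Lemma average_level f chi A B v (t : R) : 0 < t -> pmeas f -> pmeas chi -> (forall x, 0 <= chi x) ->
  intle (fun x => f x ^+ 2) A ->
  (forall u, cube v t u -> intle (fun x => chi x * (f (x + u) - f x) ^+ 2) B) ->
  intle (fun x => chi x * f x ^+ 2 * (A <= t ^+ 2 * f x ^+ 2)%R%:R) (4 * B).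
Proof.
move=> t0 mf mchi chi0 fA fB.
have tt : 0 < t ^+ 2 by rewrite exprn_gt0.
have A0 := intle_ge0 fA.
have vB : intle (fun x => chi x * (f (x + v) - f x) ^+ 2) B.
  by apply: fB; apply/cubeP; rewrite !subrr normr0 ltW.
have B0 := intle_ge0 vB.
have mS := measurable_cube v t.
pose W (z : @mplane R * @mplane R) : \bar R :=
  (chi z.1 * (f (z.1 + z.2) - f z.1) ^+ 2 * \1_(cube v t) z.2)%:E.
have W0 z : (0 <= W z)%E by rewrite lee_fin; exact: mulsq_ge0.
have mW : measurable_fun setT W.
  apply/measurable_EFinP; apply: measurable_funM; last first.
    by apply: (measurableT_comp _ measurable_snd); exact: measurable_indic.
  apply: measurable_funM; first exact: (measurableT_comp mchi measurable_fst).
  apply: measurable_funX; apply: measurable_funB; last exact: (measurableT_comp mf measurable_fst).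
  exact: (measurableT_comp mf measurable_add_plane).
have mL : pmeas (fun x => chi x * f x ^+ 2 * (A <= t ^+ 2 * f x ^+ 2)%R%:R).
  apply: pmeasM; first by apply: pmeasM => //; exact: pmeasX.
  have mset : measurable ([set x | A <= t ^+ 2 * f x ^+ 2] : set (@mplane R)).
    have mg : pmeas (fun x => t ^+ 2 * f x ^+ 2) by apply: pmeasM; [exact: measurable_cst|exact: pmeasX].
    have := mg measurableT _ (measurable_itv `[A, +oo[); rewrite setTI.
    by congr measurable; apply/seteqP; split => x /=; rewrite in_itv/= andbT.
  have := @measurable_indic _ _ R setT _ mset; congr measurable_fun.
  apply/funext => x; rewrite indicE; have [h|h] := boolP (A <= t ^+ 2 * f x ^+ 2).
    by rewrite mem_set.
  by rewrite memNset//=; exact/negP.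
(* The square has area 4 t^2, so averaging gives 4 t^2 f(x)^2 <= 2 J + 2 A. On the level set 2 A <=
   2 t^2 f(x)^2 is absorbed, and t^2 f(x)^2 <= J remains. *)
have key x : ((t ^+ 2 * (chi x * f x ^+ 2 * (A <= t ^+ 2 * f x ^+ 2)%R%:R))%:E
    <= \int[leb2 R]_u W (x, u))%E.
  have [At|_] := leP A (t ^+ 2 * f x ^+ 2); last first.
    by rewrite !mulr0; apply: integral_ge0 => u _.
  pose J := (\int[leb2 R]_u ((f (x + u) - f x) ^+ 2 * \1_(cube v t) u)%:E)%E.
  have mJ : pmeas (fun u => (f (x + u) - f x) ^+ 2 * \1_(cube v t) u).
    apply: pmeasM; last exact: measurable_indic.
    apply: pmeasX; apply: pmeasB; last exact: measurable_cst.
    by rewrite (_ : (fun u => _) = (fun u => f (u + x))); [exact: pmeas_shift|apply/funext => u; rewrite addrC].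
  have -> : (\int[leb2 R]_u W (x, u) = (chi x)%:E * J)%E.
    rewrite /J -ge0_integralZl_EFin//.
    - by apply: eq_integral => u _; rewrite /W /= -mulrA EFinM.
    - by move=> u _; rewrite lee_fin mulr_ge0// sqr_ge0.
    - exact/measurable_EFinP.
  rewrite mulr1 mulrCA EFinM; apply: lee_wpmul2l; first by rewrite lee_fin.
  have J0 : (0 <= J)%E by apply: integral_ge0 => u _; rewrite lee_fin mulr_ge0// sqr_ge0.
  have h : ((4 * t ^+ 2 * f x ^+ 2)%:E <= 2%:E * J + (2 * A)%:E)%E.
    have -> : (4 * t ^+ 2 * f x ^+ 2)%:E = (\int[leb2 R]_u (f x ^+ 2 * \1_(cube v t) u)%:E)%E.
      under eq_integral do rewrite EFinM.
      rewrite ge0_integralZl_EFin ?sqr_ge0//.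
      - by rewrite [X in (_ * X)%E](pint_indic_cube v t0) -EFinM mulrC.
      - by apply/measurable_EFinP; exact: measurable_indic.
    have sA : intle (fun u => f (x + u) ^+ 2) A.
      by apply: intle_ext (intle_shift x fA) => u; rewrite addrC.
    have [m2 p2 le2] := intleZ (ler0n R 2) sA.
    apply: (@le_trans _ _ (\int[leb2 R]_u ((2 * ((f (x + u) - f x) ^+ 2 * \1_(cube v t) u))%:E
        + (2 * f (x + u) ^+ 2)%:E))%E).
      apply: ge0_le_integral => //.
      - by move=> u _; rewrite lee_fin mulr_ge0// sqr_ge0.
      - by apply/measurable_EFinP; apply: pmeasM; [exact: measurable_cst|exact: measurable_indic].
      - apply: emeasurable_funD; apply/measurable_EFinP => //.
        by apply: pmeasM => //; exact: measurable_cst.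
      move=> u _; rewrite -EFinD lee_fin.
      have := sqrD_le (f x - f (x + u)) (f (x + u)); rewrite subrK -[(f x - _) ^+ 2]sqrrN opprB.
      rewrite indicE; case: (u \in _) => H; rewrite ?mulr1//.
      by rewrite !mulr0 add0r mulr_ge0// sqr_ge0.
    have mD1 : measurable_fun setT (fun u : @mplane R => (2 * ((f (x + u) - f x) ^+ 2 * \1_(cube v t) u))%:E).
      by apply/measurable_EFinP; apply: pmeasM => //; exact: measurable_cst.
    have mD2 : measurable_fun setT (fun u : @mplane R => (2 * f (x + u) ^+ 2)%:E) by exact/measurable_EFinP.
    have pD1 u : (0 <= (2 * ((f (x + u) - f x) ^+ 2 * \1_(cube v t) u))%:E)%E.
      by rewrite lee_fin; apply: mulr_ge0 => //; apply: mulr_ge0 => //; exact: sqr_ge0.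
    have pD2 u : (0 <= (2 * f (x + u) ^+ 2)%:E)%E by rewrite lee_fin.
    rewrite ge0_integralD//.
    apply: leeD => //; rewrite le_eqVlt; apply/orP; left; apply/eqP.
    rewrite /J -ge0_integralZl_EFin//; last exact/measurable_EFinP.
    by move=> u _; rewrite lee_fin mulr_ge0// sqr_ge0.
  move: J0 h; case: (J) => [j| |]//= j0; last by rewrite leey.
  by rewrite -EFinM -EFinD !lee_fin; lra.
split => //.
  by move=> x; exact: mulsq_ge0.
(* Exchanging the integrals leaves at most B for each u in the square, that is 4 t^2 B in all;
   dividing by t^2 gives 4 B. *)
have hT : ((t ^+ 2)%:E * pint (fun x => (chi x * f x ^+ 2 * (A <= t ^+ 2 * f x ^+ 2)%R%:R)%R)
    <= (t ^+ 2 * (4 * B))%:E)%E.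
  rewrite /pint -ge0_integralZl_EFin ?(ltW tt)//; first last.
  - exact/measurable_EFinP.
  - by move=> x _; rewrite lee_fin; exact: mulsq_ge0.
  apply: (@le_trans _ _ (\int[leb2 R]_x \int[leb2 R]_u W (x, u))%E).
    apply: ge0_le_integral => //.
    - by move=> x _; rewrite -EFinM lee_fin; apply: mulr_ge0; [exact: ltW|exact: mulsq_ge0].
    - apply: measurable_funeM; exact/measurable_EFinP.
    - exact: (@measurable_fun_fubini_tonelli_F _ _ _ _ _ (@sleb2 R) W).
    - by move=> x _; rewrite -EFinM; exact: key.
  rewrite -[X in (X <= _)%E]/(\int[@sleb2 R]_x \int[@sleb2 R]_y W (x, y))%E.
  rewrite (@fubini_tonelli _ _ _ _ _ (@sleb2 R) (@sleb2 R) W mW W0).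
  apply: (@le_trans _ _ (\int[leb2 R]_u (B * \1_(cube v t) u)%:E)%E).
    apply: ge0_le_integral => //.
    - by move=> u _; apply: integral_ge0.
    - exact: (@measurable_fun_fubini_tonelli_G _ _ _ _ _ (@sleb2 R) W).
    - by apply/measurable_EFinP; apply: pmeasM; [exact: measurable_cst|exact: measurable_indic].
    move=> u _; rewrite /W /=; have [Su|Su] := pselect (cube v t u).
      rewrite indicE mem_set// mulr1; under eq_integral do rewrite mulr1.
      by have [_ _] := fB u Su.
    by rewrite indicE memNset// mulr0 integral0_eq// => x _; rewrite mulr0.
  under eq_integral do rewrite EFinM.
  rewrite ge0_integralZl_EFin//.
  - by rewrite [X in (_ * X)%E](pint_indic_cube v t0) -EFinM lee_fin le_eqVlt; apply/orP; left; apply/eqP; ring.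
  - by apply/measurable_EFinP; exact: measurable_indic.
by move: hT; rewrite (EFinM (t ^+ 2) (4 * B)) lee_pmul2l// lte_fin.
Qed.

End Average.

Section HigherIntegrability.
Context {R : realType}.
Variables (f chi : plane R -> R) (A K d b : R) (e : plane R) (N : nat).
Hypotheses (mf : pmeas f) (mchi : pmeas chi) (chi0 : forall x, 0 <= chi x <= 1).
Hypotheses (A0 : 0 < A) (K0 : 0 <= K) (d0 : 0 < d) (b0 : 0 < b) (N0 : (0 < N)%N).
Hypothesis fA : intle (fun x => f x ^+ 2) A.
Hypothesis fK : forall (th : R) (h : plane R), 0 < th -> th <= 1 -> th ^+ N <= b ->
      `|h.1 - th ^+ N * e.1| <= th ^+ N * d -> `|h.2 - th ^+ N * e.2| <= th ^+ N * d ->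
      intle (fun x => chi x * (f (x + h) - f x) ^+ 2) (K * th).

(** At the level where t_k^2 f^2 is of order A, |f|^(1/(2N)) is of order th_k^(-1/2) = 2^k, whereas
    the mass of f^2 above that level is O(th_k) = O(4^-k). With q - 2 = 1/(2N) the products 2^k 4^-k
    are summable. *)
Let th (k : nat) : R := 4^-1 ^+ k.
Let t k := th k ^+ N * d.
Let sg : R := (4 * N)%:R^-1.
Let q : R := 2 + (2 * N)%:R^-1.

Let th0 k : 0 < th k. Proof. by rewrite exprn_gt0// invr_gt0. Qed.
Let th1 k : th k <= 1.
Proof. by rewrite exprn_ile1// ?invr_ge0// invf_le1// ler1n. Qed.
Let t0 k : 0 < t k. Proof. by rewrite mulr_gt0// exprn_gt0. Qed.

Let level k : th k ^+ N <= b ->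
  intle (fun x => chi x * f x ^+ 2 * (A <= t k ^+ 2 * f x ^+ 2)%R%:R) (4 * (K * th k)).
Proof.
move=> hb; have c0 x : 0 <= chi x by have /andP[] := chi0 x.
apply: (average_level (v := th k ^+ N *: e) (t0 k) mf mchi c0 fA) => u /cubeP[u1 u2].
by apply: fK => //; rewrite ?th0 ?th1.
Qed.

Let sg0 : 0 < sg. Proof. by rewrite invr_gt0 ltr0n muln_gt0. Qed.

Let t_powR k : (A / t k ^+ 2) `^ sg = (A / d ^+ 2) `^ sg * 2 ^+ k.
Proof.
have dn : d != 0 by rewrite gt_eqF.
have -> : A / t k ^+ 2 = A / d ^+ 2 * (2 ^+ k) ^+ (4 * N).
  rewrite /t exprMn invfM mulrA mulrAC; congr (_ * _).
  have e4 : 4 = 2 ^+ 2 :> R by rewrite expr2; lra.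
  rewrite /th -!exprVn invrK e4 -!exprM; congr (_ ^+ _); ring.
rewrite powRM ?divr_ge0 ?sqr_ge0 ?(ltW A0) ?exprn_ge0//; congr (_ * _).
rewrite -powR_mulrn ?exprn_ge0// -powRrM /sg divff ?powRr1 ?exprn_ge0//.
by rewrite pnatr_eq0 muln_eq0/= -lt0n.
Qed.

Let small_level x : exists k, t k ^+ 2 * f x ^+ 2 < A.
Proof.
have y0 : 0 <= d ^+ 2 * f x ^+ 2 / A by apply: divr_ge0; [apply: mulr_ge0; exact: sqr_ge0|exact: ltW].
exists (Num.bound (d ^+ 2 * f x ^+ 2 / A)); set k := Num.bound _.
have h1 : d ^+ 2 * f x ^+ 2 < k%:R * A by rewrite -ltr_pdivrMr//; exact: archi_boundP.
have tk : t k ^+ 2 * k%:R <= d ^+ 2.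
  rewrite /t exprMn mulrAC ler_piMl ?sqr_ge0//.
  have h2 : (th k ^+ N) ^+ 2 <= th k.
    rewrite -exprM -[X in _ <= X]expr1 ler_wiXn2l ?th1 ?(ltW (th0 k))//.
    by rewrite muln_gt0 N0.
  apply: (@le_trans _ _ (th k * k%:R)); first by rewrite ler_wpM2r.
  rewrite /th exprVn mulrC ler_pdivrMr ?exprn_gt0// mul1r -natrX ler_nat.
  by apply: ltnW; exact: ltn_expl.
have [k0|k0] := posnP k.
  move: h1; rewrite k0 mul0r => h1; have := mulr_ge0 (sqr_ge0 d) (sqr_ge0 (f x)); lra.
have kR : 0 < k%:R :> R by rewrite ltr0n.
rewrite -(ltr_pM2r kR) [A * _]mulrC mulrAC.
by apply: le_lt_trans h1; rewrite ler_wpM2r ?sqr_ge0.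
Qed.

Let powR_split x : `|f x| `^ q = f x ^+ 2 * (f x ^+ 2) `^ sg.
Proof.
have sp : 0 < (2 * N)%:R^-1 :> R by rewrite invr_gt0 ltr0n muln_gt0.
rewrite /q powRD; last by apply/implyP => /eqP h; lra.
rewrite sqr_powR; congr (_ * _).
rewrite -sqr_powR -powRrM; congr (_ `^ _).
rewrite /sg (_ : 4 * N = 2 * (2 * N))%N; last by rewrite mulnA.
by rewrite (natrM _ 2 (2 * N)) invfM mulrA divff// mul1r.
Qed.

Lemma higher_integrability : exists C, intle (fun x => chi x * `|f x| `^ q) C.
Proof.
have [k0 hk0] : exists k0, th k0 ^+ N <= b.
  exists (Num.bound b^-1); set k := Num.bound _.
  have bV : b^-1 < k%:R by apply: archi_boundP; rewrite invr_ge0 ltW.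
  apply: (@le_trans _ _ (th k)).
    by rewrite -[X in _ <= X]expr1 ler_wiXn2l ?th1 ?(ltW (th0 k)).
  rewrite /th exprVn -[b]invrK lef_pV2 ?posrE ?invr_gt0 ?exprn_gt0//.
  rewrite (le_trans (ltW bV))// -natrX ler_nat.
  by apply: ltnW; exact: ltn_expl.
have hb k : (k0 <= k)%N -> th k ^+ N <= b.
  move=> kk; apply: le_trans hk0; rewrite lerXn2r ?nnegrE ?(ltW (th0 _))//.
  by rewrite /th ler_wiXn2l ?invr_ge0// invf_le1// ler1n.
pose c := (A / d ^+ 2) `^ sg.
have c0 : 0 <= c by exact: powR_ge0.
pose E k x := chi x * f x ^+ 2 * (A <= t k ^+ 2 * f x ^+ 2)%R%:R.
have chi0' x : 0 <= chi x by have /andP[] := chi0 x.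
have E0 k x : 0 <= E k x by apply: mulr_ge0 => //; apply: mulr_ge0 => //; exact: sqr_ge0.
have T0 k : 0 <= 2 * c * 2 ^+ (k + k0) by apply: mulr_ge0; [exact: mulr_ge0|exact: exprn_ge0].
(* The first term covers the points below level k0. In the sum the extra factor 2 is there because a
   point is in E at its last level, while its size is controlled at the next one. *)
pose S n x := c * 2 ^+ k0 * (chi x * f x ^+ 2) + \sum_(k < n) (2 * c * 2 ^+ (k + k0)) * E (k + k0)%N x.
have cf : intle (fun x => chi x * f x ^+ 2) A.
  apply: intle_mono fA; first by apply: pmeasM => //; exact: pmeasX.
  move=> x; have /andP[p1 p2] := chi0 x.
  by rewrite mulr_ge0 ?sqr_ge0//= ler_piMl// sqr_ge0.
pose C := c * 2 ^+ k0 * A + 16 * c * K.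
have SC n : intle (S n) C.
  apply: intleD; first by apply: intleZ => //; rewrite mulr_ge0 ?exprn_ge0.
  apply: (@intle_weak _ _ (\sum_(k < n) (2 * c * 2 ^+ (k + k0)) * (4 * (K * th (k + k0)%N)))); last first.
    apply: intle_sum => k; apply: intleZ; first exact: T0.
    by apply: level; apply: hb; rewrite leq_addl.
  apply: (@le_trans _ _ (\sum_(k < n) (8 * c * K) * 2^-1 ^+ k)).
    apply: ler_sum => k _.
    have -> : 2 * c * 2 ^+ (k + k0) * (4 * (K * th (k + k0)%N)) = 8 * c * K * (2 ^+ (k + k0) * th (k + k0)%N) by ring.
    rewrite ler_wpM2l ?mulr_ge0//.
    rewrite /th -exprMn (_ : 2 * 4^-1 = 2^-1 :> R); last by field.
    by rewrite exprD ler_piMr ?exprn_ge0 ?invr_ge0// exprn_ile1// ?invr_ge0// invf_le1// ler1n.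
  rewrite -mulr_sumr (_ : 16 * c * K = 8 * c * K * 2); last by ring.
  rewrite ler_wpM2l ?mulr_ge0//.
  have h := subrX1 (2^-1 : R) n.
  have : 0 <= 2^-1 ^+ n :> R by rewrite exprn_ge0.
  lra.
exists C; apply: (intle_fatou SC).
- by apply: pmeasM => //; exact: pmeas_norm_powR.
- by move=> x; rewrite mulr_ge0// powR_ge0.
apply: aeS (negligible_point 0) => x _ e' e0.
have S0 n : 0 <= \sum_(k < n) (2 * c * 2 ^+ (k + k0)) * E (k + k0)%N x.
  by apply: sumr_ge0 => k _; exact: mulr_ge0 (T0 k) (E0 _ _).
have pw k : t k ^+ 2 * f x ^+ 2 < A -> (f x ^+ 2) `^ sg <= c * 2 ^+ k.
  move=> h; rewrite -t_powR; apply: ge0_ler_powR; rewrite ?nnegrE ?sqr_ge0 ?(ltW sg0)//.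
    by rewrite divr_ge0 ?sqr_ge0// ltW.
  by rewrite ler_pdivlMr ?exprn_gt0// mulrC ltW.
have [lt0|ge0] := ltP (t k0 ^+ 2 * f x ^+ 2) A.
  apply: nearW => n; rewrite powR_split mulrA /S.
  apply: (@le_trans _ _ (c * 2 ^+ k0 * (chi x * f x ^+ 2))); last by rewrite -addrA lerDl addr_ge0// ltW.
  by rewrite mulrC ler_wpM2r ?pw// mulr_ge0 ?sqr_ge0.
have [j jE jlt] : exists2 j, (A <= t (j + k0)%N ^+ 2 * f x ^+ 2) & t (j + k0).+1 ^+ 2 * f x ^+ 2 < A.
  have ex : exists k, t (k + k0)%N ^+ 2 * f x ^+ 2 < A.
    have [k hk] := small_level x; exists k.
    apply: le_lt_trans hk; rewrite ler_wpM2r ?sqr_ge0// lerXn2r ?nnegrE ?(ltW (t0 _))//.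
    rewrite /t ler_pM2r// lerXn2r ?nnegrE ?(ltW (th0 _))//.
    by rewrite /th ler_wiXn2l ?invr_ge0 ?leq_addr// invf_le1// ler1n.
  case: (ex_minnP ex) => [[|n] hn mn].
    by move: hn; rewrite add0n ltNge ge0.
  exists n => //; rewrite leNgt; apply/negP => /mn; by rewrite ltnn.
exists j.+1 => // n /= jn.
apply: (@le_trans _ _ ((2 * c * 2 ^+ (j + k0)) * E (j + k0)%N x)); last first.
  rewrite /S (bigD1 (Ordinal jn))//= -!addrA [X in _ <= X]addrCA lerDl !addr_ge0 ?(ltW e0)//.
    by apply: mulr_ge0; [apply: mulr_ge0 => //; exact: exprn_ge0|apply: mulr_ge0 => //; exact: sqr_ge0].
  by apply: sumr_ge0 => k _; exact: mulr_ge0 (T0 k) (E0 _ _).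
rewrite /E jE mulr1 powR_split mulrA mulrC.
apply: ler_wpM2r; first by apply: mulr_ge0 => //; exact: sqr_ge0.
by apply: le_trans (pw _ jlt) _; rewrite exprS le_eqVlt; apply/orP; left; apply/eqP; ring.
Qed.

End HigherIntegrability.

Section Covering.
Context {R : realType}.

Lemma compact_closure (Omega : set (plane R)) L : Omega `<=` obox L -> compact (closure Omega).
Proof.
move=> OL; apply: (@subclosed_compact _ _ (cquad (- L) L (- L) L)).
- exact: closed_closure.
- exact: compact_cquad.
have cl : closed (cquad (- L) L (- L) L).
  by apply: compact_closed_plane; exact: compact_cquad.
rewrite [X in _ `<=` X]((closure_id _).1 cl); apply: closureS => x /OL; exact: oquad_sub.
Qed.

(** Finitely many of the open sets where chi x exceeds half of its value at x cover the compact
    closure, so g is at most a finite sum of multiples of the chi x g. *)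
Lemma intle_cover (Omega : set (plane R)) L (g : plane R -> R) (chi : plane R -> plane R -> R) :
  Omega `<=` obox L -> pmeas g -> (forall x, 0 <= g x) -> (forall x, ~ Omega x -> g x = 0) ->
  (forall x y, 0 <= chi x y) -> (forall x, continuous (chi x)) ->
  (forall x, closure Omega x -> 0 < chi x x /\ exists C, intle (fun y => chi x y * g y) C) ->
  exists C, intle g C.
Proof.
move=> OL mg g0 gO chi0 cchi H.
(* The filter of finite lists directed by inclusion: a property near this filter holds for all large
   enough lists, so the near-covering form of compactness yields a finite subcover. *)
pose F (A : set (seq (plane R))) := exists s0 : seq (plane R), forall s, {subset s0 <= s} -> A s.
have FF : Filter F.
  split; first by exists [::].
  - move=> A B [s1 h1] [s2 h2]; exists (s1 ++ s2) => s h; split.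
      by apply: h1 => u us; apply: h; rewrite mem_cat us.
    by apply: h2 => u us; apply: h; rewrite mem_cat us orbT.
  - by move=> A B AB [s0 h]; exists s0 => s /h /AB.
pose P (s : seq (plane R)) y := exists x, [/\ x \in s, closure Omega x & chi x x / 2 < chi x y].
have := (compact_near_coveringP (closure Omega)).1 (compact_closure OL) _ F P FF.
move=> /(_ _)/wrap[].
  move=> x cx; have [c0 _] := H x cx.
  exists ([set y | chi x x / 2 < chi x y], [set s : seq (plane R) | x \in s]); last first.
    by move=> [y s] [/= h1 h2]; exists x.
  split => /=; last by exists [:: x] => s; apply; rewrite mem_head.
  apply: open_nbhs_nbhs; split; last by rewrite /=; lra.
  apply: (@open_comp _ _ (chi x) [set y | chi x x / 2 < y]); last exact: open_gt.
  by move=> y _; exact: cchi.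
move=> [D' /(_ D' (fun u => id)) cov].
have /choice[C hC] : forall x, exists C, closure Omega x -> intle (fun y => chi x y * g y) C.
  move=> x; have [xD|xD] := pselect (closure Omega x); last by exists 0.
  by have [_ [C hC]] := H x xD; exists C.
have mchi x : pmeas (chi x) by exact: pmeas_continuous.
pose w (x : plane R) : R := if `[< closure Omega x >] then (chi x x / 2)^-1 else 0.
have w0 x : 0 <= w x.
  rewrite /w; case: asboolP => // /H[c0 _].
  by rewrite invr_ge0 divr_ge0// ltW.
have hw x : intle (fun y => w x * (chi x y * g y)) (w x * C x).
  rewrite /w; case: asboolP => xD.
    have [c0 _] := H x xD.
    by apply: intleZ; [rewrite invr_ge0 divr_ge0// ltW|exact: hC].
  by rewrite mul0r; apply: intle_ext (@intle0 R) => y; rewrite mul0r.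
exists (\sum_(x <- D') w x * C x).
apply: intle_mono (intle_sum D' hw) => // y.
rewrite g0/=; have [Oy|nOy] := pselect (Omega y); last first.
  by rewrite gO// sumr_ge0// => x _; rewrite !mulr_ge0.
have [x [xD cx xy]] := cov y (subset_closure Oy).
have [cx0 _] := H x cx.
rewrite (big_rem x)//=; apply: (@le_trans _ _ (w x * (chi x y * g y))); last first.
  by rewrite lerDl sumr_ge0// => ? _; rewrite !mulr_ge0.
rewrite /w asboolT// mulrA ler_peMl// ler_pdivlMl ?divr_gt0// mulr1 ltW//.
Qed.

End Covering.

Section TonelliBound.
Context {R : realType} {d : measure_display} {T : measurableType d}.
Variable m : {sigma_finite_measure set T -> \bar R}.

(** Minkowski's integral inequality in L^1: a function below a weighted mean of the F(., t) has its
    integral below the weighted mean of their integrals. The bound is asked only where the weight is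
    nonzero. *)
Lemma intle_tonelli (w : T -> R) (F : @mplane R * T -> R) (E : plane R -> R) (B Cw : R) :
  measurable_fun setT w -> (forall t, 0 <= w t) -> (\int[m]_t (w t)%:E <= Cw%:E)%E ->
  measurable_fun setT F -> (forall z, 0 <= F z) -> 0 <= B ->
  (forall t, w t != 0 -> (\int[leb2 R]_x (F (x, t))%:E <= B%:E)%E) ->
  pmeas E -> (forall x, 0 <= E x) ->
  (forall x, ((E x)%:E <= \int[m]_t (w t * F (x, t))%:E)%E) -> intle E (B * Cw).
Proof.
move=> mw w0 wC mF F0 B0 FB mE E0 EF; split => //.
pose W (z : @mplane R * T) : \bar R := (w z.2 * F z)%:E.
have W0 z : (0 <= W z)%E by rewrite lee_fin mulr_ge0.
have mW : measurable_fun setT W.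
  apply/measurable_EFinP; apply: measurable_funM => //.
  exact: (measurableT_comp mw measurable_snd).
apply: (@le_trans _ _ (\int[@sleb2 R]_x \int[m]_t W (x, t))%E).
  apply: ge0_le_integral => //.
  - by move=> x _; rewrite lee_fin.
  - exact/measurable_EFinP.
  - exact: (@measurable_fun_fubini_tonelli_F _ _ _ _ _ m W).
rewrite (@fubini_tonelli _ _ _ _ _ (@sleb2 R) m W mW W0).
apply: (@le_trans _ _ (\int[m]_t (B * w t)%:E)%E).
  apply: ge0_le_integral => //.
  - by move=> t _; apply: integral_ge0.
  - exact: (@measurable_fun_fubini_tonelli_G _ _ _ _ _ (@sleb2 R) W).
  - by apply/measurable_EFinP; exact: measurable_funM.
  move=> t _; rewrite /W /=; have [->|wt] := eqVneq (w t) 0.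
    by rewrite mulr0 integral0_eq// => x _; rewrite mul0r.
  under eq_integral do rewrite EFinM.
  have mFt : measurable_fun setT (fun x : @mplane R => (F (x, t))%:E).
    apply/measurable_EFinP; apply: (measurableT_comp mF).
    by apply: measurable_fun_pair => //; exact: measurable_cst.
  rewrite (_ : (B * w t)%:E = (w t)%:E * B%:E)%E; last by rewrite -EFinM mulrC.
  rewrite ge0_integralZl_EFin//; last by move=> x _; rewrite lee_fin.
  by apply: lee_wpmul2l; [rewrite lee_fin|exact: FB].
under eq_integral do rewrite EFinM.
rewrite ge0_integralZl_EFin//.
- by rewrite EFinM; apply: lee_wpmul2l => //; rewrite lee_fin.
- by move=> t _; rewrite lee_fin.
- exact/measurable_EFinP.
Qed.

End TonelliBound.

Section Shift.
Context {R : realType}.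
Implicit Types f : plane R -> R.

Lemma Rintegral_shift (h : plane R) f : (leb2 R).-integrable setT (EFin \o f) ->
  \int[leb2 R]_x f (x + h) = \int[leb2 R]_x f x.
Proof.
move=> fi; have [mf [C fC]] := integrable_intle fi.
have mp : pmeas (fun x => (`|f x| + f x) / 2).
  by apply: pmeasM; [apply: pmeasD => //; exact: pmeas_norm|exact: measurable_cst].
have mn : pmeas (fun x => (`|f x| - f x) / 2).
  by apply: pmeasM; [apply: pmeasB => //; exact: pmeas_norm|exact: measurable_cst].
have bnd x : - `|f x| <= f x <= `|f x| by rewrite -ler_norml.
have p0 x : 0 <= (`|f x| + f x) / 2 by have /andP[] := bnd x; lra.
have n0 x : 0 <= (`|f x| - f x) / 2 by have /andP[] := bnd x; lra.
have ip : intle (fun x => (`|f x| + f x) / 2) C.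
  by apply: intle_mono fC => // x; rewrite p0/=; have /andP[] := bnd x; lra.
have in_ : intle (fun x => (`|f x| - f x) / 2) C.
  by apply: intle_mono fC => // x; rewrite n0/=; have /andP[] := bnd x; lra.
have toint (g : plane R -> R) : intle g C -> (leb2 R).-integrable setT (EFin \o g).
  move=> gC; have [mg g0 _] := gC.
  have le x : `|g x| <= g x by rewrite ger0_norm.
  by have [] := intle_integrable mg le gC.
have sh (g : plane R -> R) : intle g C -> \int[leb2 R]_x g (x + h) = \int[leb2 R]_x g x.
  by move=> [mg g0 _]; rewrite /Rintegral -[X in fine X]/(pint (fun x => g (x + h))) pint_shift.
have E x : f x = (`|f x| + f x) / 2 - (`|f x| - f x) / 2 by lra.
transitivity (\int[leb2 R]_x ((`|f (x + h)| + f (x + h)) / 2) - \int[leb2 R]_x ((`|f (x + h)| - f (x + h)) / 2)).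
  rewrite -(RintegralB measurableT (toint _ (intle_shift h ip)) (toint _ (intle_shift h in_))).
  by apply: eq_Rintegral => x _; exact: E.
rewrite (sh _ ip) (sh _ in_) -(RintegralB measurableT (toint _ ip) (toint _ in_)).
by apply: eq_Rintegral => x _; rewrite -E.
Qed.

Lemma intle_lim f (K c : R) : 0 <= c -> (forall t, 0 < t -> t <= 1 -> intle f (K + t * c)) -> intle f K.
Proof.
move=> c0 H; have [mf f0 _] := H 1 ltr01 (lexx _); split => //.
apply/lee_addgt0Pr => e e0.
pose t := Num.min 1 (e / (c + 1)).
have c1 : 0 < c + 1 by rewrite ltr_wpDl.
have t0 : 0 < t by rewrite lt_min ltr01 divr_gt0.
have t1 : t <= 1 by rewrite ge_min lexx.
have [_ _ h] := H t t0 t1; apply: le_trans h _; rewrite -EFinD lee_fin lerD2l.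
have te : t * (c + 1) <= e by rewrite -ler_pdivlMr// ge_min lexx orbT.
by apply: le_trans te; rewrite ler_pM2l// lerDl.
Qed.

End Shift.

(** * Continuous representatives *)

Section Morrey.
Context {R : realType}.
Local Notation mu := (@lebesgue_measure R).

(* Half-open squares, so that a square is the disjoint union of its four quarters. *)
Definition hsq (s : R) : set (plane R) := `[0, s[ `*` `[0, s[.

Lemma measurable_hsq s : measurable (hsq s : set (@mplane R)).
Proof. by apply: measurable_rect; exact: measurable_itv. Qed.

Lemma pint_indic_hsq (s : R) : 0 < s -> pint (\1_(hsq s)) = (s ^+ 2)%:E.
Proof.
move=> s0; rewrite /pint integral_indic ?setIT//; last exact: measurable_hsq.
pose A : set (measurableTypeR R) := [set` `[0, s[ ].
have mA : measurable A by exact: measurable_itv.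
have -> : leb2 R (hsq s) = (mu A * mu A)%E by exact: product_measure1E.
by rewrite /A lebesgue_measure_itv/= lte_fin s0 -EFinD subr0 -EFinM.
Qed.

Lemma intle_indic_hsq (s : R) : 0 < s -> intle (\1_(hsq s)) (s ^+ 2).
Proof.
move=> s0; split; [by apply: measurable_indic; exact: measurable_hsq|by []|].
by rewrite pint_indic_hsq.
Qed.

Lemma hsqP s x : hsq s x <-> (0 <= x.1 < s) /\ (0 <= x.2 < s).
Proof. by rewrite /hsq /= !in_itv. Qed.

Definition corner (s : R) (a b : bool) : plane R := (s * a%:R, s * b%:R).

Lemma indic_hsq_double (s : R) x : 0 < s -> \1_(hsq (2 * s)) x =
  \1_(hsq s) x + \1_(hsq s) (x - corner s true false) +
  \1_(hsq s) (x - corner s false true) + \1_(hsq s) (x - corner s true true) :> R.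
Proof.
move=> s0; have I1 (t : R) : ((0 <= t < 2 * s)%R%:R : R) = (0 <= t < s)%R%:R + (0 <= t - s < s)%R%:R.
  by case: (leP 0 t) => t1; case: (ltP t s) => t2; case: (ltP t (2 * s)) => t3;
    case: (leP 0 (t - s)) => t4; case: (ltP (t - s) s) => t5; rewrite /= ?addr0 ?add0r//; exfalso; lra.
have IE r y : \1_(hsq r) y = (0 <= y.1 < r)%R%:R * (0 <= y.2 < r)%R%:R :> R.
  rewrite indicE; have [h|h] := pselect (hsq r y).
    by rewrite mem_set//; move/hsqP: h => [-> ->]; rewrite mulr1.
  rewrite memNset//; case: (boolP (0 <= y.1 < r)) => h1; last by rewrite mul0r.
  case: (boolP (0 <= y.2 < r)) => h2; last by rewrite mulr0.
  by case: h; apply/hsqP.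
rewrite !IE /corner /= !mulr1 !mulr0 !subr0 !I1; ring.
Qed.

Variables (u : plane R -> R) (g : 'I_2 -> plane R -> R) (A C q L : R).
Hypotheses (mu_ : pmeas u) (mg : forall j, pmeas (g j)) (A0 : 0 <= A).
Hypotheses (iu : intle (fun x => u x ^+ 2) A) (ig : forall j, intle (fun x => g j x ^+ 2) A).
Hypotheses (q2 : 2 < q) (gq : forall j, intle (fun x => `|g j x| `^ q) C).
Hypotheses (L0 : 0 < L) (uL : forall x, ~ obox L x -> u x = 0).
Hypothesis approx : forall e, 0 < e -> exists phi, [/\ smooth phi,
  intle (fun x => (u x - phi x) ^+ 2) e & forall j, intle (fun x => ('D_(dir j) phi x - g j x) ^+ 2) e].

Let C0 : 0 <= C. Proof. exact: intle_ge0 (gq ord0). Qed.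

(** Equal to 3 (1 + 16 (2 A + 2) + 1): u is compared with an approximation at distance r, whose
    increment is bounded by [translate]. *)
Let B2 := 6 + 96 * (A + 1).
Let B20 : 0 <= B2. Proof. by rewrite addr_ge0// mulr_ge0// addr_ge0. Qed.

Let translate_u (h : plane R) r : 0 < r -> r <= 1 -> `|h.1| <= r -> `|h.2| <= r ->
  intle (fun x => (u (x + h) - u x) ^+ 2) (B2 * r ^+ 2).
Proof.
move=> r0 r1 h1 h2; have rr0 : 0 < r ^+ 2 by rewrite exprn_gt0.
have [phi [sphi iup iD]] := approx rr0.
have iDphi j : intle (fun x => 'D_(dir j) phi x ^+ 2) (2 * A + 2).
  apply: (@intle_weak _ _ (2 * A + 2 * r ^+ 2)).
    by rewrite lerD2l ler_piMr// exprn_ile1// ltW.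
  apply: intle_mono (intleD (intleZ (ler0n R 2) (ig j)) (intleZ (ler0n R 2) (iD j))).
    by apply: pmeasX; apply: pmeas_smooth; exact: smooth_D.
  move=> x; rewrite sqr_ge0/=; set a := 'D_(_) _ _.
  by apply: le_trans (sqrD_le (g j x) (a - g j x)); rewrite addrC subrK.
have H := intleZ (ler0n R 3) (intleD (intleD (intle_shift h iup) (translate sphi h1 h2 iDphi)) iup).
apply: intle_mono; last apply: intle_weak H.
- apply: pmeasX; exact: pmeasB (pmeas_shift h mu_) mu_.
- move=> x; rewrite sqr_ge0/=; set u' := u (x + h); set p' := phi (x + h); set p := phi x.
  rewrite -subr_ge0.
  have -> : 3 * ((u' - p') ^+ 2 + (p' - p) ^+ 2 + (u x - p) ^+ 2) - (u' - u x) ^+ 2 =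
     (u' - p' - (p' - p)) ^+ 2 + (u' - p' + (u x - p)) ^+ 2 + (p' - p + (u x - p)) ^+ 2 by ring.
  by rewrite !addr_ge0 ?sqr_ge0.
by rewrite /B2 le_eqVlt; apply/orP; left; apply/eqP; ring.
Qed.

Let hsq_sqr (s t : R) f e : 0 < s -> s <= 1 -> 0 < t -> pmeas f -> intle (fun x => f x ^+ 2) e -> e <= t ^+ 2 ->
  intle (fun v => \1_(hsq s) v * `|f v|) (2 * t).
Proof.
move=> s0 s1 t0 mf fe et; have tV : 0 < t^-1 by rewrite invr_gt0.
have H := intleD (intleZ (ltW t0) (intle_indic_hsq s0)) (intleZ (ltW tV) fe).
apply: intle_mono; last apply: intle_weak H.
- by apply: pmeasM; [apply: measurable_indic; exact: measurable_hsq|exact: pmeas_norm].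
- move=> v; rewrite mulr_ge0//=.
  have := amgm (\1_(hsq s) v) (f v) t0.
  rewrite normrM (ger0_norm (_ : 0 <= \1_(hsq s) v))//.
  by rewrite (_ : \1_(hsq s) v ^+ 2 = \1_(hsq s) v)// indicE; case: (_ \in _); rewrite ?expr1n ?expr0n.
have : t^-1 * e <= t by rewrite ler_pdivrMl// -expr2.
have : t * s ^+ 2 <= t by rewrite ler_piMr ?(ltW t0)// exprn_ile1// ltW.
lra.
Qed.

Let grad_hsq (s : R) (x : plane R) j : 0 < s ->
  intle (fun v => \1_(hsq s) v * `|g j (v + x)|) ((1 + C) * s `^ (2 - 2 / q)).
Proof.
move=> s0; have q0 : 0 < q by apply: lt_trans q2; rewrite ltr0n.
have q1 : 1 <= q by apply: ltW; apply: lt_trans q2; rewrite ltr1n.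
(* With this c both terms of [le_cst_powR] have the order s^(2 - 2/q) that Hölder's inequality
   gives: c s^2 and c^(1-q). *)
pose c := s `^ (- (2 / q)).
have c0 : 0 < c by exact: powR_gt0.
have H := intleD (intleZ (ltW c0) (intle_indic_hsq s0)) (intleZ (powR_ge0 c (1 - q)) (intle_shift x (gq j))).
apply: intle_mono; last apply: intle_weak H.
- by apply: pmeasM; [apply: measurable_indic; exact: measurable_hsq|apply: pmeas_norm; exact: pmeas_shift].
- move=> v; rewrite mulr_ge0//=.
  have h := le_cst_powR q1 (normr_ge0 (g j (v + x))) c0.
  rewrite indicE; case: (_ \in _) => /=; rewrite ?mul1r ?mulr1.
    exact: h.
  by rewrite mul0r mulr0 add0r mulr_ge0 ?powR_ge0.
have e1 : c * s ^+ 2 = s `^ (2 - 2 / q).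
  rewrite -(powR_mulrn 2 (ltW s0)) /c -powRD; last by rewrite (gt_eqF s0) implybT.
  by rewrite addrC.
have e2 : c `^ (1 - q) = s `^ (2 - 2 / q).
  rewrite /c -powRrM; congr (_ `^ _); field; exact: lt0r_neq0.
by rewrite e1 e2 le_eqVlt; apply/orP; left; apply/eqP; ring.
Qed.

(** For a smooth approximation the increment is a line integral of the derivative, and each
    translate of the derivative is controlled by [grad_hsq]. The approximation at distance t costs 6
    t, removed by [intle_lim]. *)
Let increment (s : R) (x : plane R) j : 0 < s -> s <= 1 ->
  intle (fun v => \1_(hsq s) v * `|u (v + x + s *: dir j) - u (v + x)|)
    (s * ((1 + C) * s `^ (2 - 2 / q))).
Proof.
move=> s0 s1; apply: (@intle_lim _ _ _ 6) => // t t0 t1.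
have tt : 0 < t ^+ 2 by rewrite exprn_gt0.
have [phi [sphi iup iD]] := approx tt.
have mD : pmeas ('D_(dir j) phi) by apply: pmeas_smooth; exact: smooth_D.
have mphi : pmeas phi by exact: pmeas_smooth.
have mI : pmeas (\1_(hsq s) : plane R -> R) by apply: measurable_indic; exact: measurable_hsq.
pose K := (1 + C) * s `^ (2 - 2 / q) + 2 * t.
have K0 : 0 <= K by rewrite /K addr_ge0// ?mulr_ge0 ?powR_ge0 ?addr_ge0 ?(ltW t0).
have bD (y : plane R) : intle (fun v => \1_(hsq s) v * `|'D_(dir j) phi (v + y)|) K.
  have h1 := grad_hsq y j s0.
  have m2 : pmeas (fun v => 'D_(dir j) phi (v + y) - g j (v + y)).
    exact: pmeasB (pmeas_shift y mD) (pmeas_shift y (mg j)).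
  have h2 := hsq_sqr s0 s1 t0 m2 (intle_shift y (iD j)) (lexx _).
  apply: intle_mono (intleD h1 h2).
    by apply: pmeasM => //; apply: pmeas_norm; exact: (pmeas_shift y mD).
  move=> v; rewrite mulr_ge0//= -mulrDr ler_wpM2l//.
  by rewrite -[X in `|X| <= _](subrKC (g j (v + y))) ler_normD.
have bphi : intle (fun v => \1_(hsq s) v * `|phi (v + x + s *: dir j) - phi (v + x)|) (K * s).
  pose F (z : @mplane R * measurableTypeR R) : R := \1_(hsq s) z.1 * `|'D_(dir j) phi (z.1 + x + z.2 *: dir j)|.
  pose w (t : measurableTypeR R) : R := \1_(`[0, s] : set R) t.
  apply: (@intle_tonelli _ _ _ mu w F _ K s) => //.
  - by apply: measurable_indic; exact: measurable_itv.
  - have -> : (\int[mu]_t (w t)%:E = mu `[0%R, s])%E by rewrite integral_indic// setIT.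
    by rewrite lebesgue_measure_itv/= lte_fin s0 -EFinD subr0.
  - apply: measurable_funM; first exact: (measurableT_comp mI measurable_fst).
    apply: measurableT_comp => //.
    have := measurableT_comp (pmeas_shift x mD) (measurable_plane_line (dir j)).
    apply: eq_measurable_fun => z _ /=; congr ('D_(dir j) phi _).
    by rewrite addrAC.
  - by move=> z; rewrite /F mulr_ge0.
  - move=> t' _; have [_ _ h] := bD (x + t' *: dir j); apply: le_trans h.
    by rewrite le_eqVlt; apply/orP; left; apply/eqP; apply: eq_integral => v _; rewrite /F /= addrA.
  - apply: pmeasM => //; apply: pmeas_norm; apply: pmeasB; last exact: pmeas_shift.
    have := pmeas_shift (x + s *: dir j) mphi; congr pmeas; apply/funext => v; by rewrite addrA.
  move=> v; rewrite EFinM; have h := line_abs j sphi (v + x) s0.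
  apply: (@le_trans _ _ ((\1_(hsq s) v)%:E * (\int[mu]_(t in `[0%R, s]) (`|'D_(dir j) phi (v + x + t *: dir j)|)%:E))%E).
    by apply: lee_wpmul2l => //; rewrite lee_fin.
  have mf : measurable_fun setT (fun t : measurableTypeR R => `|'D_(dir j) phi (v + x + t *: dir j)|).
    apply: measurableT_comp => //; apply: (@continuous_measurable_fun R).
    by apply: (@continuous_line R ('D_(dir j) phi)); apply: smooth_continuous; exact: smooth_D.
  rewrite integral_in_indic -ge0_integralZl_EFin//; first last.
  - by apply/measurable_EFinP; apply: measurable_funM => //; apply: measurable_indic; exact: measurable_itv.
  rewrite le_eqVlt; apply/orP; left; apply/eqP; apply: eq_integral => t' _.
  by rewrite /F /w /= -EFinM; congr (_%:E); ring.
have iup' y := hsq_sqr s0 s1 t0 (pmeasB (pmeas_shift y mu_) (pmeas_shift y mphi)) (intle_shift y iup) (lexx _).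
have H := intleD (intleD bphi (iup' (x + s *: dir j))) (iup' x).
apply: intle_mono; last apply: intle_weak H.
- apply: pmeasM => //; apply: pmeas_norm; apply: pmeasB; last exact: pmeas_shift.
  have := pmeas_shift (x + s *: dir j) mu_; congr pmeas; apply/funext => v; by rewrite addrA.
- move=> v; rewrite mulr_ge0//= -!mulrDr ler_wpM2l//.
  rewrite !addrA; set u' := u (v + x + _); set p' := phi (v + x + _); set p := phi (v + x).
  rewrite (_ : u' - u (v + x) = p' - p + (u' - p') - (u (v + x) - p)); last by ring.
  by rewrite (le_trans (ler_normB _ _))// lerD2r ler_normD.
rewrite /K; have : 2 * t * s <= 2 * t by rewrite ler_piMr// mulr_ge0// ltW.
set X := (1 + C) * _ => h; have -> : (X + 2 * t) * s = s * X + 2 * t * s by ring.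
by move: h; set Y := s * X; set W := 2 * t * s; lra.
Qed.

Let mI s : pmeas (\1_(hsq s) : plane R -> R).
Proof. by apply: measurable_indic; exact: measurable_hsq. Qed.

Let iav (s : R) x : 0 < s -> s <= 1 ->
  (leb2 R).-integrable setT (EFin \o (fun v => \1_(hsq s) v * u (v + x))).
Proof.
move=> s0 s1; have A1 : 0 < A + 1 by rewrite ltr_wpDl.
have AA : A <= (A + 1) ^+ 2.
  have h1 : A <= A + 1 by rewrite lerDl.
  by apply: (le_trans h1); rewrite expr2 ler_peMr ?(ltW A1)// lerDr.
have H := hsq_sqr s0 s1 A1 (pmeas_shift x mu_) (intle_shift x iu) AA.
have m1 : pmeas (fun v => \1_(hsq s) v * u (v + x)) by apply: pmeasM => //; exact: (pmeas_shift x mu_).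
have le v : `|\1_(hsq s) v * u (v + x)| <= \1_(hsq s) v * `|u (v + x)|.
  by rewrite normrM (ger0_norm (_ : 0 <= \1_(hsq s) v)).
by have [] := intle_integrable m1 le H.
Qed.

Let av (s : R) x := (s ^+ 2)^-1 * \int[leb2 R]_v (\1_(hsq s) v * u (v + x)).

Let av_diff (s : R) x h B : 0 < s -> s <= 1 ->
  intle (fun v => \1_(hsq s) v * `|u (v + x + h) - u (v + x)|) B ->
  `|av s (x + h) - av s x| <= (s ^+ 2)^-1 * B.
Proof.
move=> s0 s1 H; rewrite /av -mulrBr normrM ger0_norm ?invr_ge0 ?sqr_ge0// ler_wpM2l ?invr_ge0 ?sqr_ge0//.
rewrite -(RintegralB measurableT (iav (x + h) s0 s1) (iav x s0 s1)).
have mm : pmeas (fun v => \1_(hsq s) v * u (v + (x + h)) - \1_(hsq s) v * u (v + x)).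
  by apply: pmeasB; apply: pmeasM => //; exact: (pmeas_shift _ mu_).
have le v : `|\1_(hsq s) v * u (v + (x + h)) - \1_(hsq s) v * u (v + x)| <=
    \1_(hsq s) v * `|u (v + x + h) - u (v + x)|.
  by rewrite -mulrBr normrM (ger0_norm (_ : 0 <= \1_(hsq s) v))// addrA.
by have [] := intle_integrable mm le H.
Qed.

(** Morrey's Hölder exponent in dimension two. *)
Let gm := 1 - 2 / q.

Let av_dir (s : R) x j : 0 < s -> s <= 1 -> `|av s (x + s *: dir j) - av s x| <= (1 + C) * s `^ gm.
Proof.
move=> s0 s1; apply: le_trans (av_diff s0 s1 (increment x j s0 s1)) _.
have -> : s `^ (2 - 2 / q) = s * s `^ gm.
  rewrite -{2}(powRr1 (ltW s0)) -powRD; last by rewrite (gt_eqF s0) implybT.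
  by congr (_ `^ _); rewrite /gm; ring.
rewrite le_eqVlt; apply/orP; left; apply/eqP; field; exact: lt0r_neq0.
Qed.

Let av_corner (s : R) x a b : 0 < s -> s <= 1 -> `|av s (x + corner s a b) - av s x| <= 2 * (1 + C) * s `^ gm.
Proof.
move=> s0 s1; have K0 : 0 <= (1 + C) * s `^ gm by rewrite mulr_ge0 ?powR_ge0// addr_ge0.
have cE (c d : bool) : corner s c d = (if c then s *: dir ord0 else 0) + (if d then s *: dir ord_max else 0).
  rewrite (plane_dir (corner s c d)) /corner /=.
  by congr (_ + _); [case: c|case: d]; rewrite ?mulr1 ?mulr0 ?scale0r.
have e2 : 2 * (1 + C) * s `^ gm = (1 + C) * s `^ gm + (1 + C) * s `^ gm by ring.
rewrite cE addrA e2; set y := x + _.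
have h1 : `|av s y - av s x| <= (1 + C) * s `^ gm.
  by rewrite /y; case: (a); [exact: av_dir|rewrite addr0 subrr normr0].
have h2 z : `|av s (z + (if b then s *: dir ord_max else 0)) - av s z| <= (1 + C) * s `^ gm.
  by case: (b); [exact: av_dir|rewrite addr0 subrr normr0].
rewrite -(subrK (av s y) (av s (y + _))) -addrA (le_trans (ler_normD _ _))//.
by apply: lerD; [exact: h2|exact: h1].
Qed.

Let av_double (s : R) x : 0 < s -> 2 * s <= 1 ->
  av (2 * s) x = 4^-1 * (av s x + av s (x + corner s true false) + av s (x + corner s false true) + av s (x + corner s true true)).
Proof.
move=> s0 s1; have s1' : s <= 1 by lra.
have sh c : \int[leb2 R]_v (\1_(hsq s) (v - c) * u (v + x)) = \int[leb2 R]_v (\1_(hsq s) v * u (v + (x + c))).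
  have i1 := iav (x + c) s0 s1'.
  rewrite -(Rintegral_shift (- c) i1); apply: eq_Rintegral => v _.
  by rewrite [x + c]addrC addrA subrK.
have ish c : (leb2 R).-integrable setT (EFin \o (fun v => \1_(hsq s) (v - c) * u (v + x))).
  have [m1 [K hK]] := integrable_intle (iav (x + c) s0 s1').
  have := intle_shift (- c) hK => hK'.
  have m2 : pmeas (fun v => \1_(hsq s) (v - c) * u (v + x)).
    by apply: pmeasM; [exact: (pmeas_shift (- c) (mI s))|exact: (pmeas_shift x mu_)].
  have le v : `|\1_(hsq s) (v - c) * u (v + x)| <= `|\1_(hsq s) (v - c) * u (v - c + (x + c))|.
    by rewrite [x + c]addrC addrA subrK.
  by have [] := intle_integrable m2 le hK'.
have i0 := iav x s0 s1'.
have D (f1 f2 : plane R -> R) : (leb2 R).-integrable setT (EFin \o f1) -> (leb2 R).-integrable setT (EFin \o f2) ->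
  (leb2 R).-integrable setT (EFin \o (fun v => f1 v + f2 v)).
  by move=> h1 h2; have := integrableD measurableT h1 h2; apply: eq_integrable.
rewrite /av; have -> : \int[leb2 R]_v (\1_(hsq (2 * s)) v * u (v + x)) =
   \int[leb2 R]_v (\1_(hsq s) v * u (v + x) + \1_(hsq s) (v - corner s true false) * u (v + x) +
   \1_(hsq s) (v - corner s false true) * u (v + x) + \1_(hsq s) (v - corner s true true) * u (v + x)).
  by apply: eq_Rintegral => v _; rewrite indic_hsq_double//; ring.
rewrite (RintegralD measurableT (D _ _ (D _ _ i0 (ish _)) (ish _)) (ish _)).
rewrite (RintegralD measurableT (D _ _ i0 (ish _)) (ish _)) (RintegralD measurableT i0 (ish _)).
rewrite !sh; field; exact: lt0r_neq0.
Qed.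

Let av_step (s : R) x : 0 < s -> 2 * s <= 1 -> `|av (2 * s) x - av s x| <= 2 * (1 + C) * s `^ gm.
Proof.
move=> s0 s1; have s1' : s <= 1 by lra.
have K0 : 0 <= 2 * (1 + C) * s `^ gm by rewrite !mulr_ge0 ?powR_ge0// addr_ge0.
rewrite av_double//.
have h1 := av_corner x true false s0 s1'; have h2 := av_corner x false true s0 s1'; have h3 := av_corner x true true s0 s1'.
move: h1 h2 h3; set a1 := av s (x + corner s true false); set a2 := av s (x + corner s false true).
set a3 := av s (x + corner s true true); set a0 := av s x; set K := 2 * _ * _ in K0 *.
rewrite !ler_norml => /andP[? ?] /andP[? ?] /andP[? ?]; apply/andP; split; lra.
Qed.

(** The constant blows up as s tends to 0; it serves for the continuity of each average, and
    uniformity in s comes from the dyadic steps. *)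
Let av_lipschitz (s r : R) x h : 0 < s -> s <= 1 -> 0 < r -> r <= 1 -> `|h.1| <= r -> `|h.2| <= r ->
  `|av s (x + h) - av s x| <= (s ^+ 2)^-1 * (2 * (B2 + 1)) * r.
Proof.
move=> s0 s1 r0 r1 h1 h2; have B0 : 0 < B2 + 1 by rewrite ltr_wpDl.
have t0 : 0 < (B2 + 1) * r by rewrite mulr_gt0.
have e : B2 * r ^+ 2 <= ((B2 + 1) * r) ^+ 2.
  rewrite exprMn ler_wpM2r ?sqr_ge0//.
  have B1 : 1 <= B2 + 1 by rewrite lerDr.
  apply: (@le_trans _ _ (B2 + 1)); first by rewrite lerDl.
  by rewrite expr2 ler_peMr// ltW.
have mm : pmeas (fun v => u (v + x + h) - u (v + x)).
  have := pmeasB (pmeas_shift h mu_) mu_ => /(pmeas_shift x); exact.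
have H := hsq_sqr s0 s1 t0 mm (intle_shift x (translate_u r0 r1 h1 h2)) e.
by have := av_diff s0 s1 H; rewrite !mulrA.
Qed.

Let av_continuous (s : R) : 0 < s -> s <= 1 -> continuous (av s).
Proof.
move=> s0 s1 x; apply/cvgrPdist_lt => e e0.
pose K := (s ^+ 2)^-1 * (2 * (B2 + 1)).
have K0 : 0 < K by rewrite mulr_gt0 ?invr_gt0 ?exprn_gt0// mulr_gt0// ltr_wpDl.
pose r := Num.min 1 (e / (2 * K)).
have r0 : 0 < r by rewrite lt_min ltr01 divr_gt0// mulr_gt0.
have r1 : r <= 1 by rewrite ge_min lexx.
have re : K * r < e.
  have : r <= e / (2 * K) by rewrite ge_min lexx orbT.
  have K2 : 0 < 2 * K by rewrite mulr_gt0.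
  rewrite ler_pdivlMr// => h.
  by rewrite mulrC; lra.
exists (ball x.1 r, ball x.2 r); first by split; exact: nbhsx_ballx.
move=> y [/= y1 y2].
rewrite distrC -[y](subrKC x); set h := y - x.
apply: le_lt_trans re; apply: av_lipschitz => //.
- by apply: ltW; rewrite /h /= distrC.
- by apply: ltW; rewrite /h /= distrC.
Qed.

Let B3 := 4 * (L + 1) ^+ 2 + B2.

(** The difference is a mean of increments u(x + v) - u(x) with v in the square. Each is O(s) in L^2
    by [translate_u] and vanishes outside the box of half-side L + 1, hence is O(s) in L^1. *)
Let av_L1 (s : R) : 0 < s -> s <= 1 -> intle (fun x => `|av s x - u x|) (B3 * s).
Proof.
move=> s0 s1; have ss : 0 < (s ^+ 2)^-1 by rewrite invr_gt0 exprn_gt0.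
have mav : pmeas (av s) by apply: pmeas_continuous; exact: av_continuous.
have mE : pmeas (fun x => `|av s x - u x|) by apply: pmeas_norm; exact: pmeasB.
pose w (v : @mplane R) : R := (s ^+ 2)^-1 * \1_(hsq s) v.
pose F (z : @mplane R * @mplane R) : R := `|u (z.1 + z.2) - u z.1|.
have B30 : 0 <= B3 by rewrite /B3 addr_ge0// mulr_ge0// sqr_ge0.
have mF : measurable_fun setT F.
  apply: measurableT_comp => //; apply: measurable_funB.
    exact: (measurableT_comp mu_ measurable_add_plane).
  exact: (measurableT_comp mu_ measurable_fst).
have mw : measurable_fun setT w by apply: pmeasM => //; exact: measurable_cst.
have w0 v : 0 <= w v by rewrite /w mulr_ge0// ltW.
rewrite -[B3 * s]mulr1.
apply: (@intle_tonelli _ _ _ (@sleb2 R) w F _ (B3 * s) 1 mw w0) => //.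
- have [_ _ h] := intleZ (ltW ss) (intle_indic_hsq s0); apply: le_trans h _.
  by rewrite lee_fin mulVf ?lexx// expf_neq0// gt_eqF.
- by move=> z; exact: normr_ge0.
- by rewrite mulr_ge0// ltW.
- move=> v; rewrite /w => wv.
  have /hsqP[/andP[v1 v1s] /andP[v2 v2s]] : hsq s v.
    by apply: contrapT => nv; move: wv; rewrite indicE memNset// mulr0 eqxx.
  have n1 : `|v.1| <= s by rewrite ger0_norm// ltW.
  have n2 : `|v.2| <= s by rewrite ger0_norm// ltW.
  have L1 : 0 < L + 1 by rewrite addr_gt0.
  have sV : 0 < s^-1 by rewrite invr_gt0.
  have H := intleD (intleZ (ltW s0) (intle_indic_obox L1)) (intleZ (ltW sV) (translate_u s0 s1 n1 n2)).
  have [] // : intle (fun x => `|u (x + v) - u x|) (B3 * s).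
  apply: intle_mono; last apply: intle_weak H.
  + by apply: pmeas_norm; exact: pmeasB (pmeas_shift v mu_) mu_.
  + move=> x; rewrite normr_ge0/=.
    have [xL|xL] := pselect (obox (L + 1) x).
      rewrite indicE mem_set//.
      by have := amgm 1 (u (x + v) - u x) s0; rewrite mul1r expr1n.
    have o1 : ~ obox L x.
      by move=> /oboxP[p1 p2]; apply: xL; apply/oboxP; split; lra.
    have o2 : ~ obox L (x + v).
      move=> /oboxP[p1 p2]; apply: xL; apply/oboxP; split.
        by rewrite -(addrK v.1 x.1) (le_lt_trans (ler_normB _ _))//; move: p1 => /=; lra.
      by rewrite -(addrK v.2 x.2) (le_lt_trans (ler_normB _ _))//; move: p2 => /=; lra.
    by rewrite !uL// subrr normr0 addr_ge0 ?mulr_ge0 ?sqr_ge0 ?(ltW s0) ?(ltW sV).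
  by rewrite /B3 le_eqVlt; apply/orP; left; apply/eqP; field; exact: lt0r_neq0.
move=> x.
have i0 := iav x s0 s1.
have i1 : (leb2 R).-integrable setT (EFin \o (fun v => \1_(hsq s) v * u x)).
  have m1 : pmeas (fun v => \1_(hsq s) v * u x) by apply: pmeasM => //; exact: measurable_cst.
  have le v : `|\1_(hsq s) v * u x| <= `|u x| * \1_(hsq s) v.
    by rewrite normrM (ger0_norm (_ : 0 <= \1_(hsq s) v))// mulrC.
  by have [] := intle_integrable m1 le (intleZ (normr_ge0 (u x)) (intle_indic_hsq s0)).
have ux : u x = (s ^+ 2)^-1 * \int[leb2 R]_v (\1_(hsq s) v * u x).
  rewrite RintegralZr//; last first.
    have [m1 _ _] := intle_indic_hsq s0.
    have le v : `|\1_(hsq s) v| <= \1_(hsq s) v :> R by rewrite ger0_norm.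
    by have [] := intle_integrable m1 le (intle_indic_hsq s0).
  rewrite /Rintegral [X in fine X](pint_indic_hsq s0)/= mulrA mulVf ?mul1r//.
  by rewrite expf_neq0// gt_eqF.
have -> : `|av s x - u x| = (s ^+ 2)^-1 * `|\int[leb2 R]_v (\1_(hsq s) v * (u (v + x) - u x))|.
  rewrite {1}ux /av -mulrBr normrM (gtr0_norm ss) -(RintegralB measurableT i0 i1).
  by congr (_ * `| _ |); apply: eq_Rintegral => v _; rewrite mulrBr.
have m3 : pmeas (fun v => \1_(hsq s) v * (u (v + x) - u x)).
  by apply: pmeasM => //; apply: pmeasB; [exact: (pmeas_shift x mu_)|exact: measurable_cst].
have -> : (\int[sleb2 (R:=R)]_t (w t * F (x, t))%:E = ((s ^+ 2)^-1)%:E *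
    \int[leb2 R]_v (`|\1_(hsq s) v * (u (v + x) - u x)|)%:E)%E.
  rewrite -ge0_integralZl_EFin ?(ltW ss)//; last by apply/measurable_EFinP; exact: measurableT_comp.
  apply: eq_integral => v _; rewrite -EFinM /w /F /= normrM (ger0_norm (_ : 0 <= \1_(hsq s) v))//.
  by rewrite -mulrA [x + v]addrC.
rewrite EFinM; apply: lee_wpmul2l; first by rewrite lee_fin ltW.
have i3 : (leb2 R).-integrable setT (EFin \o (fun v => \1_(hsq s) v * (u (v + x) - u x))).
  have := integrableB measurableT i0 i1; apply: eq_integrable => // v _ /=.
  by rewrite mulrBr EFinB.
have fin := integrable_fin_num measurableT i3.
rewrite /Rintegral -[in X in (X <= _)%E]abse_EFin fineK//.
by apply: le_abse_integral => //; exact/measurable_EFinP.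
Qed.

(* The averages over squares of sides s and 2s differ by O(s^gm), so the dyadic averages
   converge uniformly; their limit is [u] almost everywhere. *)
Lemma morrey : exists U : plane R -> R, continuous U /\ {ae leb2 R, forall x, u x = U x}.
Proof.
have q0 : 0 < q by apply: lt_trans q2; rewrite ltr0n.
have gm0 : 0 < gm by rewrite /gm subr_gt0 ltr_pdivrMr// mul1r.
have h0 : 0 < 2^-1 :> R by rewrite invr_gt0.
have h1 : 2^-1 < 1 :> R by rewrite invf_lt1// ltr1n.
pose be : R := 2^-1 `^ gm.
have be0 : 0 < be by exact: powR_gt0.
have be1 : be < 1.
  have : be < 1 `^ gm by apply: gt0_ltr_powR => //; rewrite nnegrE ?ler01// ltW.
  by rewrite powR1.
pose s k : R := 2^-1 ^+ k.
have s0 k : 0 < s k by exact: exprn_gt0.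
have s1 k : s k <= 1 by rewrite exprn_ile1// ltW.
pose a k x := av (s k) x.
pose Dc := 2 * (1 + C).
have Dc0 : 0 <= Dc by rewrite mulr_ge0// addr_ge0.
have step k x : `|a k x - a k.+1 x| <= Dc * be ^+ k.+1.
  have e2 : 2 * s k.+1 = s k by rewrite /s exprS mulrA divff ?mul1r// pnatr_eq0.
  have := @av_step (s k.+1) x (s0 _); rewrite e2 => /(_ (s1 k)).
  by rewrite /s powR_exprn ?(ltW h0).
have b1 : 0 < 1 - be by rewrite subr_gt0.
pose C' := Dc * be / (1 - be).
have C'0 : 0 <= C' by apply: divr_ge0; [apply: mulr_ge0 => //|]; exact: ltW.
have C'E k : C' * be ^+ k - C' * be ^+ k.+1 = Dc * be ^+ k.+1.
  by rewrite /C' exprS; field; exact: lt0r_neq0.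
pose b k x := a k x + C' * be ^+ k.
pose c k x := a k x - C' * be ^+ k.
have bdec x n k : b (n + k)%N x <= b n x.
  elim: k => [|k IH]; first by rewrite addn0.
  rewrite addnS; apply: le_trans IH; have := step (n + k)%N x; rewrite ler_norml => /andP[h2 _].
  have := C'E (n + k)%N; rewrite /b; move: h2; set X := Dc * _; set Y := C' * _; set Z := C' * _; lra.
have cinc x n k : c n x <= c (n + k)%N x.
  elim: k => [|k IH]; first by rewrite addn0.
  rewrite addnS; apply: (le_trans IH); have := step (n + k)%N x; rewrite ler_norml => /andP[_ h2].
  have := C'E (n + k)%N; rewrite /c; move: h2; set X := Dc * _; set Y := C' * _; set Z := C' * _; lra.
have cb x n k : c n x <= b k x.
  apply: le_trans (cinc x n k) _; apply: le_trans (bdec x k n); rewrite addnC /c /b.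
  have : 0 <= C' * be ^+ (k + n) by rewrite mulr_ge0// exprn_ge0// ltW.
  lra.
pose U x := inf (range (fun k => b k x)).
have Ub x n : U x <= b n x.
  by apply: ge_inf; [exists (c 0%N x) => _ [k _ <-]|exists n].
have Uc x n : c n x <= U x.
  by apply: lb_le_inf; [exists (b 0%N x), 0%N|move=> _ [k _ <-]].
have Ua x n : `|U x - a n x| <= C' * be ^+ n.
  by rewrite ler_norml; have := Ub x n; have := Uc x n; rewrite /b /c => ? ?; apply/andP; split; lra.
have small e : 0 < e -> exists n, C' * be ^+ n < e.
  move=> e0; have cv : (C' * be ^+ n) @[n --> \oo] --> (0 : R).
    rewrite -[X in _ --> X](mulr0 C'); apply: cvgMr; apply: cvg_expr.
    by rewrite gtr0_norm.
  move/cvgrPdist_lt: cv => /(_ e e0)[N _ hN]; exists N.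
  have := hN N (leqnn N); rewrite /= sub0r normrN ger0_norm//.
  by rewrite mulr_ge0// exprn_ge0// ltW.
exists U; split.
  move=> x; apply/cvgrPdist_lt => e e0.
  have e3 : 0 < e / 3 by rewrite divr_gt0.
  have [n hn] := small _ e3.
  have ca : {for x, continuous (a n)} by exact: av_continuous.
  move/cvgrPdist_lt: ca => /(_ _ e3).
  apply: filterS => y hy.
  have ux := Ua x n; have uy := Ua y n.
  have -> : U x - U y = (U x - a n x) + (a n x - a n y) - (U y - a n y) by ring.
  rewrite (le_lt_trans (ler_normB _ _))//; have hD := ler_normD (U x - a n x) (a n x - a n y).
  by move: ux uy hy hn hD; set X := `|U x - _|; set Y := `|U y - _|; set Z := `|a n x - a n y|; set W := `|_ + _|; set V := C' * _; lra.
have B31 : 0 < B3 + 1.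
  by rewrite ltr_wpDl// /B3 addr_ge0// mulr_ge0// sqr_ge0.
(* The side s n is 2^-n, so after division by a constant the L^1 distance has the rate that
   [ae_small] requires. *)
have H n : intle (fun x => (B3 + 1)^-1 * `|a n x - u x|) (2^-1 ^+ n).
  apply: intle_weak (intleZ _ (av_L1 (s0 n) (s1 n))); last by rewrite invr_ge0 ltW.
  rewrite mulrA ler_piMl ?(ltW (s0 n))// ler_pdivrMl// mulr1 lerDl//.
apply: aeS (ae_small H) => x hx.
apply/eqP; rewrite -subr_eq0 -normr_le0; apply/ler_addgt0Pr => e e0; rewrite add0r.
have e2 : 0 < e / 2 by rewrite divr_gt0.
have [n0 hn0] := small _ e2.
have e4 : 0 < (B3 + 1)^-1 * (e / 2) by rewrite mulr_gt0 ?invr_gt0.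
have [n1 _ hn1] := hx _ e4.
pose n := (n0 + n1)%N.
have /= h2 := hn1 n (leq_addl _ _).
rewrite ltr_pM2l ?invr_gt0// in h2.
have h3 : C' * be ^+ n < e / 2.
  apply: le_lt_trans hn0; rewrite ler_wpM2l// ler_wiXn2l ?(ltW be0) ?(ltW be1)// /n leq_addr//.
have h4 := Ua x n.
have -> : u x - U x = - (a n x - u x) - (U x - a n x) by ring.
apply: le_trans (ler_normB _ _) _; rewrite normrN.
by move: h2 h3 h4; set X := `|a n x - _|; set Y := `|U x - _|; set V := C' * _; lra.
Qed.

End Morrey.

(** * The adjoint state *)

Section Extension.
Context {R : realType} {Omega : set (plane R)}.
Implicit Types f g : plane R -> R.

Lemma sqr_add_le (a b g g' : R) : g + g' = 0 ->
  (a + b) ^+ 2 <= 2 * (a - g) ^+ 2 + 2 * (b - g') ^+ 2.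
Proof.
move=> g0; apply: le_trans (sqrD_le _ _); rewrite le_eqVlt; apply/orP; left; apply/eqP.
by congr (_ ^+ 2); rewrite addrACA -opprD g0 subr0.
Qed.

Lemma uniform_bound (I : finType) (f : I -> plane R -> R) :
  (forall i, exists C, intle (f i) C) -> exists C, forall i, intle (f i) C.
Proof.
move=> /choice[C hC]; exists (\sum_i C i) => i; apply: intle_weak (hC i).
by rewrite (bigD1 i)//= lerDl sumr_ge0// => k _; exact: intle_ge0 (hC k).
Qed.

Lemma Lq_intle q f : measO Omega f -> (exists C, intle (ext0 Omega (fun x => `|f x| `^ q)) C) -> Lq Omega q f.
Proof.
move=> mf [C /intle_lty h]; split => //.
rewrite integral_mkcond; apply: le_lt_trans h; rewrite le_eqVlt; apply/orP; left; apply/eqP.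
by apply: eq_integral => x _; rewrite /ext0 !patchE; case: ifP.
Qed.

Lemma ext0_exp f n x : (ext0 Omega f x) ^+ n.+1 = ext0 Omega (fun x => f x ^+ n.+1) x.
Proof. by have [Ox|Ox] := pselect (Omega x); [rewrite !ext0_in|rewrite !ext0_out// expr0n]. Qed.

Lemma ext0_add0 f g x : (Omega x -> f x + g x = 0) -> ext0 Omega f x + ext0 Omega g x = 0.
Proof. by move=> h; have [Ox|Ox] := pselect (Omega x); [rewrite !ext0_in// h|rewrite !ext0_out// addr0]. Qed.

End Extension.

Lemma ord2_cases (k : 'I_2) : k = ord0 \/ k = lift ord0 ord0.
Proof. by case: k => -[|[|//]] hk; [left|right]; apply/val_inj. Qed.

Section Adjoint.
Context {R : realType}.
Variables (Omega : set (plane R)) (l : nat) (D : 'I_l -> plane R) (alpha nu : R).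
Hypotheses (a0 : 0 < alpha) (a2 : alpha < 2) (nu0 : 0 < nu).
Variable L : R.
Hypotheses (L0 : 0 < L) (OL : Omega `<=` obox L) (oO : open Omega).
Hypotheses (OD : forall t, Omega (D t)) (lO : lipschitz_boundary Omega).
Local Notation ext := (ext0 Omega).
Local Notation rh := (rho Omega D alpha).
Local Notation irh := (irho Omega D alpha).
Variables (yO y z : vfield R) (P : plane R -> R).
Hypotheses (hyO : L2v Omega (fun=> 1) yO) (hy : H01v Omega rh y)
  (hz : adjoint_solution Omega D nu alpha yO y z P).

Local Notation Z i := (ext (vcomp z i)).
Local Notation Y i := (ext (vcomp y i)).
Local Notation G i j := (ext (wpartial Omega j (vcomp z i))).
Local Notation DY i j := (ext (wpartial Omega j (vcomp y i))).
Local Notation F i := (ext (fun x => vcomp y i x - vcomp yO i x)).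

Let zH : H01v Omega irh z. Proof. by have [] := hz. Qed.
Let mrh := measurable_rho Omega D alpha.
Let mirh := measurable_irho Omega D alpha.
Let rh0 := rho_ge0 Omega D alpha.
Let irh0 := irho_ge0 Omega D alpha.

Let myO i : measO Omega (vcomp yO i). Proof. by have [] := hyO i. Qed.
Let mP : measO Omega P. Proof. by have [_ []] := hz. Qed.
Let mz i : measO Omega (vcomp z i). Proof. exact: H01v_measO zH. Qed.
Let my i : measO Omega (vcomp y i). Proof. exact: H01v_measO hy. Qed.
Let mG i j : measO Omega (wpartial Omega j (vcomp z i)).
Proof. exact: wpartial_measO (H01v_wpartial i j zH). Qed.
Let mDY i j : measO Omega (wpartial Omega j (vcomp y i)).
Proof. exact: wpartial_measO (H01v_wpartial i j hy). Qed.

(** The divergence of z is itself an admissible multiplier: it is square integrable and the weight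
    is bounded, so it belongs to L^2(rho). Tested against itself it has square integral zero. *)
Lemma divergence_free : aeO Omega (wdiv Omega z) (fun=> 0).
Proof.
have [_ _ _ hdiv] := hz.
have E : wdiv Omega z = fun x => wpartial Omega ord0 (vcomp z ord0) x +
    wpartial Omega (lift ord0 ord0) (vcomp z (lift ord0 ord0)) x.
  by apply/funext => x; rewrite /wdiv /mxtrace !big_ord_recl big_ord0 addr0 !mxE.
have mD : measO Omega (wdiv Omega z).
  by rewrite E; apply: measurable_funD; exact: wpartial_measO (H01v_wpartial _ _ zH).
have [c c0 unw] := unweight a0 L0 OL oO OD.
have [C hC] : exists C, intle (ext (fun x => wdiv Omega z x ^+ 2)) C.
  have /choice[Ci hCi] : forall i, exists C, intle (ext (fun x => wpartial Omega i (vcomp z i) x ^+ 2 * irh x)) C.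
    by move=> i; exact: H01v_grad_L2.
  have mg i := wpartial_measO (H01v_wpartial i i zH).
  have h i := unw _ _ (mg i) (hCi i).
  exists (2 * (c * Ci ord0 + c * Ci (lift ord0 ord0))).
  rewrite E; exact: intle_sqrD (mg ord0) (mg (lift ord0 ord0)) (h _) (h _).
move: (wdiv Omega z) mD C hC hdiv => {E}d mD C hC hdiv.
have [M M0 hM] := rho_bounded a0 L0 OL OD.
have := hdiv d; move=> /(_ _)/wrap[].
  apply/(L2w_intle oO mrh rh0); split => //; exists (M * C).
  apply: intle_mono (intleZ (ltW M0) hC); first by apply: measO_ext0 => //; exact: measO_sqrw.
  move=> x; rewrite ext0_ge0 ?andTb; last by move=> u; rewrite mulr_ge0// sqr_ge0.
  have [Ox|Ox] := pselect (Omega x); last by rewrite !ext0_out// mulr0.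
  by rewrite !ext0_in// mulrC ler_wpM2r ?sqr_ge0// hM.
move=> I0; apply: intle_sqr_ae0 => //.
apply: intO_intle => //; last by rewrite -[X in _ <= X]I0.
- by move=> x; exact: sqr_ge0.
- exact: measurable_funX.
- by exists C.
Qed.

(** With p = (m+1)/m these are bounds on y in L^(2p) and on the inverse weight in L^p, written as
    (m+1)-th powers of the base c that [young_pow] takes. *)
Lemma source_bounds m : (1 < m)%N -> alpha * (m.+1%:R / m.-1%:R) < 2 ->
  exists A, [/\ forall i, intle (fun x => F i x ^+ 2) A, intle (fun x => (ext P x) ^+ 2) A,
    forall i, intle (fun x => (`|Y i x| `^ (2 / m%:R)) ^+ m.+1) A,
    forall i j, intle (fun x => DY i j x ^+ 2 * rh x) A &
    intle (fun x => (ext irh x `^ (m%:R^-1)) ^+ m.+1) A].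
Proof.
move=> m1 am; have m0 : (0 < m)%N by exact: ltn_trans m1.
have mR : 0 < m%:R :> R by rewrite ltr0n.
have m'R : 0 < m.-1%:R :> R by rewrite ltr0n -subn1 subn_gt0.
have mE : m%:R = m.-1%:R + 1 :> R by rewrite natr1 prednK.
pose p : R := m.+1%:R / m%:R.
have pE : p = 1 + m%:R^-1 by rewrite /p -natr1 mulrDl divff ?mul1r// gt_eqF.
have p1 : 1 < p by rewrite pE ltrDl invr_gt0.
have p2 : p < 2.
  rewrite pE (_ : 2 = 1 + 1)// ltrD2l invf_lt1//; by rewrite ltr1n.
have psE : p / (2 - p) = m.+1%:R / m.-1%:R.
  rewrite (_ : 2 - p = m.-1%:R / m%:R); last by rewrite pE mE; field; rewrite -mE gt_eqF.
  by rewrite /p; field; rewrite !gt_eqF.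
have [Cy hCy] := field_powR a0 L0 OL oO OD hy p1 p2 (eq_ind_r (fun t => alpha * t < 2) am psE).
have cy i : intle (fun x => (`|Y i x| `^ (2 / m%:R)) ^+ m.+1) Cy.
  apply: intle_ext (hCy i) => x; have e : 2 / m%:R * m.+1%:R = p * 2 :> R by rewrite /p; field; exact: lt0r_neq0.
  have [Ox|Ox] := pselect (Omega x).
    by rewrite !ext0_in// -powR_mulrn ?powR_ge0// -powRrM e.
  by rewrite !ext0_out// normr0 powR0 ?expr0n// mulf_neq0// invr_neq0// gt_eqF.
have pb : 0 < p by exact: lt_trans p1.
have abp : alpha * p < 2.
  apply: le_lt_trans am; rewrite ler_pM2l// /p ler_pM2l// ?ltr0n// lef_pV2 ?posrE//.
  by rewrite ler_nat leq_pred.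
have [Ci hCi] := intle_irho_powR D a0 L0 OL oO pb abp.
have ci : intle (fun x => (ext irh x `^ (m%:R^-1)) ^+ m.+1) Ci.
  apply: intle_ext hCi => x; have e : m%:R^-1 * m.+1%:R = p by rewrite mulrC.
  have [Ox|Ox] := pselect (Omega x).
    by rewrite !ext0_in// -powR_mulrn ?powR_ge0// -powRrM e.
  by rewrite !ext0_out// powR0 ?expr0n// invr_neq0// gt_eqF.
have [CD cD] : exists C, forall ij : 'I_2 * 'I_2, intle (fun x => DY ij.1 ij.2 x ^+ 2 * rh x) C.
  apply: uniform_bound => -[i j] /=.
  have [C hC] := H01v_grad_L2 oO i j mrh rh0 hy; exists C; apply: intle_ext hC => x.
  by have [Ox|Ox] := pselect (Omega x); [rewrite !ext0_in|rewrite !ext0_out// expr0n mul0r].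
have [c c0 unw] := unweight a0 L0 OL oO OD.
have [CP cP] : exists C, intle (fun x => (ext P x) ^+ 2) C.
  have [_ /(L2w_intle oO mirh irh0 _).1[_ [C hC]] _ _] := hz.
  exists (c * C); apply: intle_ext (unw _ _ mP hC) => x; by rewrite ext0_exp.
have [CF cF] : exists C, forall i, intle (fun x => F i x ^+ 2) C.
  apply: uniform_bound => i.
  have [C1 h1] : exists C, intle (ext (fun x => vcomp y i x ^+ 2)) C.
    exists (4 * L ^+ 2 + Cy); apply: intle_mono (intleD (intle_indic_obox L0) (hCy i)).
      by apply: measO_ext0 => //; apply: measurable_funX; exact: my.
    move=> x; rewrite ext0_ge0 ?andTb; last by move=> u; exact: sqr_ge0.
    have [Ox|Ox] := pselect (Omega x); last by rewrite !ext0_out// addr0.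
    rewrite !ext0_in// indicE mem_set; last exact: OL.
    rewrite -sqr_powR; have [t1|t1] := leP 1 `|vcomp y i x|.
      rewrite (le_trans (ler_powR t1 (_ : 2 <= p * 2))) ?lerDr//.
      by rewrite ler_peMl// ltW.
    rewrite -[X in X <= _]addr0 lerD ?powR_ge0//.
    by rewrite sqr_powR -real_normK ?num_real// exprn_ile1// ltW.
  have [C2 h2] : exists C, intle (ext (fun x => (- vcomp yO i x) ^+ 2)) C.
    have h1w := (L2w_intle oO (measurable_cst (1 : R)) (fun=> ler01) (vcomp yO i)).1 (hyO i).
    have [_ [C hC]] := h1w; exists C; apply: intle_ext hC => x.
    by have [Ox|Ox] := pselect (Omega x); [rewrite !ext0_in// mulr1 sqrrN|rewrite !ext0_out].
  have mN : measO Omega (fun x => - vcomp yO i x) by exact: (measurableT_comp (@oppr_measurable R setT)) (myO i).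
  exists (2 * (C1 + C2)); apply: intle_ext (intle_sqrD oO (my i) mN h1 h2) => x.
  by rewrite ext0_exp.
have Cy0 := intle_ge0 (cy ord0); have Ci0 := intle_ge0 ci; have CD0 := intle_ge0 (cD (ord0, ord0)).
have CP0 := intle_ge0 cP; have CF0 := intle_ge0 (cF ord0).
exists (CF + CP + Cy + CD + Ci); split.
- move=> i; apply: intle_weak (cF i); lra.
- apply: intle_weak cP; lra.
- move=> i; apply: intle_weak (cy i); lra.
- move=> i j; apply: intle_weak (cD (i, j)); lra.
- apply: intle_weak ci; lra.
Qed.

Lemma solution_bounds k : exists A, (forall i, intle (fun x => (Z i x ^+ k.+1) ^+ 2) A) /\
  (forall i j, intle (fun x => G i j x ^+ 2) A).
Proof.
have [Cz hCz] := field_pow a0 a2 L0 OL oO OD k zH.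
have [c c0 unw] := unweight a0 L0 OL oO OD.
have [CG cG] : exists C, forall ij : 'I_2 * 'I_2, intle (fun x => G ij.1 ij.2 x ^+ 2) C.
  apply: uniform_bound => -[i j] /=.
  have [C hC] := H01v_grad_L2 oO i j mirh irh0 zH; exists (c * C).
  by apply: intle_ext (unw _ _ (mG i j) hC) => x; rewrite ext0_exp.
have C0 := intle_ge0 (hCz ord0); have C1 := intle_ge0 (cG (ord0, ord0)).
exists (Cz + CG); split => [i|i j].
- apply: (@intle_weak _ _ Cz); first lra.
  by apply: intle_ext (hCz i) => x; rewrite ext0_exp ext0_exp.
- apply: intle_weak (cG (i, j)); lra.
Qed.

Lemma unweighted_approx e : 0 < e -> exists phi, [/\ test_field Omega phi,
  forall i, intle (fun x => (Z i x - vcomp phi i x) ^+ 2) e &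
  forall i j, intle (fun x => ('D_(dir j) (vcomp phi i) x - G i j x) ^+ 2) e].
Proof.
move=> e0; have [c c0 unw] := unweight a0 L0 OL oO OD.
have [Cw iw] := intle_irho D a0 a2 L0 OL oO.
have ec0 : 0 < e / c by rewrite divr_gt0.
have [phi [tphi h1 h2]] := H01v_approx oO mirh irh0 iw zH ec0.
have ec : c * (e / c) = e by rewrite mulrC divfK// gt_eqF.
exists phi; split => // [i|i j].
  have mf : measO Omega (fun x => vcomp z i x - vcomp phi i x).
    by apply: measurable_funB; [exact: mz|exact: test_measO (tphi i)].
  have := unw _ _ mf (h1 i); rewrite ec; apply: intle_ext => x.
  by rewrite -(ext0_exp _ 1) ext0B (ext0_test x (tphi i)).
have tD := test_D j (tphi i).
have mf : measO Omega (fun x => wpartial Omega j (vcomp z i) x - 'D_(dir j) (vcomp phi i) x).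
  by apply: measurable_funB; [exact: mG|exact: test_measO tD].
have := unw _ _ mf (h2 i j); rewrite ec; apply: intle_ext => x.
by rewrite -(ext0_exp _ 1) ext0B (ext0_test x tD) -sqrrN opprB.
Qed.

(** B is chosen before r: the approximating field may change with the scale, but the constants of
    the translation estimate may not. *)
Lemma approximant_bounds k k' : exists B, forall r, 0 < r -> r <= 1 -> exists phi, [/\ test_field Omega phi,
  forall i j, intle (fun x => 'D_(dir j) (vcomp phi i) x ^+ 2) B,
  forall i j, intle (fun x => ('D_(dir j) (vcomp phi i) x - G i j x) ^+ 2) (r ^+ 2),
  (forall i, intle (fun x => (vcomp phi i x ^+ k.+1) ^+ 2) B) /\
  (forall i, intle (fun x => (vcomp phi i x ^+ k'.+1) ^+ 2) B) &
  intle (fun x => (\sum_i 'D_(dir i) (vcomp phi i) x) ^+ 2) (B * r ^+ 2)].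
Proof.
have [CZ [hZ hG]] := solution_bounds 0.
have CZ0 := intle_ge0 (hG ord0 ord0).
pose A := 2 * CZ + 2.
have [S1 hS1] := sobolev_pow A k L0; have [S2 hS2] := sobolev_pow A k' L0.
exists (A + 4 + `|S1| + `|S2|) => r r0 r1.
have rr0 : 0 < r ^+ 2 by rewrite exprn_gt0.
have [phi [tphi d1 d2]] := unweighted_approx rr0.
have rr : r ^+ 2 <= 1 by rewrite exprn_ile1// ltW.
have bD i j : intle (fun x => 'D_(dir j) (vcomp phi i) x ^+ 2) A.
  apply: (@intle_weak _ _ (2 * CZ + 2 * r ^+ 2)); first by rewrite /A; lra.
  apply: intle_mono (intleD (intleZ (ler0n R 2) (hG i j)) (intleZ (ler0n R 2) (d2 i j))).
    by apply: pmeasX; apply: pmeas_smooth; exact: test_smooth (test_D j (tphi i)).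
  move=> x; rewrite sqr_ge0/=; set a := 'D_(_) _ _.
  by apply: le_trans (sqrD_le (G i j x) (a - G i j x)); rewrite addrC subrK.
have bP i : intle (fun x => vcomp phi i x ^+ 2) A.
  apply: (@intle_weak _ _ (2 * CZ + 2 * r ^+ 2)); first by rewrite /A; lra.
  apply: intle_mono (intleD (intleZ (ler0n R 2) (hZ i)) (intleZ (ler0n R 2) (d1 i))).
    by apply: pmeasX; apply: pmeas_smooth; exact: test_smooth (tphi i).
  move=> x; rewrite sqr_ge0/= expr1.
  have := sqrD_le (Z i x) (- (Z i x - vcomp phi i x)); by rewrite sqrrN opprB addrC subrK.
exists phi; split => //.
- by move=> i j; apply: intle_weak (bD i j); have := normr_ge0 S1; have := normr_ge0 S2; lra.
- have A0 : 0 <= A by rewrite /A; lra.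
  have n1 := normr_ge0 S1; have n2 := normr_ge0 S2; have m1 := ler_norm S1; have m2 := ler_norm S2.
  split=> i.
    apply: (@intle_weak _ _ S1); first lra.
    exact: hS1 (test_smooth (tphi i)) (test_supp_box OL (tphi i)) (bP i) (bD i).
  apply: (@intle_weak _ _ S2); first lra.
  exact: hS2 (test_smooth (tphi i)) (test_supp_box OL (tphi i)) (bP i) (bD i).
(* As z is divergence free, the divergence of phi is the sum of two approximation errors, each of
   square integral at most r^2. *)
apply: (@intle_weak _ _ (2 * r ^+ 2 + 2 * r ^+ 2)).
  have : 4 * r ^+ 2 <= (A + 4 + `|S1| + `|S2|) * r ^+ 2.
    by rewrite ler_wpM2r ?sqr_ge0// /A; have := normr_ge0 S1; have := normr_ge0 S2; lra.
  lra.
pose l0 : 'I_2 := lift ord0 ord0.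
apply: intle_mono_ae (intleD (intleZ (ler0n R 2) (d2 ord0 ord0)) (intleZ (ler0n R 2) (d2 l0 l0))) _ _ _.
- apply: pmeasX; apply: pmeas_sum => i; apply: pmeas_smooth; exact: test_smooth (test_D i (tphi i)).
- by move=> x; exact: sqr_ge0.
apply: aeS (divergence_free) => x hx.
have g0 : G ord0 ord0 x + G l0 l0 x = 0.
  apply: ext0_add0 => Ox; rewrite -(hx Ox).
  by rewrite /wdiv /mxtrace !big_ord_recl big_ord0 addr0 !mxE.
rewrite !big_ord_recl big_ord0 addr0; exact: sqr_add_le g0.
Qed.

Lemma adjoint_integrand (w : vfield R) x :
  nu * frob (wgrad Omega z x) (wgrad Omega w x)
  - dot (y x *m (wgrad Omega z x)^T) (w x) + dot (z x *m wgrad Omega y x) (w x) - P x * wdiv Omega w x =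
  nu * (\sum_i \sum_j wpartial Omega j (vcomp z i) x * wpartial Omega j (vcomp w i) x)
  - \sum_i \sum_j vcomp y j x * wpartial Omega j (vcomp z i) x * vcomp w i x
  + \sum_j \sum_i vcomp z i x * wpartial Omega j (vcomp y i) x * vcomp w j x
  - P x * \sum_i wpartial Omega i (vcomp w i) x.
Proof.
congr (_ * _ - _ + _ - _ * _).
- by apply: eq_bigr => i _; apply: eq_bigr => j _; rewrite !mxE.
- rewrite /dot; apply: eq_bigr => i _; rewrite mxE mulr_suml; apply: eq_bigr => j _.
  by rewrite !mxE.
- rewrite /dot; apply: eq_bigr => i _; rewrite mxE mulr_suml; apply: eq_bigr => j _.
  by rewrite !mxE.
- by apply: eq_bigr => i _; rewrite mxE.
Qed.

(** The adjoint equation on the whole plane: all fields are extended by zero, and the weak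
    derivatives of the test field are exchanged almost everywhere for the classical ones. *)
Lemma weak_identity (v : vfield R) : test_field Omega v ->
  \int[leb2 R]_x (nu * (\sum_i \sum_j G i j x * 'D_(dir j) (vcomp v i) x)
    - \sum_i \sum_j Y j x * G i j x * vcomp v i x + \sum_j \sum_i Z i x * DY i j x * vcomp v j x
    - ext P x * \sum_i 'D_(dir i) (vcomp v i) x) = \int[leb2 R]_x (\sum_i F i x * vcomp v i x).
Proof.
move=> tv; have [Cw iw] := intle_rho a0 L0 OL oO OD.
have [_ _ /(_ v)] := hz.
move=> /(_ (test_H01v oO mrh rh0 iw tv)) + _.
have mv i : measO Omega (vcomp v i) by exact: test_measO (tv i).
have mD i j : measO Omega ('D_(dir j) (vcomp v i)) by exact: test_measO (test_D j (tv i)).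
have sv i : smooth (vcomp v i) by exact: test_smooth (tv i).
have mw i j : measO Omega (wpartial Omega j (vcomp v i)).
  by apply: (@wpartial_measO _ _ _ _ ('D_(dir j) (vcomp v i))); exact: is_wpartial_smooth.
have wE i j : aeO Omega (wpartial Omega j (vcomp v i)) ('D_(dir j) (vcomp v i)).
  exact: wpartial_smooth.
under [X in X = _ -> _]eq_Rintegral do rewrite adjoint_integrand.
rewrite [intO Omega (fun x => dot _ _)]intO_ext0 => E.
transitivity (\int[leb2 R]_x ext (fun x =>
  nu * (\sum_i \sum_j wpartial Omega j (vcomp z i) x * wpartial Omega j (vcomp v i) x)
  - \sum_i \sum_j vcomp y j x * wpartial Omega j (vcomp z i) x * vcomp v i x
  + \sum_j \sum_i vcomp z i x * wpartial Omega j (vcomp y i) x * vcomp v j x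
  - P x * \sum_i wpartial Omega i (vcomp v i) x) x).
  apply: Rintegral_ae.
  - apply: pmeasB; [apply: pmeasD; [apply: pmeasB|]|].
    + apply: pmeasM; first exact: measurable_cst.
      do 2 (apply: pmeas_sum => ?); apply: pmeasM; first by apply: measO_ext0.
      by apply: pmeas_smooth; exact: smooth_D.
    + do 2 (apply: pmeas_sum => ?); apply: pmeasM; last exact: pmeas_smooth.
      by apply: pmeasM; apply: measO_ext0.
    + do 2 (apply: pmeas_sum => ?); apply: pmeasM; last exact: pmeas_smooth.
      by apply: pmeasM; apply: measO_ext0.
    + apply: pmeasM; first exact: measO_ext0.
      by apply: pmeas_sum => ?; apply: pmeas_smooth; exact: smooth_D.
  - apply: measO_ext0 => //.
    apply: measOB; [apply: measOD; [apply: measOB|]|].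
    + apply: measOM; first exact: measurable_cst.
      by do 2 (apply: measO_sum => ?); apply: measOM; [exact: mG|exact: mw].
    + by do 2 (apply: measO_sum => ?); apply: measOM; [apply: measOM; [exact: my|exact: mG]|exact: mv].
    + by do 2 (apply: measO_sum => ?); apply: measOM; [apply: measOM; [exact: mz|exact: mDY]|exact: mv].
    + by apply: measOM => //; apply: measO_sum => ?; exact: mw.
  have H := aeI (aeI (wE ord0 ord0) (wE ord0 (lift ord0 ord0)))
    (aeI (wE (lift ord0 ord0) ord0) (wE (lift ord0 ord0) (lift ord0 ord0))).
  have {}H : {ae leb2 R, forall x, Omega x -> forall i j, wpartial Omega j (vcomp v i) x = 'D_(dir j) (vcomp v i) x}.
    apply: aeS H => x [[e1 e2] [e3 e4]] Ox i j.
    move: (e1 Ox) (e2 Ox) (e3 Ox) (e4 Ox) => {}e1 {}e2 {}e3 {}e4.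
    by have [->|->] := ord2_cases i; have [->|->] := ord2_cases j.
  apply: aeS H => x hx; have [Ox|Ox] := pselect (Omega x); last first.
    rewrite [RHS]ext0_out// (ext0_out P Ox) mul0r subr0.
    have s1 : \sum_i \sum_j G i j x * 'D_(dir j) (vcomp v i) x = 0.
      by apply: big1 => i _; apply: big1 => j _; rewrite (ext0_out (wpartial Omega j (vcomp z i)) Ox) mul0r.
    have s2 : \sum_i \sum_j Y j x * G i j x * vcomp v i x = 0.
      by apply: big1 => i _; apply: big1 => j _; rewrite (ext0_out (vcomp y j) Ox) !mul0r.
    have s3 : \sum_j \sum_i Z i x * DY i j x * vcomp v j x = 0.
      by apply: big1 => j _; apply: big1 => i _; rewrite (ext0_out (vcomp z i) Ox) !mul0r.
    have zero (k s t u : R) : s = 0 -> t = 0 -> u = 0 -> k * s - t + u = 0.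
      by move=> -> -> ->; rewrite mulr0 subrr addr0.
    exact: zero s1 s2 s3.
  rewrite [RHS]ext0_in//; congr (_ * _ - _ + _ - _ * _).
  - by apply: eq_bigr => i _; apply: eq_bigr => j _; rewrite (ext0_in _ Ox) hx.
  - by apply: eq_bigr => i _; apply: eq_bigr => j _; rewrite (ext0_in (vcomp y j) Ox) (ext0_in (wpartial Omega j (vcomp z i)) Ox).
  - by apply: eq_bigr => j _; apply: eq_bigr => i _; rewrite (ext0_in (vcomp z i) Ox) (ext0_in (wpartial Omega j (vcomp y i)) Ox).
  - by rewrite (ext0_in _ Ox).
  - by apply: eq_bigr => i _; rewrite hx.
rewrite -intO_ext0 [LHS]E; apply: eq_Rintegral => x _.
have [Ox|Ox] := pselect (Omega x).
  by rewrite ext0_in// /dot; apply: eq_bigr => i _; rewrite (ext0_in _ Ox) !mxE.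
by rewrite ext0_out// big1// => i _; rewrite (ext0_out _ Ox) mul0r.
Qed.

(** N depends on alpha alone and is fixed before x0, so the local gains of integrability have a
    common exponent. *)
Lemma adjoint_translate : exists2 N : nat, (0 < N)%N & forall x0, closure Omega x0 ->
  exists (b : R) (e : plane R) (d : R) (K : R),
    [/\ 0 < b, 0 < d <= 1 /\ (`|e.1| <= 1 /\ `|e.2| <= 1), 0 <= K &
    forall (th : R) (h : plane R), 0 < th -> th <= 1 -> th ^+ N <= b ->
      `|h.1 - th ^+ N * e.1| <= th ^+ N * d -> `|h.2 - th ^+ N * e.2| <= th ^+ N * d ->
      forall i j, intle (fun x => cutoff x0 b x * (G i j (x + h) - G i j x) ^+ 2) (K * th)].
Proof.
have [m m1 am] := exponent_exists a0 a2; exists (4 * m.+1)%N => // x0 cx0.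
have [b [e [d [b0 d01 [e1 e2] out]]]] := outward_closure oO lO cx0.
have m0 : (0 < m)%N by exact: ltn_trans m1.
have [A1 [bF bP bY bD bI]] := source_bounds m1 am.
have [A2 [bZ bG]] := solution_bounds (2 * m).+1.
(* These give the powers 2m+1 and 4m+3 of phi, which the interpolation [iw] needs for the powers m+1
   and 2m+2 of the increment in [T2] and [T3]. *)
have [B hB] := approximant_bounds m.*2 ((2 * m).+1).*2.
have [M M0 hM] : exists2 M, 0 < M & forall j x, `|'D_(dir j) (cutoff x0 b) x| <= M.
  have [M1 M10 h1] := test_bounded (test_D ord0 (test_cutoff x0 b)).
  have [M2 M20 h2] := test_bounded (test_D (lift ord0 ord0) (test_cutoff x0 b)).
  exists (M1 + M2); first by rewrite addr_gt0.
  move=> j x; have [->|->] := ord2_cases j.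
  - by rewrite (le_trans (h1 x))// lerDl ltW.
  - by rewrite (le_trans (h2 x))// lerDr ltW.
have n1 := normr_ge0 A1; have n2 := normr_ge0 A2; have nB := normr_ge0 B.
have l1 := ler_norm A1; have l2 := ler_norm A2; have lB := ler_norm B.
pose A := 1 + `|A1| + `|A2| + `|B| + M.
have A1A : A1 <= A by rewrite /A; lra.
have A2A : A2 <= A by rewrite /A; lra.
have BA : B <= A by rewrite /A; lra.
have MA : M <= A by rewrite /A; lra.
have oneA : 1 <= A by rewrite /A; lra.
exists b, e, d, `|gradK nu A m|; split => // th h th0 th1.
set r := th ^+ (4 * m.+1) => rb h1 h2 i j.
have /andP[d0 d1] := d01.
have r0 : 0 < r by rewrite exprn_gt0.
have r1 : r <= 1 by rewrite exprn_ile1// ltW.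
have [phi [tphi p1 p2 [p3 p4] p5]] := hB r r0 r1.
have hb (u v : R) : `|v| <= 1 -> `|u - r * v| <= r * d -> `|u| <= 2 * r.
  move=> v1 uv; rewrite -(subrK (r * v) u) (le_trans (ler_normD _ _))//.
  have rd : r * d <= r by rewrite ler_piMr// ltW.
  have rv : `|r * v| <= r by rewrite normrM (gtr0_norm r0) ler_piMr// ltW.
  by move: uv rd rv; set t := `|u - _|; set s := `|r * v|; set q := r * d; lra.
apply: (@intle_weak _ _ (gradK nu A m * th)); first by rewrite ler_wpM2r ?(ltW th0)// ler_norm.
have sphi k : smooth (vcomp phi k) by exact: test_smooth (tphi k).
have schi := smooth_cutoff x0 b.
pose v : vfield R := fun x => \row_k (cutoff x0 b x * (vcomp phi k (x + h) - vcomp phi k x)).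
have vE k : vcomp v k = fun x => cutoff x0 b x * (vcomp phi k (x + h) - vcomp phi k x).
  by apply/funext => x; rewrite /vcomp mxE.
have tv : test_field Omega v.
  move=> k; rewrite vE.
  apply: (test_translate out schi _ _ h1 h2 (tphi k)); last by rewrite r0.
  by move=> x; exact: cutoff_out.
have W := weak_identity tv.
apply: (grad_translate nu0 oneA m0 schi (cutoff_bound x0 b) _
  (Z := fun i => Z i) (Y := fun i => Y i) (F := fun i => F i) (G := fun i j => G i j) (DY := fun i j => DY i j)
  (P := ext P) (rh := rh) (irh := ext irh) (phi := vcomp phi) _ _ _ _ _ _ _ _ _ _ _ _ _ _ _ th0 th1 (erefl r)).
- by move=> k x; exact: le_trans MA.
- by move=> k; exact: measO_ext0.
- by move=> k; exact: measO_ext0.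
- by move=> k; apply: measO_ext0 => //; apply: measOB; [exact: my|exact: myO].
- by move=> k k'; exact: measO_ext0.
- by move=> k k'; exact: measO_ext0.
- exact: measO_ext0.
- by move=> k; exact: intle_weak (bF k).
- exact: intle_weak bP.
- by move=> k k'; exact: intle_weak (bG k k').
- by move=> k; apply: intle_weak A2A _; rewrite mulnS; exact: bZ.
- by move=> k; exact: intle_weak (bY k).
- by move=> k k'; exact: intle_weak (bD k k').
- by apply: ext0_ge0 => x; exact: irho_ge0.
- exact: intle_weak bI.
- move=> k k'; apply: aeS (rho_gt0_ae Omega D alpha) => x x0' DYx; split => //.
  have [Ox|Ox] := pselect (Omega x); first by rewrite ext0_in.
  by move: DYx; rewrite ext0_out// eqxx.
- exact: hb h1.
- exact: hb h2.
- exact: sphi.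
- by move=> k k'; exact: intle_weak (p1 k k').
- exact: p2.
- by move=> k; exact: intle_weak (p3 k).
- by move=> k; exact: intle_weak (p4 k).
- by apply: intle_weak p5; rewrite ler_wpM2r// sqr_ge0.
transitivity (\int[leb2 R]_x (\sum_k F k x * vcomp v k x)); last first.
  by apply: eq_Rintegral => x _; apply: eq_bigr => k _; rewrite vE.
rewrite -W; apply: eq_Rintegral => x _.
have dv k k' : 'D_(dir k') (vcomp v k) x = 'D_(dir k') (cutoff x0 b) x * (vcomp phi k (x + h) - vcomp phi k x)
   + cutoff x0 b x * ('D_(dir k') (vcomp phi k) (x + h) - 'D_(dir k') (vcomp phi k) x).
  rewrite vE derive_product//; last by apply: smoothB => //; exact: smooth_shift.
  by rewrite derive_increment.
congr (_ * _ - _ + _ - _ * _).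
- by apply: eq_bigr => k _; apply: eq_bigr => k' _; rewrite dv.
- by apply: eq_bigr => k _; apply: eq_bigr => k' _; rewrite vE.
- by apply: eq_bigr => k _; apply: eq_bigr => k' _; rewrite vE.
- by apply: eq_bigr => k _; rewrite dv.
Qed.

(** The upper bound on q allows z itself to be controlled in L^q by its fourth power. *)
Lemma adjoint_gradient_Lq : exists q : R, [/\ 2 < q, q <= 4 &
  forall i j, exists C, intle (fun x => `|G i j x| `^ q) C].
Proof.
have [N N0 HN] := adjoint_translate.
have [A [_ bG]] := solution_bounds 0.
have N1 : 0 < (2 * N)%:R^-1 :> R by rewrite invr_gt0 ltr0n muln_gt0.
have N2 : (2 * N)%:R^-1 <= 1 :> R by rewrite invf_le1 ?ltr0n ?ler1n muln_gt0.
have q0 : 2 + (2 * N)%:R^-1 != 0 :> R by rewrite gt_eqF//; lra.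
exists (2 + (2 * N)%:R^-1); split; [lra|lra|move=> i j].
have A0 : 0 < `|A| + 1 by rewrite ltr_wpDl.
have fA : intle (fun x => G i j x ^+ 2) (`|A| + 1).
  by apply: intle_weak (bG i j); rewrite (le_trans (ler_norm _))// lerDl.
have mGe : pmeas (G i j) by exact: measO_ext0.
have /choice[chi hchi] : forall x0, exists chi : plane R -> R, [/\ forall x, 0 <= chi x, continuous chi &
    closure Omega x0 -> 0 < chi x0 /\ exists C, intle (fun x => chi x * `|G i j x| `^ (2 + (2 * N)%:R^-1)) C].
  move=> x0; have [cx0|nx0] := pselect (closure Omega x0); last first.
    by exists (fun=> 0); split => // x; exact: cvg_cst.
  have [b [e [d [K [b0 [/andP[d0 _] _] K0 H]]]]] := HN x0 cx0.
  exists (cutoff x0 b); split=> [x||_].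
  - by have /andP[] := cutoff_bound x0 b x.
  - by apply: smooth_continuous; exact: smooth_cutoff.
  split; first exact: cutoff_gt0.
  apply: (higher_integrability (e := e) mGe _ (cutoff_bound x0 b) A0 K0 d0 b0 N0 fA).
    by apply: pmeas_smooth; exact: smooth_cutoff.
  by move=> th h t0 t1 tb h1 h2; exact: (H th h t0 t1 tb h1 h2 i j).
have c1 x u : 0 <= chi x u by have [h _ _] := hchi x.
have c2 x : continuous (chi x) by have [_ h _] := hchi x.
have c3 x : closure Omega x -> 0 < chi x x /\ exists C, intle (fun y => chi x y * `|G i j y| `^ (2 + (2 * N)%:R^-1)) C.
  by have [_ _ h] := hchi x.
apply: (@intle_cover _ Omega L (fun x => `|G i j x| `^ (2 + (2 * N)%:R^-1)) chi OL _ _ _ c1 c2 c3).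
- exact: pmeas_norm_powR.
- by move=> x; exact: powR_ge0.
- by move=> x nOx; rewrite ext0_out// normr0 powR0.
Qed.

Lemma adjoint_W1q (q : R) : 2 < q -> q <= 4 ->
  (forall i j, exists C, intle (fun x => `|G i j x| `^ q) C) -> W1qv Omega q z.
Proof.
move=> q2 q4 hG i; have q0 : q != 0 by rewrite gt_eqF//; lra.
split.
  apply: Lq_intle => //.
  have [A [bZ _]] := solution_bounds 1.
  exists (4 * L ^+ 2 + A); apply: intle_mono (intleD (intle_indic_obox L0) (bZ i)).
    apply: measO_ext0 => //; apply: (measurableT_comp (measurable_powR q)).
    exact: (measurableT_comp (@normr_measurable R setT)) (mz i).
  move=> x; rewrite ext0_ge0 ?andTb; last by move=> u; exact: powR_ge0.
  have [Ox|Ox] := pselect (Omega x); last by rewrite !ext0_out// addr_ge0// sqr_ge0.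
  rewrite !ext0_in// indicE mem_set; last exact: OL.
  have [t1|t1] := leP 1 `|vcomp z i x|.
    apply: (@le_trans _ _ ((vcomp z i x ^+ 2) ^+ 2)); last by rewrite lerDr.
    apply: le_trans (ler_powR t1 q4) _.
    by rewrite powR_mulrn// -(real_normK (num_real (vcomp z i x))) -exprM.
  rewrite -[X in X <= _]addr0 lerD ?sqr_ge0//.
  have -> : true%:R = 1 `^ q by rewrite powR1.
  by rewrite ge0_ler_powR ?nnegrE ?(ltW t1)// (le_trans _ (ltW q2)).
move=> j; exists (wpartial Omega j (vcomp z i)); split; first exact: H01v_wpartial zH.
apply: Lq_intle => //; have [C hC] := hG i j; exists C; apply: intle_ext hC => x.
by have [Ox|Ox] := pselect (Omega x); [rewrite !ext0_in|rewrite !ext0_out// normr0 powR0].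
Qed.

(** Morrey's argument is applied on the whole plane to the extension of z by zero. Being a limit of
    test fields, the extension has the extended gradient as its gradient, and the boundary creates
    no singular part. *)
Lemma adjoint_continuous (q : R) : 2 < q ->
  (forall i j, exists C, intle (fun x => `|G i j x| `^ q) C) -> continuous_on_closure Omega z.
Proof.
move=> q2 hG.
have [A [bZ bG]] := solution_bounds 0.
have A0 : 0 <= A by exact: intle_ge0 (bG ord0 ord0).
have /choice[U hU] : forall i, exists U : plane R -> R, continuous U /\ {ae leb2 R, forall x, Z i x = U x}.
  move=> i.
  have [C hC] : exists C, forall j : 'I_2, intle (fun x => `|G i j x| `^ q) C.
    by apply: uniform_bound => j; exact: hG.
  apply: (morrey (u := Z i) (g := fun j => G i j) _ _ A0 _ (bG i) q2 hC L0).
  - exact: measO_ext0.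
  - by move=> j; exact: measO_ext0.
  - by apply: intle_ext (bZ i) => x; rewrite expr1.
  - by move=> x nx; rewrite ext0_out// => /OL.
  move=> e e0; have [phi [tphi h1 h2]] := unweighted_approx e0.
  by exists (vcomp phi i); split => //; exact: test_smooth (tphi i).
exists (fun x => \row_i U i x); split.
  apply: continuous_subspaceT => x.
  have -> : (fun x => \row_i U i x) = (fun x => U ord0 x *: delta_mx ord0 ord0 +
      U (lift ord0 ord0) x *: delta_mx ord0 (lift ord0 ord0) : 'rV[R]_2).
    apply/funext => u; apply/rowP => k; rewrite !mxE.
    have [->|->] := ord2_cases k.
    - by rewrite !eqxx/= mulr1 mulr0 addr0.
    - by rewrite !eqxx/= mulr1 mulr0 add0r.
  apply: cvgD; apply: cvgZr_tmp.
  - by have [cU _] := hU ord0; exact: cU.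
  - by have [cU _] := hU (lift ord0 ord0); exact: cU.
have [_ e0] := hU ord0; have [_ e1] := hU (lift ord0 ord0).
apply: aeS (aeI e0 e1) => x [h0 h1] Ox; apply/rowP => k; rewrite mxE.
have [->|->] := ord2_cases k.
- by rewrite -h0 ext0_in.
- by rewrite -h1 ext0_in.
Qed.

End Adjoint.

Lemma bounded_obox (R : realType) (Omega : set (plane R)) : bounded_set Omega ->
  exists2 L, 0 < L & Omega `<=` obox L.
Proof.
move=> [M [_ hM]]; exists (`|M| + 2); first by rewrite ltr_wpDl.
move=> x Ox; have : `|x| <= `|M| + 1.
  by apply: (hM (`|M| + 1)) => //; rewrite (le_lt_trans (ler_norm _))// ltrDl.
rewrite prod_normE ge_max => /andP[h1 h2].
by apply/oboxP; split; lra.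
Qed.

Theorem theorem6p1 (R : realType) (Omega : set (plane R))
  (hOmega : lipschitz_domain Omega)
  (l : nat) (hl : (0 < l)%N)
  (D : 'I_l -> plane R) (hDinj : injective D) (hD : forall t, Omega (D t))
  (nu eta : R) (hnu : 0 < nu) (heta : 0 < eta)
  (yO : vfield R) (hyO : L2v Omega (fun=> 1) yO)
  (alpha : R) (halpha : 0 < alpha < 2)
  (a b : 'M[R]_(l, 2)) (hab : forall t i, a t i < b t i)
  (ybar : vfield R) (Ubar : 'M[R]_(l, 2))
  (hloc : local_solution Omega D nu alpha eta yO a b ybar Ubar)
  (hreg : regular Omega nu ybar)
  (pbar : plane R -> R) (hpbar : weak_solution Omega D nu alpha Ubar ybar pbar)
  (OU : set 'M[R]_(l, 2)) (Oy : set (vfield R)) (Op : set (plane R -> R))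
  (Q : 'M[R]_(l, 2) -> vfield R * (plane R -> R))
  (hQ : local_solution_map Omega D nu alpha Ubar ybar pbar OU Oy Op Q)
  (U : 'M[R]_(l, 2)) (hU : OU U)
  (z : vfield R) (r : plane R -> R)
  (hz : adjoint_solution Omega D nu alpha yO (Q U).1 z r) :
  (exists2 q : R, 2 < q & W1qv Omega q z) /\ continuous_on_closure Omega z.
Proof.
have [oO _ bO lO] := hOmega; have [L L0 OL] := bounded_obox bO.
have /andP[a0 a2] := halpha.
have [_ _ _ /(_ _ hU)[_ _ [hy _ _ _] _]] := hQ.
have [q [q2 q4 hG]] := adjoint_gradient_Lq a0 a2 hnu L0 OL oO hD lO hyO hy hz.
split; last exact: (adjoint_continuous a0 a2 L0 OL oO hD hz q2 hG).
exists q => //; exact: (adjoint_W1q a0 a2 L0 OL oO hD hz q2 q4 hG).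
Qed.
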